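(* Let $\mathcal{S}_{ad}$ be a class of open sets in $\mathbb{R}^2$ whose set of admissible support functions $\widetilde{\mathcal{F}_{ad}}=\{h\in W^{1,\infty}(\mathbb{T}):\Omega^h\in\mathcal{S}_{ad}\}$ is given by the constraint $k_1\le h\le k_2$, i.e. $$\widetilde{\mathcal{F}_{ad}}=\{h\in W^{1,\infty}(\mathbb{T}):k_1\le h\le k_2\},$$ with $k_1,k_2:\mathbb{T}\to[0,+\infty]$ respectively upper- and lower-semicontinuous. Let $\Omega_0=\Omega^{h_0}$, $h_0>0$, be an optimal shape for $$\min\{J(\Omega):\Omega\in\mathcal{S}_{ad},\ \Omega\text{ convex}\}$$ with $J=R+C$, and assume that $$\forall h\in\widetilde{\mathcal{F}_{ad}},\quad R(\Omega^h)=r(h)\quad\text{and}\quad C(\Omega^h)=\int_{\mathbb{T}}G(\theta,h(\theta),h'(\theta))\,d\theta,$$ where, for some $p\in[1,\infty]$: $r:W^{1,\infty}(\mathbb{T})\to\mathbb{R}$ is $C^1$ around $h_0$; $G:(\theta,u,q)\in\mathbb{T}\times(0,\infty)\times\mathbb{R}\mapsto G(\theta,u,q)\in\mathbb{R}$ is $C^2$ around $\mathbb{T}\times h_0(\mathbb{T})\times\mathrm{Conv}(h_0'(\mathbb{T}))$; $r'(h_0)\in L^p(\mathbb{T})$; and $G_{qq}>0$ in $\mathbb{T}\times h_0(\mathbb{T})\times\mathrm{Conv}(h_0'(\mathbb{T}))$. Then $h_0\in W^{2,p}(\widetilde{\mathbb{T}_{in}})$, where $\widetilde{\mathbb{T}_{in}}=\{\theta\in\mathbb{T}:k_1(\theta)<h_0(\theta)<k_2(\theta)\}$.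 This implies in particular that $\widetilde{(\partial\Omega_0)_{in}}$ is strictly convex.
   Context: $\mathbb{T}=[0,2\pi)$, with functions on $\mathbb{T}$ (including $G$ in its first variable) regarded as $2\pi$-periodic functions on $\mathbb{R}$; $W^{1,\infty}(\mathbb{T})$ is the space of $2\pi$-periodic functions in $W^{1,\infty}_{loc}(\mathbb{R})$. The support function of a bounded set $\Omega$ is $h_\Omega(\theta)=\max\{x\cdot e^{i\theta}:x\in\Omega\}$ (maximum over the closure, $e^{i\theta}=(\cos\theta,\sin\theta)$). If $\Omega$ is convex, $h_\Omega''+h_\Omega\ge0$; conversely, for $h\in W^{1,\infty}(\mathbb{T})$ with $h''+h\ge0$ (i.e. $\int_{\mathbb{T}}(hv-h'v')\,d\theta\ge0$ for all nonnegative $v\in W^{1,\infty}(\mathbb{T})$), $\Omega^h$ denotes the unique open convex set (an origin being fixed) with support function $h$; conditions involving $\Omega^h$ are understood for $h$ with $h''+h\ge0$, so the problem reads $\min\{J(\Omega^h):h\in\widetilde{\mathcal{F}_{ad}},\ h''+h\ge0\}$. $\mathrm{Conv}(h_0'(\mathbb{T}))$ is the smallest closed interval containing all one-sided derivatives $h_0'(\theta^+),h_0'(\theta^-)$, $\theta\in\mathbb{T}$. ''Around'' means in a neighborhood (in $W^{1,\infty}(\mathbb{T})$ for functionals). ''$r'(h_0)\in L^p(\mathbb{T})$'' means $r'(h_0)v=\int_{\mathbb{T}}g\,v\,d\theta$ for some $g\in L^p(\mathbb{T})$. Finally $$\widetilde{(\partial\Omega_0)_{in}}=\{x\in\partial\Omega_0:\exists\theta\in\widetilde{\mathbb{T}_{in}},\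 x\cdot e^{i\theta}=h_0(\theta)\},$$ i.e. the set of points of $\partial\Omega_0$ having a supporting line orthogonal to $(\cos\theta,\sin\theta)$ for some $\theta\in\widetilde{\mathbb{T}_{in}}$; strictly convex means that it contains no nondegenerate line segment. *)

(* Defs.v *)
From HB Require Import structures.
From mathcomp Require Import all_boot all_order all_algebra.
From mathcomp Require Import all_classical all_reals all_analysis.
Import Order.TTheory GRing.Theory Num.Theory.
Import numFieldNormedType.Exports.

Set Implicit Arguments.
Unset Strict Implicit.
Unset Printing Implicit Defensive.

Local Open Scope classical_set_scope.
Local Open Scope ring_scope.

(* Functions on the circle T = R / 2 pi Z are 2 pi-periodic functions on R,
   and subsets of T are 2 pi-periodic subsets of R.  Integrals and norms over T
   are taken over one period. *)

Section Circle.
Context {R : realType}.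
Implicit Types (f g h v : R -> R) (U : set R) (p : \bar R).

Local Notation mu := (@lebesgue_measure R).

Definition circle_periodic {V : Type} (f : R -> V) :=
  forall t, f (t + 2 * pi) = f t.

Definition period : set R := `[0, 2 * pi[%classic.

Definition test_function U (phi : R -> R) :=
  [/\ forall n x, derivable (derive1n n phi) x 1,
      compact (closure [set x | phi x != 0])
    & closure [set x | phi x != 0] `<=` U].

(* g = f' in the sense of distributions on the open set U *)
Definition weak_derivative U f g :=
  [/\ locally_integrable U f, locally_integrable U g
    & forall phi, test_function U phi ->
        \int[mu]_(x in U) (f x * derive1 phi x) =
        - \int[mu]_(x in U) (g x * phi x)].

(* A representative of h'; it is determined almost everywhere and only occurs
   under integrals and essential suprema. *)
Definition wderiv h : R -> R :=
  xget (cst 0) [set g | weak_derivative setT h g].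

(* W^{1,oo}(T): periodic elements of W^{1,oo}_loc(R), each represented by its
   continuous representative. *)
Definition W1inf h :=
  [/\ circle_periodic h, continuous h
    & exists2 g, weak_derivative setT h g &
        forall K, compact K -> finite_norm mu +oo%E (g \_ K)].

Definition W1inf_norm h : \bar R :=
  ('N[mu]_+oo [EFin \o (h \_ period)] +
   'N[mu]_+oo [EFin \o (wderiv h \_ period)])%E.

Definition Lp_circle p U g :=
  [/\ circle_periodic g, measurable_fun (U `&` period) g
    & finite_norm mu p (g \_ (U `&` period))].

(* f in W^{2,p}(U), for U an open subset of T *)
Definition W2p p U f :=
  exists f1 f2,
    [/\ Lp_circle p U f, Lp_circle p U f1, Lp_circle p U f2,
        weak_derivative U f f1 & weak_derivative U f1 f2].

(* h'' + h >= 0 *)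
Definition convex_support h :=
  forall v, W1inf v -> (forall t, 0 <= v t) ->
    0 <= \int[mu]_(t in period) (h t * v t - wderiv h t * wderiv v t).

Definition one_sided_derivatives h : set R :=
  [set l | exists t,
     (fun s => s^-1 * (h (t + s) - h t)) @ 0^'+ --> l \/
     (fun s => s^-1 * (h (t + s) - h t)) @ 0^'- --> l].

(* Conv(h'(T)) *)
Definition conv_derivatives h : set R :=
  smallest [set I : set R | closed I /\ is_interval I] (one_sided_derivatives h).

(* T x h(T) x Conv(h'(T)) *)
Definition jet_hull h : set (R * R * R) :=
  [set x | range h x.1.2 /\ conv_derivatives h x.2].

(* Functionals on W^{1,oo}(T) are total on R -> R; only their values on
   W^{1,oo}(T) are used. *)
Definition is_frechet_derivative (r : (R -> R) -> R) h (L : (R -> R) -> R) :=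
  [/\ forall (a : R) v w, W1inf v -> W1inf w -> L (a *: v + w) = a * L v + L w,
      exists M : R, forall v, W1inf v ->
        ((`|L v|%R)%:E <= M%:E * W1inf_norm v)%E
    & forall e : R, 0 < e -> exists2 d : R, 0 < d &
        forall v, W1inf v -> (W1inf_norm v < d%:E)%E ->
          ((`|r (h + v) - r h - L v|%R)%:E <= e%:E * W1inf_norm v)%E].

Definition C1_around (r : (R -> R) -> R) h0 :=
  exists2 d0 : R, 0 < d0 & exists dr : (R -> R) -> (R -> R) -> R,
  let ball h := W1inf h /\ (W1inf_norm (h - h0)%R < d0%:E)%E in
  (forall h, ball h -> is_frechet_derivative r h (dr h)) /\
  (forall h, ball h -> forall e : R, 0 < e -> exists2 d : R, 0 < d &
     forall h1, ball h1 -> (W1inf_norm (h1 - h)%R < d%:E)%E ->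
       forall v, W1inf v ->
         ((`|dr h1 v - dr h v|%R)%:E <= e%:E * W1inf_norm v)%E).

(* r'(h) in L^p(T) *)
Definition derivative_in_Lp p (r : (R -> R) -> R) h :=
  exists L, is_frechet_derivative r h L /\
  exists2 g, Lp_circle p setT g &
    forall v, W1inf v -> L v = \int[mu]_(t in period) (g t * v t).

End Circle.

Section Smoothness.
Context {R : realType} {V : normedModType R}.

Definition C1_on (U : set V) (F : V -> R) :=
  forall x, U x -> differentiable F x /\
    forall v, {for x, continuous (fun y => 'd F y v)}.

Definition C2_on (U : set V) (F : V -> R) :=
  C1_on U F /\ forall v, C1_on U (fun y => 'd F y v).

Definition C2_around (K : set V) (F : V -> R) :=
  exists U, [/\ open U, K `<=` U & C2_on U F].

End Smoothness.

Section Plane.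
Context {R : realType}.
Implicit Types (Om A : set (R * R)) (h : R -> R) (U : set R).

Definition dot (x y : R * R) : R := x.1 * y.1 + x.2 * y.2.

Definition eitheta (t : R) : R * R := (cos t, sin t).

Definition convex_domain Om :=
  convex_set (Om : set (convex_lmodType (R * R)%type)).

Definition support_function Om (t : R) : R :=
  sup [set dot x (eitheta t) | x in closure Om].

(* Om = Omega^h.  The relation is empty when h is the support function of a
   point or of a segment, as no open convex set has such a support function. *)
Definition is_Omega h Om :=
  [/\ open Om, Om !=set0, bounded_set Om, convex_domain Om
    & forall t, support_function Om t = h t].

(* The points of the boundary of Om having a supporting line orthogonal to
   eitheta t for some t in U, where h is the support function of Om. *)
Definition boundary_part Om h U : set (R * R) :=
  [set x | (closure Om `\` interior Om) x /\
           exists2 t, U t & dot x (eitheta t) = h t].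

Definition contains_no_segment A :=
  forall x y : R * R, x != y ->
    ~ (forall s : R, 0 <= s <= 1 -> A ((1 - s) *: x + s *: y)).

End Plane.

Definition upper_semicontinuous {X : topologicalType} {R : numFieldType}
  (k : X -> \bar R) := lower_semicontinuous (fun x => - k x)%E.

Definition between {R : realType} (k1 k2 : R -> \bar R) (h : R -> R) :=
  forall t, (k1 t <= (h t)%:E <= k2 t)%E.

Definition strictly_between {R : realType} (k1 k2 : R -> \bar R) (h : R -> R) :
  set R := [set t | (k1 t < (h t)%:E < k2 t)%E].

(* Main.v *)
Require Import Defs.
From HB Require Import structures.
From mathcomp Require Import all_boot all_order all_algebra.
From mathcomp Require Import all_classical all_reals all_analysis.
From mathcomp Require Import measurable_realfun ess_sup_inf.
From mathcomp Require Import ring lra.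
Import Order.TTheory GRing.Theory Num.Theory.
Import numFieldNormedType.Exports.
Set Implicit Arguments.
Unset Strict Implicit.
Unset Printing Implicit Defensive.
Local Open Scope classical_set_scope.
Local Open Scope ring_scope.

(** The radius of curvature [h0 + h0''] of an optimal shape is controlled where no
    constraint is active, because a part of the boundary that is too flat could be
    pulled outwards so as to decrease the cost. Given a short arc [[a, b]] of
    angles inside the set where [k1 < h0 < k2], let [P] be the intersection of the
    supporting lines at [a] and [b], and replace [Om0] by the union of the sets
    [(1 - s) Om0 + s P] for [0 <= s <= tau]. The new set is open, bounded and
    convex, so the convexity constraint needs no multiplier, and its support
    function is [h0 + tau v], where [v] is the positive part of [S - h0] and [S t
    = dot P (eitheta t)] ([pulled_Omega]). By the trigonometric convexity of
    support functions, [v] vanishes outside the arc and equals [S - h0] on it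
    ([chord_le], [chord_ge]). For small [tau] the new set is admissible, since [h0
    + tau v] is at least [h0], and [h0] stays away from [k2] on the arc.

    On the arc, of length [l], the derivative [v' = S' - h0'] is [m - h0'] up to
    [O(l)], where [m] is the mean slope of [h0]. As [G] is C^2 with [G_qq > 0] on a
    compact set that is convex in [q], [G_q] is Lipschitz and strongly monotone in
    [q] ([jet_estimates]), so that the term [G_q v'] of the first variation is at most
    [- al v'^2 / 8 + O(l^2)] up to a constant multiple of [v'], whose integral is zero
    ([quadratic_gain]). Optimality ([first_variation]) therefore bounds the integral
    of [v'^2] by the integral of [g v], where [g] represents the derivative of [r],
    and by terms of lower order. By the Cauchy-Schwarz inequality, the integral of
    [|v'|] is [O(l)] times the integral of [|g| + 1]. The second difference of [h0]
    is controlled by the value of [v] at the middle of the arc, which gives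
    ([midpoint_estimate])
      [h0 (c + s) + h0 (c - s) - 2 h0 c <= K s \int_(c - s)^(c + s) (|g| + 1)].

    Being semiconvex, [h0] has right derivatives, whose increments are bounded from
    below by [- 4 B] times the length of the interval. Summing second differences
    bounds them from above by [2 K] times the integral of [|g| + 1]
    ([right_derivative_increment]). Hence they are the integrals of a density
    ([increment_density]), which is the limit of difference quotients and is
    dominated by [2 K (|g| + 1) + 4 B], a function in L^p
    ([second_derivative_primitive]). Integration by parts
    ([weak_derivative_local]) identifies it with the second weak derivative.

    Strict convexity follows from the same estimate. A segment in the part of the
    boundary under consideration lies in a supporting line orthogonal to
    [eitheta t] for some [t] with [k1 t < h0 t < k2 t], and makes a corner of [h0] at
    [t]. The second differences of [h0] at [t] are then at least of order [s],
    whereas [midpoint_estimate] makes them [o(s)] ([no_corner]).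

    The cost is defined with an arbitrary weak derivative. It is related to right
    derivatives through primitives: a continuous function is a primitive of its weak
    derivative ([weak_derivative_primitive]), and a semiconvex Lipschitz function is
    a primitive of its right derivative ([right_derivative_primitive]). *)

(** * Integrals over segments of the line *)

Section SegmentIntegral.
Context {R : realType}.
Local Notation mu := (@lebesgue_measure R).
Implicit Types (f g : R -> R) (a b c s M : R).

Lemma locint_measurable f : locally_integrable setT f -> measurable_fun setT f.
Proof. by case. Qed.

Lemma locint_itv f (i : interval R) a b : locally_integrable setT f ->
  [set` i] `<=` `[a, b] -> mu.-integrable [set` i] (EFin \o f).
Proof.
move=> [mf _ If] iab.
apply: (@integrableS _ _ _ mu `[a, b]) => //.
apply/integrableP; split; first by apply/measurable_EFinP; exact: measurable_funTS.
by apply: If => //; exact: segment_compact.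
Qed.

Lemma locint_seg f a b : locally_integrable setT f ->
  mu.-integrable `[a, b] (EFin \o f).
Proof. by move=> If; exact: (@locint_itv f `[a, b] a b). Qed.

Lemma compact_segment_bound (K : set R) : compact K ->
  exists n : nat, K `<=` `[- n%:R, n%:R].
Proof.
move=> /compact_bounded[M [_ KM]].
exists (Num.truncn (M + 1)).+1 => x Kx /=; rewrite in_itv/= -ler_norml.
apply: (le_trans (KM (M + 1) _ _ Kx)); first by rewrite ltrDl.
exact/ltW/Num.Theory.truncnS_gt.
Qed.

Lemma locintP f : measurable_fun setT f ->
  (forall n : nat, mu.-integrable `[- n%:R, n%:R] (EFin \o f)) ->
  locally_integrable setT f.
Proof.
move=> mf If; split => //; first exact: openT.
move=> K _ cK.
have [n Kn] := compact_segment_bound cK.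
have /integrableP[_] := If n; apply: le_lt_trans.
apply: ge0_subset_integral => //=; first exact: compact_measurable.
by apply/measurable_EFinP/measurableT_comp => //; exact: measurable_funTS.
Qed.

Lemma bounded_locint f M : measurable_fun setT f -> (forall x, `|f x| <= M) ->
  locally_integrable setT f.
Proof.
move=> mf fM; apply: locintP => // n.
apply: measurable_bounded_integrable => //.
- by apply: compact_finite_measure; exact: segment_compact.
- exact: measurable_funTS.
- exists M; split; first exact: num_real.
  by move=> x Mx y _ /=; apply: le_trans (fM y) (ltW Mx).
Qed.

Lemma continuous_locint f : continuous f -> locally_integrable setT f.
Proof.
move=> cf; apply: locintP; first exact: continuous_measurable_fun.
move=> n; apply: continuous_compact_integrable; first exact: segment_compact.
exact: continuous_subspaceT.
Qed.

Lemma locint_cst (k : R) : locally_integrable setT (fun=> k).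
Proof. by apply: continuous_locint => x; exact: cvg_cst. Qed.

Lemma locintZ (k : R) f : locally_integrable setT f ->
  locally_integrable setT (fun x => k * f x).
Proof.
move=> If; apply: locintP.
  by apply: measurable_funM => //; exact: locint_measurable.
move=> n; have := @integrableZl _ _ _ mu `[- n%:R, n%:R] _ k _ (locint_seg (- n%:R) n%:R If).
by apply => //.
Qed.

Lemma locint_norm f : locally_integrable setT f ->
  locally_integrable setT (fun x => `|f x|).
Proof.
move=> If; apply: locintP.
  by apply: measurableT_comp => //; exact: locint_measurable.
by move=> n; apply: integrable_norm; exact: locint_seg.
Qed.

Lemma locintD f g : locally_integrable setT f -> locally_integrable setT g ->
  locally_integrable setT (fun x => f x + g x).
Proof. exact: locally_integrableD. Qed.

Lemma locintB f g : locally_integrable setT f -> locally_integrable setT g ->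
  locally_integrable setT (fun x => f x - g x).
Proof. exact: locally_integrableB. Qed.

Lemma locintM f g M : locally_integrable setT f -> measurable_fun setT g ->
  (forall x, `|g x| <= M) -> locally_integrable setT (fun x => f x * g x).
Proof.
move=> If mg gM; apply: locintP.
  by apply: measurable_funM => //; exact: locint_measurable.
move=> n; apply: (@le_integrable _ _ _ mu _ _ _ (EFin \o (fun x => M * `|f x|))) => //.
- apply/measurable_EFinP/measurable_funTS/measurable_funM => //.
  exact: locint_measurable.
- move=> x _ /=; rewrite lee_fin normrM [leRHS]ger0_norm.
    by rewrite mulrC ler_wpM2r.
  by rewrite mulr_ge0// (le_trans _ (gM x)).
- exact/locint_seg/locintZ/locint_norm.
Qed.

Lemma Rintegral_chasles f a b c : locally_integrable setT f ->
  a <= b -> b <= c ->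
  \int[mu]_(x in `[a, c]) f x =
  \int[mu]_(x in `[a, b]) f x + \int[mu]_(x in `[b, c]) f x.
Proof.
move=> If ab bc.
have := @Rintegral_itvB R f (BLeft a) (BRight c) b.
rewrite (Rintegral_itv_obnd_cbnd (b := BRight c)); last first.
  by apply: (@locint_itv f _ b c If); apply: subset_itvr; rewrite bnd_simp.
move=> H; rewrite -H; first by rewrite addrC subrK.
- exact: locint_seg.
- by rewrite bnd_simp.
- by rewrite bnd_simp.
Qed.

Lemma Rintegral_point f a : \int[mu]_(x in `[a, a]) f x = 0.
Proof. by rewrite set_itv1 Rintegral_set1. Qed.

Lemma segment_measure a b : a <= b -> fine (mu `[a, b]%classic) = b - a.
Proof.
move=> ab; rewrite lebesgue_measure_itv/= lte_fin.
by case: ltP => //= ba; apply/esym/eqP; rewrite subr_eq0 eq_le ab ba.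
Qed.

Lemma Rintegral_seg_cst (k : R) a b : a <= b ->
  \int[mu]_(x in `[a, b]) k = k * (b - a).
Proof. by move=> ab; rewrite Rintegral_cst// segment_measure. Qed.

Lemma measurable_shift s : measurable_fun setT (fun x : R => x + s).
Proof. by apply: measurable_funD. Qed.

Definition translation s : measurableTypeR R -> measurableTypeR R :=
  fun x => x + s.

Lemma measurable_translation s : measurable_fun setT (translation s).
Proof. exact: measurable_shift. Qed.

HB.instance Definition _ s := @isMeasurableFun.Build _ _ (measurableTypeR R)
  (measurableTypeR R) (translation s) (measurable_translation s).

Lemma lebesgue_measure_translation (A : set R) s : measurable A ->
  pushforward mu (translation s) A = mu A.
Proof.
move=> mA.
apply/esym/lebesgue_measure_unique => //= _ [[a b]] _ <-.
rewrite /pushforward.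
have -> : translation s @^-1` `]a, b]%classic = `]a - s, b - s]%classic.
  by apply/seteqP; split=> x /=; rewrite /translation !in_itv/= ltrBlDr lerBrDr.
rewrite !lebesgue_measure_itv/= !lte_fin ltrD2r.
by case: ifP => // _; rewrite -!EFinD; congr EFin; ring.
Qed.

Lemma ge0_integral_shift (f : R -> \bar R) a b s : measurable_fun setT f ->
  (forall x, 0 <= f x)%E ->
  (\int[mu]_(x in `[a, b]) f (x + s)%R = \int[mu]_(x in `[(a + s)%R, (b + s)%R]) f x)%E.
Proof.
move=> mf f0.
have pre : translation s @^-1` `[a + s, b + s]%classic = `[a, b]%classic.
  by apply/seteqP; split=> x /=; rewrite /translation !in_itv/= !lerD2r.
rewrite -pre -[LHS](@ge0_integral_pushforward _ _ _ _ _ _ (measurable_translation s) mu _ f)//.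
  by apply: eq_measure_integral => A mA _; exact: lebesgue_measure_translation.
exact: measurable_funTS.
Qed.

Lemma Rintegral_shift f a b s : locally_integrable setT f ->
  \int[mu]_(x in `[a, b]) f (x + s) = \int[mu]_(x in `[a + s, b + s]) f x.
Proof.
move=> If; rewrite /Rintegral; congr fine.
have mf := locint_measurable If.
have mEf : measurable_fun setT (EFin \o f) by exact/measurable_EFinP.
rewrite integralE [RHS]integralE.
rewrite -(@ge0_integral_shift ((EFin \o f)^\+)%E)//; last exact: measurable_funepos.
rewrite -(@ge0_integral_shift ((EFin \o f)^\-)%E)//; last exact: measurable_funeneg.
by congr (_ - _)%E; apply: eq_integral => x _; rewrite ?funeposE ?funenegE.
Qed.

Lemma locintS f (A : set R) : locally_integrable setT f -> measurable A ->
  (exists a b, A `<=` `[a, b]) -> mu.-integrable A (EFin \o f).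
Proof.
move=> If mA [a [b Aab]].
by apply: (@integrableS _ _ _ mu `[a, b]) => //; exact: locint_seg.
Qed.

Lemma le_Rintegral_seg f g a b :
  locally_integrable setT f -> locally_integrable setT g ->
  (forall x, a <= x <= b -> f x <= g x) ->
  \int[mu]_(x in `[a, b]) f x <= \int[mu]_(x in `[a, b]) g x.
Proof.
move=> If Ig fg; apply: le_Rintegral => //; try exact: locint_seg.
Qed.

Lemma RintegralD_seg f g a b :
  locally_integrable setT f -> locally_integrable setT g ->
  \int[mu]_(x in `[a, b]) (f x + g x) =
  \int[mu]_(x in `[a, b]) f x + \int[mu]_(x in `[a, b]) g x.
Proof. by move=> If Ig; apply: RintegralD => //; exact: locint_seg. Qed.

Lemma RintegralB_seg f g a b :
  locally_integrable setT f -> locally_integrable setT g ->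
  \int[mu]_(x in `[a, b]) (f x - g x) =
  \int[mu]_(x in `[a, b]) f x - \int[mu]_(x in `[a, b]) g x.
Proof. by move=> If Ig; apply: RintegralB => //; exact: locint_seg. Qed.

Lemma RintegralZ_seg f (k : R) a b :
  locally_integrable setT f ->
  \int[mu]_(x in `[a, b]) (k * f x) = k * \int[mu]_(x in `[a, b]) f x.
Proof. by move=> If; apply: RintegralZl => //; exact: locint_seg. Qed.

Lemma Rintegral_seg_norm f a b : locally_integrable setT f ->
  `|\int[mu]_(x in `[a, b]) f x| <= \int[mu]_(x in `[a, b]) `|f x|.
Proof. by move=> If; apply: le_normr_Rintegral => //; exact: locint_seg. Qed.

Lemma Rintegral_seg_subset f a b c d : locally_integrable setT f ->
  (forall x, 0 <= f x) -> c <= a -> b <= d ->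
  \int[mu]_(x in `[a, b]) f x <= \int[mu]_(x in `[c, d]) f x.
Proof.
move=> If f0 ca bd; have [ab|ba] := leP a b; last first.
  by rewrite set_itv_ge ?bnd_simp -?ltNge// Rintegral_set0 Rintegral_ge0.
rewrite (Rintegral_chasles If ca (le_trans ab bd)) (Rintegral_chasles If ab bd).
by rewrite addrCA lerDl addr_ge0// Rintegral_ge0.
Qed.

Lemma ae_eq_Rintegral (f g : R -> R) (D : set R) : measurable D ->
  measurable_fun D f -> measurable_fun D g -> {ae mu, forall x, D x -> f x = g x} ->
  \int[mu]_(x in D) f x = \int[mu]_(x in D) g x.
Proof.
move=> mD mf mg fg; congr fine; apply: ae_eq_integral => //.
- exact/measurable_EFinP.
- exact/measurable_EFinP.
- apply: filterS fg; first exact: (ae_filter_ringOfSetsType mu).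
  by move=> x fg Dx; rewrite fg.
Qed.

Lemma circle_periodicZ {V : Type} (f : R -> V) : circle_periodic f ->
  forall (n : nat) t, f (t + 2 * pi *+ n) = f t.
Proof.
move=> pf; elim=> [|n IH] t; first by rewrite mulr0n addr0.
by rewrite mulrSr addrA pf IH.
Qed.

Lemma twopi_gt0 : 0 < 2 * pi :> R.
Proof. by rewrite mulr_gt0// pi_gt0. Qed.

Lemma Rintegral_period f c : circle_periodic f -> locally_integrable setT f ->
  \int[mu]_(x in period) f x = \int[mu]_(x in `[c, c + 2 * pi]) f x.
Proof.
move=> pf If.
have step d e : d <= e -> e <= d + 2 * pi ->
    \int[mu]_(x in `[d, d + 2 * pi]) f x = \int[mu]_(x in `[e, e + 2 * pi]) f x.
  move=> de ed.
  rewrite (Rintegral_chasles If de ed).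
  rewrite (@Rintegral_chasles f e (d + 2 * pi) (e + 2 * pi))// ?lerD2r//.
  rewrite addrC; congr (_ + _); rewrite -Rintegral_shift//.
  by apply: eq_Rintegral => x _; rewrite pf.
have up (n : nat) d : \int[mu]_(x in `[d, d + 2 * pi]) f x =
    \int[mu]_(x in `[d + 2 * pi *+ n, d + 2 * pi *+ n + 2 * pi]) f x.
  elim: n => [|n IH]; first by rewrite mulr0n addr0.
  rewrite IH (step _ (d + 2 * pi *+ n + 2 * pi)).
  - by rewrite -(addrA d) -mulrSr.
  - by rewrite lerDl ltW// twopi_gt0.
  - by [].
have base : \int[mu]_(x in period) f x = \int[mu]_(x in `[0, 0 + 2 * pi]) f x.
  rewrite add0r /period Rintegral_itv_bndo_bndc//.
  by apply: (@locint_itv f _ 0 (2 * pi)) => // x /=; rewrite !in_itv/= => /andP[-> /ltW].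
have [n cn] : exists n : nat, 0 <= c + 2 * pi *+ n.
  exists (Num.truncn (- c / (2 * pi))).+1.
  rewrite -lerBlDl sub0r -mulr_natr -ler_pdivrMl ?twopi_gt0// mulrC.
  exact/ltW/Num.Theory.truncnS_gt.
rewrite base (up n c); set d := c + _ in cn *.
pose m := Num.truncn (d / (2 * pi)).
have md : 2 * pi *+ m <= d.
  by rewrite -[leLHS]mulr_natr mulrC -ler_pdivlMr ?twopi_gt0// Num.Theory.truncn_le ?divr_ge0// ltW// twopi_gt0.
have dm : d <= 2 * pi *+ m + 2 * pi.
  rewrite -mulrSr -[leRHS]mulr_natr -ler_pdivrMl ?twopi_gt0// mulrC.
  exact/ltW/Num.Theory.truncnS_gt.
by rewrite (up m 0) add0r (step _ _ md dm).
Qed.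

End SegmentIntegral.

(** * Primitives of locally integrable functions *)

Section Primitive.
Context {R : realType}.
Local Notation mu := (@lebesgue_measure R).
Implicit Types (f g : R -> R) (a b c s M : R).

(** [f] is locally absolutely continuous with derivative [g]; only increments
    are compared, so that no base point has to be chosen. *)
Definition is_primitive f g :=
  forall a b, a <= b -> f b - f a = \int[mu]_(x in `[a, b]) g x.

Lemma is_primitive_integral g : locally_integrable setT g ->
  is_primitive (fun x => if 0 <= x then \int[mu]_(t in `[0, x]) g t
                         else - \int[mu]_(t in `[x, 0]) g t) g.
Proof.
move=> Ig a b ab; have [a0|a0] := leP 0 a.
  rewrite (le_trans a0 ab) (Rintegral_chasles Ig a0 ab) addrC addrA.
  by rewrite [- _ + _]addrC subrr add0r.
have [b0|b0] := leP 0 b.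
  by rewrite opprK addrC (Rintegral_chasles Ig (ltW a0) b0).
by rewrite opprK addrC (Rintegral_chasles Ig ab (ltW b0)) addrK.
Qed.

Lemma is_primitiveZ f g (k : R) : locally_integrable setT g ->
  is_primitive f g -> is_primitive (fun x => k * f x) (fun x => k * g x).
Proof. by move=> I p a b ab; rewrite RintegralZ_seg// -p// mulrBr. Qed.

Lemma lebesgue_pt_is_derive f g x : locally_integrable setT g ->
  is_primitive f g -> lebesgue_pt g x -> is_derive x 1 f (g x).
Proof.
move=> Ig pf gx.
have x1 : x < x + 1 by rewrite ltrDl.
have [] := FTC1_lebesgue_pt x1 (locint_seg (x - 1) _ Ig) _ gx.
  by rewrite /= lte_fin; lra.
set F := (fun y => _) => dF eF.
have FD : is_derive x 1 F (g x).
  apply: DeriveDef; first exact: dF.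
  by rewrite -derive1E; exact: eF.
apply: (@near_eq_is_derive _ _ _ (fun y => F y + f (x - 1)) f x 1 (g x)).
  near=> y; have xy : x - 1 <= y.
    by apply: ltW; near: y; apply: lt_nbhsr; lra.
  by rewrite /F -pf// subrK.
rewrite -[g x]addr0.
exact: (@is_deriveD _ _ _ F (cst (f (x - 1))) x 1 (g x) 0).
Unshelve. all: by end_near. Qed.

Lemma is_primitive_ae_derive f g : locally_integrable setT g ->
  is_primitive f g -> {ae mu, forall x : R, is_derive x (1 : R) f (g x)}.
Proof.
move=> Ig pf; apply: filterS (lebesgue_differentiation Ig).
  exact: (ae_filter_ringOfSetsType mu).
by move=> x; exact: lebesgue_pt_is_derive.
Qed.

Lemma is_primitive_continuous f g : locally_integrable setT g ->
  is_primitive f g -> continuous f.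
Proof.
move=> Ig pf x.
have x1 : x - 1 <= x + 1 by lra.
have := parameterized_integral_continuous x1 (locint_seg _ _ Ig).
pose F y := parameterized_integral mu (x - 1) y g.
rewrite -/F => cF.
have cFx : {for x, continuous F}.
  move: cF; rewrite continuous_within_itvP; last by lra.
  by case=> + _ _; apply; rewrite in_itv/=; apply/andP; split; lra.
apply: (@cvg_trans _ ((fun y => F y + f (x - 1)) @ x)).
  apply: near_eq_cvg; near=> y.
  have xy : x - 1 <= y by apply: ltW; near: y; apply: lt_nbhsr; lra.
  by rewrite /F /parameterized_integral -pf// subrK.
have -> : f x = F x + f (x - 1).
  by rewrite /F /parameterized_integral -pf ?subrK//; lra.
have c1 : (fun=> f (x - 1)) @ x --> f (x - 1) by exact: cvg_cst.
exact: (cvgD (cFx : F @ x --> F x) c1).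
Unshelve. all: by end_near. Qed.

Lemma derive_is_primitive f g : (forall x : R, is_derive x (1 : R) f (g x)) ->
  continuous g -> is_primitive f g.
Proof.
move=> df cg a b; rewrite le_eqVlt => /predU1P[<-|ab].
  by rewrite subrr Rintegral_point.
have cf : continuous f.
  by move=> x; apply: differentiable_continuous; apply/derivable1_diffP; case: (df x).
rewrite /Rintegral (@continuous_FTC2 _ _ f)//.
- exact: continuous_subspaceT.
- split.
  + by move=> x _; case: (df x).
  + exact: (cvg_at_right_filter (cf a)).
  + exact: (cvg_at_left_filter (cf b)).
- by move=> x _; rewrite derive1E; case: (df x).
Qed.

Lemma dominated_cvg_seg (f_ : nat -> R -> R) f w a b :
  (forall n, measurable_fun setT (f_ n)) -> measurable_fun setT f ->
  locally_integrable setT w ->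
  {ae mu, forall x, a <= x <= b -> f_ n x @[n --> \oo] --> f x} ->
  (forall n x, a <= x <= b -> `|f_ n x| <= w x) ->
  \int[mu]_(x in `[a, b]) f_ n x @[n --> \oo] --> \int[mu]_(x in `[a, b]) f x.
Proof.
move=> mf_ mf Iw f_f f_w.
have mEf_ n : measurable_fun `[a, b] (EFin \o f_ n).
  by apply/measurable_EFinP; exact: measurable_funTS.
have mEf : measurable_fun `[a, b] (EFin \o f).
  by apply/measurable_EFinP; exact: measurable_funTS.
have [|||||If _ H] := @dominated_convergence _ _ R mu `[a, b]%classic
  (measurable_itv _) (fun n => EFin \o f_ n) (EFin \o f) (EFin \o w).
- exact: mEf_.
- exact: mEf.
- apply: filterS f_f; first exact: (ae_filter_ringOfSetsType mu).
  move=> x H xab; apply/cvg_EFin; first by apply: nearW.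
  by apply: H; move: xab; rewrite /= in_itv.
- exact: locint_seg.
- apply/aeW => x n /=; rewrite in_itv/= => xab.
  by rewrite lee_fin f_w.
apply: fine_cvg; rewrite fineK//.
exact: integrable_fin_num.
Qed.

Lemma locint_cM f g : locally_integrable setT f -> continuous g ->
  locally_integrable setT (fun x => f x * g x).
Proof.
move=> If cg; apply: locintP.
  apply: measurable_funM; first exact: locint_measurable.
  exact: continuous_measurable_fun.
move=> n.
have [M gM] : exists M, forall x, - n%:R <= x <= n%:R -> `|g x| <= M.
  have /compact_bounded[M [_ HM]] : compact (g @` `[- n%:R, n%:R]).
    apply: continuous_compact; last exact: segment_compact.
    exact: continuous_subspaceT.
  exists (M + 1) => x xn; apply: (HM (M + 1)); first by rewrite ltrDl.
  by exists x => //=; rewrite in_itv.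
apply: (@le_integrable _ _ _ mu _ _ _ (EFin \o (fun x => M * `|f x|))) => //.
- apply/measurable_EFinP/measurable_funTS/measurable_funM.
    exact: locint_measurable.
  exact: continuous_measurable_fun.
- move=> x /=; rewrite in_itv/= => xn; rewrite lee_fin normrM [leRHS]ger0_norm.
    by rewrite mulrC ler_wpM2r// gM.
  by rewrite mulr_ge0// (le_trans _ (gM x xn)).
- exact/locint_seg/locintZ/locint_norm.
Qed.

Lemma integrable_seg_restrict f a b : locally_integrable setT f ->
  mu.-integrable setT (EFin \o (f \_ `[a, b])).
Proof.
move=> If; rewrite -restrict_EFin.
exact: ((integrable_mkcond (mu := mu) _ (measurable_itv `[a, b])).1 (locint_seg a b If)).
Qed.

(** Integration by parts holds for primitives of locally integrable functions:
    both sides are iterated integrals of [g x * k y] over the triangle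
    [a <= x <= y <= b], computed in the two possible orders. *)
Lemma is_primitive_ibp f g h k a b : a <= b ->
  locally_integrable setT g -> locally_integrable setT k ->
  is_primitive f g -> is_primitive h k ->
  \int[mu]_(x in `[a, b]) (k x * f x) =
  f b * h b - f a * h a - \int[mu]_(x in `[a, b]) (g x * h x).
Proof.
move=> ab Ig Ik pf ph.
have cf := is_primitive_continuous Ig pf.
have ch := is_primitive_continuous Ik ph.
set I := `[a, b]%classic.
pose T := (fun z : R * R => (g \_ I) z.1 * (k \_ I) z.2 * (z.1 <= z.2)%R%:R) : _ -> R.
have mgI : measurable_fun setT (g \_ I).
  by apply/(measurable_restrictT _ (measurable_itv _)); apply: measurable_funTS; case: Ig.
have mkI : measurable_fun setT (k \_ I).
  by apply/(measurable_restrictT _ (measurable_itv _)); apply: measurable_funTS; case: Ik.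
have mT : measurable_fun setT T.
  apply: measurable_funM.
    by apply: measurable_funM; apply: measurableT_comp.
  have -> : (fun z : R * R => (z.1 <= z.2)%R%:R : R) =
            (fun z => if z.1 <= z.2 then 1 else 0).
    by apply/funext => z; case: ifP.
  apply: measurable_fun_ifT => //.
  by apply: measurable_fun_ler.
have IT : (mu \x mu)%E.-integrable setT (EFin \o T).
  apply/integrable12ltyP; first exact/measurable_EFinP.
  have /integrableP[_ IgI] := integrable_seg_restrict a b Ig.
  have /integrableP[mEk IkI] := integrable_seg_restrict a b Ik.
  have mAT : measurable_fun setT (abse \o (EFin \o T)).
    by apply: measurableT_comp => //; apply/measurable_EFinP.
  have FmT := @measurable_fun_fubini_tonelli_F _ _ (measurableTypeR R) (measurableTypeR R) R mu (abse \o (EFin \o T)) mAT (fun=> abse_ge0 _).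
  have Nk : (\int[mu]_y `|(k \_ I) y|%:E)%E \is a fin_num.
    by rewrite ge0_fin_numE// integral_ge0.
  apply: (@le_lt_trans _ _ (\int[mu]_x (`|(g \_ I) x|%:E * \int[mu]_y `|(k \_ I) y|%:E))%E).
    apply: ge0_le_integral => //.
    - by move=> x _; exact: integral_ge0.
    - by apply: emeasurable_funM => //; apply/measurable_EFinP/measurableT_comp.
    - move=> x _; rewrite -ge0_integralZl//; last first.
        by apply/measurable_EFinP/measurableT_comp.
      apply: ge0_le_integral => //.
      + apply/measurable_EFinP/measurableT_comp => //.
        exact: (measurableT_comp mT (pair1_measurable x)).
      + by apply: emeasurable_funM => //; apply/measurable_EFinP/measurableT_comp.
      + move=> y _; rewrite /= -EFinM lee_fin /T/= !normrM ler_piMr//.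
        by rewrite normr_nat lern1 leq_b1.
  under eq_integral do rewrite muleC.
  rewrite ge0_integralZl//; last first.
  - exact: integral_ge0.
  - by apply/measurable_EFinP/measurableT_comp.
  by rewrite lte_mul_pinfty// integral_ge0.
have outI (u : R -> R) x : x \notin I -> (u \_ I) x = 0.
  by rewrite patchE => /negbTE ->.
have inI (u : R -> R) x : x \in I -> (u \_ I) x = u x by rewrite patchE => ->.
have := Fubini IT.
have -> : (\int[mu]_x \int[mu]_y (EFin \o T) (x, y))%E =
          (\int[mu]_(x in I) (g x * (h b - h x))%:E)%E.
  rewrite [RHS]integral_mkcond; apply: eq_integral => x _.
  rewrite patchE; case: ifPn => xI; last first.
    apply: integral0_eq => y _.
    by rewrite /= /T/= outI// !mul0r.
  have xab : a <= x <= b by move: xI; rewrite inE /I/= in_itv.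
  move/andP: (xab) => [ax xb].
  rewrite ph// EFinM /Rintegral fineK; last first.
    exact: integrable_fin_num (locint_seg _ _ Ik).
  rewrite -integralZl//; last exact: (locint_seg _ _ Ik).
  rewrite [RHS]integral_mkcond; apply: eq_integral => y _.
  rewrite patchE /= /T/= (inI g)//.
  case: ifPn; rewrite ?inE ?notin_setE /= in_itv/=.
    move=> /andP[xy yb]; rewrite xy mulr1 inI ?EFinM//.
    by rewrite inE /I/= in_itv/= yb (le_trans ax xy).
  move=> H; case: (boolP (x <= y)) => xy /=; last by rewrite mulr0.
  rewrite (outI k) ?mulr0 ?mul0r//; apply/negP; rewrite inE /I/= in_itv/=.
  by case/andP=> _ yb; apply: H; rewrite xy.
have -> : (\int[mu]_y \int[mu]_x (EFin \o T) (x, y))%E =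
          (\int[mu]_(y in I) (k y * (f y - f a))%:E)%E.
  rewrite [RHS]integral_mkcond; apply: eq_integral => y _.
  rewrite patchE; case: ifPn => yI; last first.
    apply: integral0_eq => x _.
    by rewrite /= /T/= (outI k)// mulr0 !mul0r.
  have yab : a <= y <= b by move: yI; rewrite inE /I/= in_itv.
  move/andP: (yab) => [ay yb].
  rewrite pf// EFinM /Rintegral fineK; last first.
    exact: integrable_fin_num (locint_seg _ _ Ig).
  rewrite -integralZl//; last exact: (locint_seg _ _ Ig).
  rewrite [RHS]integral_mkcond; apply: eq_integral => x _.
  rewrite patchE /= /T/= (inI k)//.
  case: ifPn; rewrite ?inE ?notin_setE /= in_itv/=.
    move=> /andP[ax xy]; rewrite xy mulr1 inI ?EFinM 1?muleC//.
    by rewrite inE /I/= in_itv/= ax (le_trans xy yb).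
  move=> H; case: (boolP (x <= y)) => xy /=; last by rewrite mulr0.
  rewrite (outI g) ?mul0r//; apply/negP; rewrite inE /I/= in_itv/=.
  by case/andP=> ax _; apply: H; rewrite xy ax.
move/(congr1 fine).
rewrite -/(Rintegral mu I (fun x => g x * (h b - h x))).
rewrite -/(Rintegral mu I (fun y => k y * (f y - f a))).
have Igh := locint_cM Ig ch.
have Ikf := locint_cM Ik cf.
have -> : \int[mu]_(x in I) (g x * (h b - h x)) =
    h b * (f b - f a) - \int[mu]_(x in I) (g x * h x).
  rewrite pf// -RintegralZ_seg// -RintegralB_seg//; last exact: locintZ.
  by apply: eq_Rintegral => x _; ring.
have -> : \int[mu]_(y in I) (k y * (f y - f a)) =
    \int[mu]_(y in I) (k y * f y) - f a * (h b - h a).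
  rewrite ph// -RintegralZ_seg// -RintegralB_seg//; last exact: locintZ.
  by apply: eq_Rintegral => x _; ring.
by move=> H; lra.
Qed.

End Primitive.

(** * Smooth test functions *)

Section SmoothBump.
Context {R : realType}.
Implicit Types (f g : R -> R) (P : {poly R}) (x a b k c : R).

Lemma is_derive1M f g x (df dg : R) : is_derive x (1 : R) f df ->
  is_derive x (1 : R) g dg ->
  is_derive x (1 : R) (fun y => f y * g y) (f x * dg + g x * df).
Proof. by move=> Df Dg; exact: is_deriveM. Qed.

Definition smooth f := forall n x, derivable (derive1n n f) x 1.

Lemma smooth_derive1 f : smooth f -> smooth (derive1 f).
Proof. by move=> sf n x; have := sf n.+1 x; rewrite /derive1n iterSr. Qed.

Lemma smooth_of_derive1 f : (forall x, derivable f x 1) -> smooth (derive1 f) ->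
  smooth f.
Proof. by move=> df sf [|n] x //; rewrite /derive1n iterSr; exact: sf. Qed.

Lemma smooth_is_derive f : smooth f -> forall x, is_derive x (1 : R) f (derive1 f x).
Proof. by move=> sf x; rewrite derive1E; apply: derivableP; exact: (sf 0%N). Qed.

Lemma smooth_continuous f : smooth f -> continuous f.
Proof.
move=> sf x; apply: differentiable_continuous; apply/derivable1_diffP.
exact: (sf 0%N).
Qed.

Lemma derive1_unique f g : (forall x, is_derive x (1 : R) f (g x)) -> derive1 f = g.
Proof. by move=> df; apply/funext => x; rewrite derive1E; case: (df x). Qed.

(** Derivability at all orders below [n] for one fixed [n], so that products can
    be treated by induction on [n]. *)
Fixpoint smooth_upto n f : Prop :=
  if n is m.+1 then (forall x, derivable f x 1) /\ smooth_upto m (derive1 f)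
  else True.

Lemma smooth_uptoP f : smooth f <-> forall n, smooth_upto n f.
Proof.
split=> [sf n|H n x].
  elim: n f sf => //= n IH f sf; split; first exact: (sf 0%N).
  exact/IH/smooth_derive1.
elim: n f H x => [|n IH] f H x; first by case: (H 1%N).
by rewrite /derive1n iterSr; apply: IH => m; case: (H m.+1).
Qed.

Lemma smooth_uptoW n f : smooth_upto n.+1 f -> smooth_upto n f.
Proof. by elim: n f => //= n IH f [df Hf]; split=> //; exact: IH. Qed.

Lemma smooth_uptoD n f g : smooth_upto n f -> smooth_upto n g ->
  smooth_upto n (fun x => f x + g x).
Proof.
elim: n f g => //= n IH f g [df sf] [dg sg].
have D x : is_derive x (1 : R) (fun x => f x + g x) (derive1 f x + derive1 g x).
  by apply: is_deriveD; rewrite derive1E; exact: derivableP.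
split; first by move=> x; case: (D x).
by rewrite (derive1_unique D); exact: IH.
Qed.

Lemma smooth_uptoM n f g : smooth_upto n f -> smooth_upto n g ->
  smooth_upto n (fun x => f x * g x).
Proof.
elim: n f g => //= n IH f g [df sf] [dg sg].
have D x : is_derive x (1 : R) (fun x => f x * g x)
    (f x * derive1 g x + g x * derive1 f x).
  have df' : is_derive x (1 : R) f (derive1 f x).
    by rewrite derive1E; exact: derivableP.
  have dg' : is_derive x (1 : R) g (derive1 g x).
    by rewrite derive1E; exact: derivableP.
  exact: is_deriveM.
split; first by move=> x; case: (D x).
rewrite (derive1_unique D); apply: smooth_uptoD; apply: IH => //.
- by apply: smooth_uptoW.
- by apply: smooth_uptoW.
Qed.

Lemma smooth_upto_affine n f k c : smooth_upto n f ->
  smooth_upto n (fun x => f (k * x + c)).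
Proof.
elim: n f => //= n IH f [df sf].
have D x : is_derive x (1 : R) (fun x => f (k * x + c)) (derive1 f (k * x + c) * k).
  apply: (@is_derive1_comp _ f (fun x => k * x + c)).
    by rewrite derive1E; exact: derivableP.
  have H := @is_deriveD _ _ _ (k *: (id : R -> R)) (cst c) x 1 (k *: (1 : R)) 0
    (@is_deriveZ _ _ _ id k x 1 1 (is_derive_id x 1)) (is_derive_cst c x 1).
  by move: H; rewrite addr0 /GRing.scale/= mulr1.
split; first by move=> x; case: (D x).
rewrite (derive1_unique D); apply: smooth_uptoM; first exact: IH.
have C : forall m (l : R), smooth_upto m (fun=> l).
  elim=> //= m IHm l; split=> [y|]; first exact: (derivable_cst l y 1).
  by rewrite (_ : derive1 _ = fun=> 0)//; apply/funext => x; exact: derive1_cst.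
exact: C.
Qed.

Lemma smoothM f g : smooth f -> smooth g -> smooth (fun x => f x * g x).
Proof.
move=> /smooth_uptoP sf /smooth_uptoP sg; apply/smooth_uptoP => n.
exact: smooth_uptoM.
Qed.

Lemma smoothB f g : smooth f -> smooth g -> smooth (fun x => f x - g x).
Proof.
move=> /smooth_uptoP sf /smooth_uptoP sg.
apply/smooth_uptoP => n; apply: smooth_uptoD => //.
have C : forall m, smooth_upto m (fun=> -1 : R).
  case=> //= m; split=> [x|]; first exact: derivable_cst.
  have -> : derive1 (fun=> -1 : R) = fun=> (0 : R).
    by apply/funext => x; exact: derive1_cst.
  elim: m => //= m IHm; split=> [x|]; first exact: derivable_cst.
  by rewrite (_ : derive1 _ = fun=> 0)//; apply/funext => x; exact: derive1_cst.
have -> : (fun x => - g x) = (fun x => -1 * g x) by apply/funext => x; rewrite mulN1r.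
exact: smooth_uptoM.
Qed.

Lemma smooth_affine f k c : smooth f -> smooth (fun x => f (k * x + c)).
Proof.
by move=> /smooth_uptoP sf; apply/smooth_uptoP => n; exact: smooth_upto_affine.
Qed.

(** [P(1/x) exp(-1/x)] extended by zero to the left half-line: this family is
    stable under derivation. *)
Definition flat P x := if 0 < x then P.[x^-1] * expR (- x^-1) else 0.

Lemma horner_le_expn P x : 1 <= x ->
  `|P.[x]| <= (\sum_(i < size P) `|P`_i|) * x ^+ (size P).
Proof.
move=> x1; rewrite horner_coef (le_trans (ler_norm_sum _ _ _))// mulr_suml.
apply: ler_sum => i _; rewrite normrM ler_wpM2l//.
rewrite normrX (ger0_norm (le_trans ler01 x1)).
by rewrite ler_weXn2l// ltnW.
Qed.

(** The exponential decays faster than any power of [x]; a quadratic bound is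
    enough for [flat P] to be derivable at zero. *)
Lemma flat_bound P : exists2 C, 0 <= C & forall x, `|x| <= 1 -> `|flat P x| <= C * x ^+ 2.
Proof.
pose n := size P; pose S := \sum_(i < size P) `|P`_i|.
have S0 : 0 <= S by apply: sumr_ge0.
exists (S * n.+2`!%:R); first by rewrite mulr_ge0.
move=> x x1; rewrite /flat; case: ifPn => [x0|_]; last first.
  by rewrite normr0 mulr_ge0 ?sqr_ge0 ?mulr_ge0.
rewrite (gtr0_norm x0) in x1.
set y := x^-1; have y1 : 1 <= y by rewrite invf_ge1.
have y0 : 0 < y by rewrite invr_gt0.
rewrite normrM (gtr0_norm (expR_gt0 _)) expRN.
have E : y ^+ n.+2 / n.+2`!%:R <= expR y.
  by apply: le_trans (expR_ge1Dxn n.+1 (ltW y0)); rewrite lerDr.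
have F0 : 0 < n.+2`!%:R :> R by rewrite ltr0n fact_gt0.
have {}E : (expR y)^-1 <= n.+2`!%:R / y ^+ n.+2.
  rewrite -[leRHS]invrK lef_pV2 ?posrE ?expR_gt0 ?invr_gt0 ?divr_gt0 ?exprn_gt0//.
  by rewrite invfM invrK mulrC.
apply: (le_trans (ler_pM (normr_ge0 _) _ (horner_le_expn P y1) E)).
  by rewrite invr_ge0 expR_ge0.
rewrite -/S -/n.
have -> : x = y^-1 by rewrite /y invrK.
have yn0 : y != 0 by rewrite gt_eqF.
have ynn : y ^+ n != 0 by rewrite expf_neq0.
rewrite le_eqVlt; apply/orP; left; apply/eqP; rewrite !exprS.
move: (y ^+ n) ynn => z z0; field.
by rewrite yn0 z0.
Qed.

Lemma flat_derive P x : is_derive x (1 : R) (flat P) (flat ('X^2 * (P - P^`())) x).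
Proof.
have [x0|x0|->] := ltgtP x 0.
- rewrite {2}/flat ltNge (ltW x0)/=.
  apply: (@near_eq_is_derive R R R (fun=> 0) (flat P) x 1 0).
  near=> y; rewrite /flat ltNge; have y0 : y < 0 by near: y; exact: lt_nbhsl.
  by rewrite (ltW y0).
- rewrite {2}/flat x0.
  apply: (@near_eq_is_derive R R R (fun y => P.[y^-1] * expR (- y^-1)) (flat P) x 1).
    near=> y; rewrite /flat; have y0 : 0 < y by near: y; exact: lt_nbhsr.
    by rewrite y0.
  have dV : is_derive x (1 : R) (fun y => y^-1) (- x ^- 2).
    have := @is_deriveV _ id x 1 1 (lt0r_neq0 x0) (is_derive_id _ _).
    by rewrite /GRing.scale/= mulr1.
  have dP : is_derive x (1 : R) (fun y => P.[y^-1]) (P^`().[x^-1] * (- x ^- 2)).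
    exact: (@is_derive1_comp _ (horner P) (fun y => y^-1)).
  have dE : is_derive x (1 : R) (fun y => expR (- y^-1)) (expR (- x^-1) * (x ^- 2)).
    apply: (@is_derive1_comp _ expR (fun y => - y^-1)).
    by rewrite -[x ^- 2]opprK; exact: is_deriveN.
  have xn : x != 0 by rewrite gt_eqF.
  have <- : P.[x^-1] * (expR (- x^-1) * x ^- 2) +
      expR (- x^-1) * (P^`().[x^-1] * (- x ^- 2)) =
      ('X^2 * (P - P^`())).[x^-1] * expR (- x^-1).
    rewrite hornerM hornerXn hornerD hornerN -exprVn.
    by ring.
  exact: (is_derive1M dP dE).
- rewrite {2}/flat ltxx.
  have [C C0 HC] := flat_bound P.
  have L : (fun h : R => h^-1 *: (flat P (h *: (1 : R) + 0) - flat P 0)) @ 0^' --> (0 : R).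
    apply/cvgrPdist_le => e e0; near=> h.
    rewrite sub0r normrN.
    have -> : flat P 0 = 0 by rewrite /flat ltxx.
    rewrite subr0 addr0 /GRing.scale/= mulr1 normrM.
    have hn : h != 0 by near: h; exact: nbhs_dnbhs_neq.
    have h1 : `|h| <= 1 by near: h; exact: dnbhs0_le.
    apply: (@le_trans _ _ (`|h^-1| * (C * h ^+ 2))); first by rewrite ler_wpM2l// HC.
    have -> : `|h^-1| * (C * h ^+ 2) = C * `|h|.
      rewrite normfV -real_normK ?num_real//; field.
      by rewrite normr_eq0.
    apply: (@le_trans _ _ ((C + 1) * `|h|)); first by rewrite ler_wpM2r// lerDl.
    rewrite mulrC -ler_pdivlMr ?ltr_wpDl//.
    near: h; apply: dnbhs0_le; rewrite divr_gt0// ltr_wpDl//.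
  apply: DeriveDef; first by apply/cvg_ex; exists 0.
  rewrite /derive; exact/cvg_lim.
Unshelve. all: by end_near. Qed.

Lemma flat_smooth P : smooth (flat P).
Proof.
have E n : exists Q, derive1n n (flat P) = flat Q.
  elim: n => [|n [Q IH]]; first by exists P.
  exists ('X^2 * (Q - Q^`())).
  by rewrite derive1nS IH (derive1_unique (flat_derive Q)).
move=> n x; have [Q ->] := E n; by case: (flat_derive Q x).
Qed.

(** Positive exactly on [a < x < b], and tending to the indicator function of that
    interval as [n] grows, since [flat 1] tends to one at infinity. *)
Definition bump (n : nat) a b x :=
  flat 1 (n.+1%:R * x + (- (n.+1%:R * a))) * flat 1 (- n.+1%:R * x + n.+1%:R * b).

Lemma flat1_ge0 x : 0 <= flat 1 x.
Proof. by rewrite /flat; case: ifP => // _; rewrite hornerC mul1r expR_ge0. Qed.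

Lemma flat1_le1 x : flat 1 x <= 1.
Proof.
rewrite /flat; case: ifPn => // x0.
by rewrite hornerC mul1r expR_le1 oppr_le0 invr_ge0 ltW.
Qed.

Lemma bump_smooth n a b : smooth (bump n a b).
Proof.
by apply: smoothM; apply: smooth_affine; exact: flat_smooth.
Qed.

Lemma bump_ge0 n a b x : 0 <= bump n a b x.
Proof. by rewrite mulr_ge0 ?flat1_ge0. Qed.

Lemma bump_le1 n a b x : bump n a b x <= 1.
Proof. by rewrite mulr_ile1 ?flat1_ge0 ?flat1_le1. Qed.

Lemma bump_out n a b x : ~~ (a < x < b) -> bump n a b x = 0.
Proof.
rewrite negb_and -!leNgt /bump /flat => /orP[xa|bx].
  by rewrite ifF ?mul0r//; apply/negbTE; rewrite -leNgt subr_le0 ler_pM2l.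
rewrite [X in _ * X]ifF ?mulr0//; apply/negbTE; rewrite -leNgt.
by rewrite mulNr addrC subr_le0 ler_pM2l.
Qed.

Lemma bump_cvg a b x : a < x < b -> bump n a b x @[n --> \oo] --> (1 : R).
Proof.
move=> /andP[ax xb].
have flat_cvg t : 0 < t -> flat 1 (n.+1%:R * t) @[n --> \oo] --> (1 : R).
  move=> t0.
  have -> : (fun n => flat 1 (n.+1%:R * t)) = (fun n => expR (- (t^-1 * n.+1%:R^-1))).
    apply/funext => n; rewrite /flat mulr_gt0// hornerC mul1r invfM.
    by rewrite mulrC.
  rewrite -[X in _ --> X]expR0.
  apply: (@cvg_comp _ _ _ (fun n => - (t^-1 * n.+1%:R^-1)) expR _ (nbhs (0 : R))).
    rewrite -oppr0; apply: cvgN; rewrite -[X in _ --> X](mulr0 t^-1).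
    apply: cvgM; first exact: cvg_cst.
    exact: cvg_harmonic.
  exact: continuous_expR.
rewrite -[X in _ --> X](mulr1 1); apply: cvgM.
  have -> : (fun n => flat 1 (n.+1%:R * x + - (n.+1%:R * a))) = (fun n => flat 1 (n.+1%:R * (x - a))).
    by apply/funext => n; rewrite mulrBr.
  by apply: flat_cvg; rewrite subr_gt0.
have -> : (fun n => flat 1 (- n.+1%:R * x + n.+1%:R * b)) = (fun n => flat 1 (n.+1%:R * (b - x))).
  by apply/funext => n; rewrite mulrBr addrC mulNr.
by apply: flat_cvg; rewrite subr_gt0.
Qed.

Lemma test_functionP (U : set R) f a b : smooth f ->
  (forall x, ~~ (a <= x <= b) -> f x = 0) -> `[a, b] `<=` U ->
  test_function U f.
Proof.
move=> sf f0 abU.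
have sub : closure [set x | f x != 0] `<=` `[a, b].
  rewrite (_ : `[a, b]%classic = closure `[a, b]).
    apply: closure_subset => x /= fx; rewrite in_itv/=.
    by apply: contraNT fx => /f0 ->.
  by apply/closure_id; exact: itv_closed.
split => //; last exact: subset_trans abU.
by apply: subclosed_compact sub; [exact: closed_closure|exact: segment_compact].
Qed.

End SmoothBump.

(** * Weak derivatives of continuous functions on the line *)

Section WeakDerivative.
Context {R : realType}.
Local Notation mu := (@lebesgue_measure R).
Implicit Types (f g u v : R -> R) (x a b s : R).

Lemma Rintegral_eq_support f (D D' : set R) : (forall x, D x -> ~ D' x -> f x = 0) ->
  (forall x, D' x -> ~ D x -> f x = 0) ->
  \int[mu]_(x in D) f x = \int[mu]_(x in D') f x.
Proof.
move=> H H'; rewrite /Rintegral integral_mkcond [in RHS]integral_mkcond.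
congr fine; apply: eq_integral => x _; rewrite !patchE.
case: (boolP (x \in D)) => [/set_mem Dx|/negP nD].
  case: (boolP (x \in D')) => // /negP nD'.
  by rewrite (H _ Dx)// => D'x; apply: nD'; exact/mem_set.
case: (boolP (x \in D')) => // /set_mem D'x.
by rewrite (H' _ D'x)// => Dx; apply: nD; exact/mem_set.
Qed.

Lemma Rintegral_support f (D : set R) a b : `[a, b] `<=` D ->
  (forall x, D x -> ~~ (a <= x <= b) -> f x = 0) ->
  \int[mu]_(x in D) f x = \int[mu]_(x in `[a, b]) f x.
Proof.
move=> abD f0; apply: Rintegral_eq_support => x; last by move=> /abD.
by move=> Dx; rewrite /= in_itv/= => /negP; exact: f0.
Qed.

Lemma continuous_translate f s : continuous f -> continuous (fun x => f (x + s)).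
Proof.
move=> cf x; apply: (@continuous_comp _ _ _ (fun x => x + s) f).
  by apply: cvgD; [exact: cvg_id|exact: cvg_cst].
exact: cf.
Qed.

(** The zero function is a primitive of [u], and primitives are derivable
    almost everywhere with the expected derivative. *)
Lemma seg_integral0_ae u : locally_integrable setT u ->
  (forall a b, a <= b -> \int[mu]_(x in `[a, b]) u x = 0) ->
  {ae mu, forall x, u x = 0}.
Proof.
move=> Iu u0; have pu : is_primitive (fun=> 0) u.
  by move=> a b ab; rewrite u0// subrr.
apply: filterS (is_primitive_ae_derive Iu pu).
  exact: (ae_filter_ringOfSetsType mu).
by move=> x [_ <-]; rewrite derive_cst.
Qed.

(** Away from the end points, the bumps on [[a, b]] tend to the indicator
    function of [[a, b]]. *)
Lemma test_orthogonal0 u : locally_integrable setT u ->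
  (forall n a b, \int[mu]_x (u x * bump n a b x) = 0) ->
  forall a b, a <= b -> \int[mu]_(x in `[a, b]) u x = 0.
Proof.
move=> Iu H a b ab.
pose v n x := u x * bump n a b x.
have mv n : measurable_fun setT (v n).
  apply: measurable_funM; first exact: locint_measurable.
  apply: continuous_measurable_fun; apply: smooth_continuous.
  exact: bump_smooth.
have cv : \int[mu]_(x in `[a, b]) v n x @[n --> \oo] --> \int[mu]_(x in `[a, b]) u x.
  apply: (dominated_cvg_seg mv (locint_measurable Iu) (locint_norm Iu)).
    have N : mu.-negligible [set a; b].
      apply/negligibleP; first by apply: measurableU.
      apply: countable_lebesgue_measure0; apply: finite_set_countable.
      exact: finite_set2.
    apply: negligibleS N => x /=; apply: contra_notP => /not_orP[xa xb] /andP[ax bx].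
    rewrite -[X in _ --> X]mulr1; apply: cvgM; first exact: cvg_cst.
    apply: bump_cvg; rewrite !lt_neqAle ax bx !andbT; apply/andP; split.
      by apply/eqP => e; apply: xa.
    by apply/eqP.
  move=> n x _; rewrite normrM ler_piMr// ger0_norm ?bump_ge0// bump_le1//.
have v0 n : \int[mu]_(x in `[a, b]) v n x = 0.
  rewrite -(H n a b); apply/esym/Rintegral_support => // x _ xab.
  rewrite /v bump_out ?mulr0//; apply: contra xab.
  by move=> /andP[/ltW -> /ltW ->].
have c0 : \int[mu]_(x in `[a, b]) v n x @[n --> \oo] --> (0 : R).
  by rewrite (_ : (fun n => _) = fun=> 0); [exact: cvg_cst|exact/funext].
exact: (cvg_unique (@Rhausdorff R) cv c0).
Qed.

Lemma continuous_ae0 u : continuous u ->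
  (forall a b, a <= b -> \int[mu]_(x in `[a, b]) u x = 0) ->
  forall x, u x = 0.
Proof.
move=> cu u0 x; have Iu := continuous_locint cu.
have pu : is_primitive (fun=> 0) u.
  by move=> a b ab; rewrite u0// subrr.
have [] := lebesgue_pt_is_derive Iu pu (x := x) _.
  apply: (@continuous_lebesgue_pt _ _ _ setT) => //.
    by split => //; exact: openT.
    exact: continuous_measurable_fun.
  exact: cu.
by move=> _ <-; rewrite derive_cst.
Qed.

Lemma Rintegral_test f phi a b : (forall x, ~~ (a <= x <= b) -> phi x = 0) ->
  \int[mu]_x (f x * phi x) = \int[mu]_(x in `[a, b]) (f x * phi x) :> R.
Proof.
by move=> p0; apply: Rintegral_support => // x _ xab; rewrite p0 ?mulr0.
Qed.

Lemma derive1_out (phi : R -> R) a b : (forall x, ~~ (a <= x <= b) -> phi x = 0) ->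
  forall x, ~~ (a <= x <= b) -> derive1 phi x = 0.
Proof.
move=> p0 x xab; rewrite derive1E.
have -> : 'D_1 phi x = 'D_1 (fun=> 0 : R) x.
  apply: near_eq_derive.
  move: xab; rewrite negb_and -!ltNge => /orP[xa|bx]; near=> y; apply: p0;
    rewrite negb_and -!ltNge; apply/orP; [left|right].
    by near: y; exact: (lt_nbhsl xa).
  by near: y; exact: (lt_nbhsr bx).
by rewrite derive_cst.
Unshelve. all: by end_near. Qed.

Lemma test_function_seg (U : set R) phi : test_function U phi ->
  exists n : nat, forall x, ~~ (- n%:R <= x <= n%:R) -> phi x = 0.
Proof.
move=> [_ cK _]; have [n Kn] := compact_segment_bound cK; exists n => x.
apply: contraNeq => px; have := Kn x _; rewrite /= in_itv/=; apply.
by apply: subset_closure.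
Qed.

Lemma test_function_smooth (U : set R) phi : test_function U phi -> smooth phi.
Proof. by case. Qed.

Lemma primitive_weak_derivative f g : locally_integrable setT g ->
  is_primitive f g -> weak_derivative setT f g.
Proof.
move=> Ig pf; have cf := is_primitive_continuous Ig pf.
split=> //; first exact: continuous_locint.
move=> phi tphi; have sphi := test_function_smooth tphi.
have [n p0] := test_function_seg tphi.
rewrite (Rintegral_test f (derive1_out p0)) (Rintegral_test g p0).
have cd := smooth_continuous (smooth_derive1 sphi).
have pphi : is_primitive phi (derive1 phi).
  exact: derive_is_primitive (smooth_is_derive sphi) cd.
have nn : - (n.+1)%:R <= (n.+1)%:R :> R by rewrite -subr_ge0 opprK addr_ge0.
have p0' x : ~~ (- n.+1%:R < x < n.+1%:R) -> phi x = 0.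
  move=> H; apply: p0; apply: contra H => /andP[H1 H2].
  rewrite (lt_le_trans _ H1) ?(le_lt_trans H2) ?ltrN2 ?ltr_nat//.
have p0'' x : ~~ (- n.+1%:R <= x <= n.+1%:R) -> phi x = 0.
  move=> H; apply: p0'; apply: contra H => /andP[H1 H2].
  by rewrite (ltW H1) (ltW H2).
rewrite -(Rintegral_test f (derive1_out p0)) -(Rintegral_test g p0).
rewrite (Rintegral_test f (derive1_out p0'')) (Rintegral_test g p0'').
under eq_Rintegral do rewrite mulrC.
rewrite (is_primitive_ibp nn Ig (continuous_locint cd) pf pphi).
by rewrite !p0' ?mulr0 ?subr0 ?sub0r// ltxx ?andbF.
Qed.

Lemma bump_seg n a b x : ~~ (a <= x <= b) -> bump n a b x = 0.
Proof.
move=> H; apply: bump_out; apply: contra H => /andP[H1 H2].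
by rewrite (ltW H1) (ltW H2).
Qed.

Lemma weak_derivative_ae f g1 g2 : weak_derivative setT f g1 ->
  weak_derivative setT f g2 -> {ae mu, forall x, g1 x = g2 x}.
Proof.
move=> [_ I1 H1] [_ I2 H2].
have I12 : locally_integrable setT (fun x => g1 x - g2 x) by exact: locintB.
have : {ae mu, forall x, g1 x - g2 x = 0}.
  apply: (seg_integral0_ae I12); apply: (test_orthogonal0 I12) => n a b.
  have tb : test_function setT (bump n a b).
    by apply: (@test_functionP _ _ _ a b) => // *; [exact: bump_smooth|exact: bump_seg].
  have := H1 _ tb; rewrite (H2 _ tb) => /oppr_inj.
  rewrite !(Rintegral_test _ (@bump_seg n a b)) => e.
  under eq_Rintegral do rewrite mulrBl.
  have cb : continuous (bump n a b) by exact/smooth_continuous/bump_smooth.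
  by rewrite RintegralB_seg ?e ?subrr//; exact: locint_cM.
apply: filterS; first exact: (ae_filter_ringOfSetsType mu).
by move=> x /eqP; rewrite subr_eq0 => /eqP.
Qed.

(** A continuous function with a weak derivative is a primitive of it: its
    difference [u] with a primitive has weak derivative zero, and testing
    against a primitive of [eta - eta(. - s)] shows that [u] and its translate
    by [s] coincide. *)
Lemma weak_derivative_primitive f g : continuous f -> weak_derivative setT f g ->
  is_primitive f g.
Proof.
move=> cf [_ Ig H].
have [V pV] : exists V, is_primitive V g.
  by eexists; exact: is_primitive_integral Ig.
have cV := is_primitive_continuous Ig pV.
pose u x := f x - V x.
have cu : continuous u by move=> x; apply: cvgB; [exact: cf|exact: cV].
have Iu := continuous_locint cu.
have Hu phi : test_function setT phi -> \int[mu]_x (u x * derive1 phi x) = 0.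
  move=> tphi; have [n p0] := test_function_seg tphi.
  have [_ _ HV] := primitive_weak_derivative Ig pV.
  rewrite (Rintegral_test _ (derive1_out p0)).
  under eq_Rintegral do rewrite mulrBl.
  have cd : continuous (derive1 phi).
    exact/smooth_continuous/smooth_derive1/(test_function_smooth tphi).
  rewrite RintegralB_seg; last 2 first.
  - by apply: locint_cM => //; exact: continuous_locint.
  - by apply: locint_cM => //; exact: continuous_locint.
  rewrite -!(Rintegral_test _ (derive1_out p0)).
  by rewrite H// HV// subrr.
have us s x : 0 <= s -> u x = u (x + s).
  move=> s0; apply/eqP; rewrite -subr_eq0; apply/eqP; move: x.
  have cus : continuous (fun x => u (x + s)).
    exact: continuous_translate.
  apply: continuous_ae0.
    by move=> x; apply: cvgB; [exact: cu|exact: cus].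
  have Ius := continuous_locint cus.
  apply: test_orthogonal0; first exact: locintB.
  move=> n a b; have [ab|ba] := leP a b; last first.
    rewrite (Rintegral_test _ (@bump_seg n a b)) set_itv_ge ?Rintegral_set0//.
    by rewrite bnd_simp -ltNge.
  pose eta := bump n a b.
  have seta : smooth eta by exact: bump_smooth.
  have ceta := smooth_continuous seta.
  have Ieta := continuous_locint ceta.
  have [E pE] : exists E, is_primitive E eta.
    by eexists; exact: is_primitive_integral Ieta.
  have dE x : is_derive x (1 : R) E (eta x).
    apply: (lebesgue_pt_is_derive Ieta pE).
    apply: (@continuous_lebesgue_pt _ _ _ setT) => //.
        by split => //; exact: openT.
      exact: continuous_measurable_fun.
    exact: ceta.
  have sE : smooth E.
    apply: smooth_of_derive1; first by move=> x; case: (dE x).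
    by rewrite (derive1_unique dE).
  pose phi x := E x - E (1 * x + - s).
  have sphi : smooth phi by exact: (smoothB sE (@smooth_affine _ E 1 (- s) sE)).
  have dphi x : derive1 phi x = eta x - eta (x - s).
    have D y : is_derive y (1 : R) phi (eta y - eta (y - s)).
      apply: is_deriveB.
      have := @is_derive1_comp _ E (fun x => 1 * x + - s) y (eta (1 * y + - s)) 1 (dE _) _.
      rewrite mul1r mulr1; apply.
      have -> : (fun x => 1 * x - s) = (fun x => x - s) by apply/funext => z; rewrite mul1r.
      have := @is_deriveB _ _ _ id (cst s) y 1 1 0 _ _.
      by rewrite subr0; apply.
    by rewrite (derive1_unique D).
  have phi0 x : ~~ (a <= x <= b + s) -> phi x = 0.
    move=> xab; rewrite /phi mul1r.
    have xs : x - s <= x by rewrite lerBlDr lerDl.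
    rewrite pE//.
    rewrite (_ : Rintegral _ _ _ = \int[mu]_(y in `[x - s, x]) (0 : R)).
      by rewrite Rintegral_seg_cst// mul0r.
    apply: eq_Rintegral => y; rewrite inE/= in_itv/= => /andP[xy yx].
    apply: bump_seg; move: xab; rewrite !negb_and -!ltNge => /orP[xa|bx].
      by rewrite (le_lt_trans yx).
    by rewrite (lt_le_trans _ xy) ?orbT// ltrBrDr.
  have tphi : test_function setT phi by exact: test_functionP sphi phi0 _.
  have := Hu _ tphi.
  under eq_Rintegral do rewrite dphi mulrBr.
  rewrite (@Rintegral_support _ _ a (b + s))//; last first.
    move=> x _ xab; rewrite -mulrBr -dphi; apply/eqP; rewrite mulf_eq0; apply/orP; right.
    by apply/eqP; apply: derive1_out xab.
  have cetas : continuous (fun x => eta (x - s)).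
    exact: continuous_translate.
  rewrite RintegralB_seg; [|exact: locint_cM|exact: locint_cM].
  have -> : \int[mu]_(x in `[a, b + s]) (u x * eta x) = \int[mu]_(x in `[a, b]) (u x * eta x).
    apply: Rintegral_support.
      by move=> x /=; rewrite !in_itv/= => /andP[-> xb]/=; rewrite (le_trans xb)// lerDl.
    by move=> x _ xab; rewrite /eta bump_seg ?mulr0.
  have -> : \int[mu]_(x in `[a, b + s]) (u x * eta (x - s)) =
            \int[mu]_(x in `[a, b]) (u (x + s) * eta x).
    rewrite -[RHS]/(Rintegral mu `[a, b] (fun x => u (x + s) * eta x)).
    transitivity (\int[mu]_(x in `[a + s, b + s]) (u x * eta (x - s))).
      apply: Rintegral_support.
        by move=> x /=; rewrite !in_itv/= => /andP[xa ->]; rewrite (le_trans _ xa)// lerDl.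
      move=> x _ xab; rewrite /eta bump_seg ?mulr0//.
      by rewrite lerBrDr lerBlDr.
    rewrite -Rintegral_shift; last exact: locint_cM.
    by apply: eq_Rintegral => x _; rewrite addrK.
  rewrite (Rintegral_test _ (@bump_seg n a b)) -/eta => e.
  under eq_Rintegral do rewrite mulrBl.
  by rewrite RintegralB_seg//; exact: locint_cM.
move=> a b ab; rewrite -(pV _ _ ab).
have := us (b - a) a; rewrite subr_ge0 => /(_ ab).
by rewrite addrC subrK /u => e; lra.
Qed.

End WeakDerivative.

(** * The space W^{1,oo} of the circle *)

Section W1infTheory.
Context {R : realType}.
Local Notation mu := (@lebesgue_measure R).
Implicit Types (f g h v : R -> R) (x a b s M : R).

Lemma lebesgue_setT_gt0 : (0 < mu [set: R])%E.
Proof.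
apply: (@lt_le_trans _ _ (mu `[0, 1]%classic)).
  by rewrite lebesgue_measure_itv/= lte_fin ltr01 oppr0 adde0 lte_fin.
by apply: le_measure; rewrite ?inE//; exact: measurable_itv.
Qed.

Lemma Lnorm_oo_le f A : 0 <= A -> {ae mu, forall x, `|f x| <= A} ->
  ('N[mu]_+oo [EFin \o f] <= A%:E)%E.
Proof.
move=> A0 fA; rewrite unlock lebesgue_setT_gt0.
apply/ess_supP; apply: filterS fA; first exact: (ae_filter_ringOfSetsType mu).
by move=> x; rewrite /= lee_fin.
Qed.

Lemma finite_norm_oo_bound f : finite_norm mu +oo%E f ->
  exists M, {ae mu, forall x, `|f x| <= M}.
Proof.
rewrite /finite_norm unlock lebesgue_setT_gt0 => H.
have [M HM] := @ess_supr_bounded _ _ R mu (fun x => `|f x|) H.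
by exists M.
Qed.

Lemma ae_and (P Q : R -> Prop) : {ae mu, forall x, P x} -> {ae mu, forall x, Q x} ->
  {ae mu, forall x, P x /\ Q x}.
Proof.
by move=> HP HQ; apply: (@filterI _ _ (ae_filter_ringOfSetsType mu)).
Qed.

Lemma ae_imply (P Q : R -> Prop) : (forall x, P x -> Q x) ->
  {ae mu, forall x, P x} -> {ae mu, forall x, Q x}.
Proof.
move=> PQ; apply: filterS; first exact: (ae_filter_ringOfSetsType mu).
exact: PQ.
Qed.

Lemma wderivP v : (exists g, weak_derivative setT v g) ->
  weak_derivative setT v (wderiv v).
Proof. by move=> [g vg]; exact: (xgetPex (cst 0) (ex_intro _ g vg)). Qed.

Lemma W1inf_wderiv v : W1inf v -> weak_derivative setT v (wderiv v).
Proof. by move=> [_ _ [g vg _]]; apply: wderivP; exists g. Qed.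

Lemma W1inf_locint v : W1inf v -> locally_integrable setT (wderiv v).
Proof. by case/W1inf_wderiv. Qed.

Lemma W1inf_primitive v : W1inf v -> is_primitive v (wderiv v).
Proof.
by move=> Wv; case: (Wv) => _ cv _; exact: weak_derivative_primitive (W1inf_wderiv Wv).
Qed.

Lemma W1inf_bound v a b : W1inf v ->
  exists2 M, 0 <= M & {ae mu, forall x, a <= x <= b -> `|wderiv v x| <= M}.
Proof.
move=> Wv; case: (Wv) => _ _ [g vg gK].
have [M HM] := finite_norm_oo_bound (gK _ (@segment_compact _ a b)).
exists `|M| => //.
apply: ae_imply (ae_and HM (weak_derivative_ae (W1inf_wderiv Wv) vg)) => x [] + -> xab.
rewrite patchE ifT; last by rewrite inE/= in_itv.
by move=> /le_trans; apply; exact: ler_norm.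
Qed.

Lemma primitive_lip_ae f g a b M : 0 <= M -> locally_integrable setT g ->
  is_primitive f g -> {ae mu, forall x, a <= x <= b -> `|g x| <= M} ->
  forall x y, a <= x -> x <= y -> y <= b -> `|f y - f x| <= M * (y - x).
Proof.
move=> M0 Ig pf gM x y ax xy yb.
rewrite pf//.
(* [g] obeys the bound up to a null set only; clamping it makes the bound hold
   everywhere. *)
pose k z := Num.max (- M) (Num.min M (g z)).
have mk : measurable_fun setT k.
  apply: (@measurable_maxr _ _ _ setT (fun=> - M)); first exact: measurable_cst.
  apply: (@measurable_minr _ _ _ setT (fun=> M)); first exact: measurable_cst.
  exact: locint_measurable.
have kM z : `|k z| <= M.
  rewrite /k ler_norml le_max lexx/= ge_max ge_min lexx/= andbT.
  by rewrite (le_trans _ M0)// oppr_le0.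
rewrite (_ : Rintegral _ _ _ = \int[mu]_(t in `[x, y]) k t); last first.
  apply: ae_eq_Rintegral => //.
  - by apply: measurable_funTS; exact: locint_measurable.
  - exact: measurable_funTS.
  apply: ae_imply gM => t gt; rewrite /= in_itv/= => /andP[xt ty].
  have := gt _; rewrite (le_trans ax xt) (le_trans ty yb) => /(_ isT).
  by rewrite ler_norml /k => /andP[H1 H2]; rewrite (min_idPr H2) (max_idPr H1).
have Ik := bounded_locint mk kM.
apply: (le_trans (Rintegral_seg_norm _ _ Ik)).
rewrite -(Rintegral_seg_cst M xy); apply: le_Rintegral_seg => //.
- exact: locint_norm.
- exact: locint_cst.
Qed.

Lemma mvt_lip f g M : (forall x : R, is_derive x (1 : R) f (g x)) ->
  (forall x, `|g x| <= M) -> forall x y, `|f y - f x| <= M * `|y - x|.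
Proof.
move=> df gM.
have cf : continuous f.
  by move=> x; apply: differentiable_continuous; apply/derivable1_diffP; case: (df x).
have H x y : x <= y -> `|f y - f x| <= M * `|y - x|.
  move=> xy; have [|c _ ->] := @MVT_segment _ f g x y xy (fun z _ => df z).
    exact: continuous_subspaceT.
  by rewrite normrM ler_wpM2r.
move=> x y; have [xy|yx] := leP x y; first exact: H.
by rewrite distrC [`|y - x|]distrC H// ltW.
Qed.

Lemma cos_lip x y : `|cos y - cos x| <= `|y - x|.
Proof.
rewrite -[leRHS]mul1r; apply: (mvt_lip (g := fun x => - sin x)) => z.
by rewrite normrN sin_max.
Qed.

Lemma sin_lip x y : `|sin y - sin x| <= `|y - x|.
Proof.
rewrite -[leRHS]mul1r; apply: (mvt_lip (g := cos)) => z.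
exact: cos_max.
Qed.

Lemma sin_le_norm x : `|sin x| <= `|x|.
Proof. by have := sin_lip 0 x; rewrite sin0 !subr0. Qed.

Lemma cos_ge_quadratic x : 1 - x ^+ 2 / 2 <= cos x.
Proof.
have -> : x = (x / 2) *+ 2 by rewrite -mulr_natr; field.
rewrite cos_mulr2n cos2sin2.
have : sin (x / 2) ^+ 2 <= (x / 2) ^+ 2.
  by rewrite -[leLHS]real_normK ?num_real// -[leRHS]real_normK ?num_real// lerXn2r ?nnegrE// sin_le_norm.
set w := x / 2; move: (sin w) => u H.
have -> : (w *+ 2) ^+ 2 / 2 = w ^+ 2 + w ^+ 2 by rewrite mulr2n; field.
by rewrite mulr2n; lra.
Qed.

Lemma W1inf_of_primitive f g M : circle_periodic f -> measurable_fun setT g ->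
  (forall x, `|g x| <= M) -> is_primitive f g -> W1inf f.
Proof.
move=> per mg gM pf; have Ig := bounded_locint mg gM.
split=> //; first exact: is_primitive_continuous pf.
exists g; first exact: primitive_weak_derivative.
have M0 : 0 <= M by exact: le_trans (gM 0).
move=> K cK; rewrite /finite_norm.
apply: (@le_lt_trans _ _ M%:E); last by rewrite ltry.
apply: Lnorm_oo_le => //; apply/aeW => x; rewrite patchE.
by case: ifP; rewrite ?normr0.
Qed.

Lemma wderiv_primitive f g : locally_integrable setT g -> is_primitive f g ->
  {ae mu, forall x, wderiv f x = g x}.
Proof.
move=> Ig pf; have fg := primitive_weak_derivative Ig pf.
by apply: (@weak_derivative_ae _ f) => //; apply: wderivP; exists g.
Qed.

Lemma W1inf_norm_le f g A B : 0 <= A -> 0 <= B -> locally_integrable setT g ->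
  is_primitive f g -> (forall x, `|f x| <= A) -> (forall x, `|g x| <= B) ->
  (W1inf_norm f <= (A + B)%:E)%E.
Proof.
move=> A0 B0 Ig pf fA gB; rewrite /W1inf_norm EFinD; apply: leeD.
  apply: Lnorm_oo_le => //; apply/aeW => x; rewrite patchE.
  by case: ifP; rewrite ?normr0.
apply: Lnorm_oo_le => //.
apply: ae_imply (wderiv_primitive Ig pf) => x e; rewrite patchE.
by case: ifP; rewrite ?normr0// e.
Qed.

(** Right-continuous functions are measurable: they are limits of their values
    at the next point of a finer and finer grid. *)
Lemma right_continuous_measurable f :
  (forall x, f y @[y --> x^'+] --> f x) -> measurable_fun setT f.
Proof.
move=> rc.
pose grid (n : nat) x : R := (Num.floor (n.+1%:R * x) + 1)%:~R / n.+1%:R.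
have mg n : measurable_fun setT (f \o grid n).
  move=> _ B mB; rewrite setTI.
  have -> : (f \o grid n) @^-1` B =
      \bigcup_(k in [set k : int | B (f ((k + 1)%:~R / n.+1%:R))])
        `[k%:~R / n.+1%:R, (k + 1)%:~R / n.+1%:R[%classic.
    apply/seteqP; split => [x Bx|x [k /= Bk]] /=.
      exists (Num.floor (n.+1%:R * x)) => //=; rewrite in_itv/=.
      rewrite ler_pdivrMr// mulrC Num.Theory.floor_le/= ltr_pdivlMr// mulrC.
      exact: Num.Theory.floorD1_gt.
    rewrite in_itv/= => /andP[kx xk].
    rewrite /grid; suff -> : Num.floor (n.+1%:R * x) = k by [].
    by apply: Num.Theory.floor_def; rewrite mulrC -ler_pdivrMr// kx/= -ltr_pdivlMr.
  rewrite bigcup_mkcond; apply: countable_bigcupT_measurable; first exact: countableP.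
  by move=> k; case: ifP => _; [exact: measurable_itv|exact: measurable0].
apply: (measurable_fun_cvg (h := fun n => f \o grid n)) => // x _.
have gx n : x < grid n x /\ grid n x <= x + n.+1%:R^-1.
  rewrite /grid; split.
    by rewrite ltr_pdivlMr// mulrC Num.Theory.floorD1_gt.
  rewrite ler_pdivrMr// mulrDl mulVf// intrD lerD2r mulrC.
  exact: Num.Theory.floor_le.
have /= := rc x; move=> /cvg_at_rightP H; apply: H; split.
  by move=> n; case: (gx n).
apply/cvgrPdist_lt => e e0; near=> n.
case: (gx n) => g1 g2; rewrite distrC ger0_norm ?subr_ge0 ?ltW//.
rewrite ltrBlDl (le_lt_trans g2)// ltrD2l.
near: n; exact: (near_infty_natSinv_lt (PosNum e0)).
Unshelve. all: by end_near. Qed.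

End W1infTheory.

(** * Semiconvex Lipschitz functions *)

Section Semiconvex.
Context {R : realType}.
Local Notation mu := (@lebesgue_measure R).
Implicit Types (h D F : R -> R) (x y z t s a b c d e K M : R).

(** [h + K t^2 / 2] is convex. *)
Definition semiconvex K h := forall x y z, x < y -> y < z ->
  (z - x) * h y <= (z - y) * h x + (y - x) * h z +
                   K / 2 * ((z - y) * (y - x) * (z - x)).

Definition quotient h t s := s^-1 * (h (t + s) - h t).

Definition right_derivative h t := lim (quotient h t @ 0^'+).

(** After [n] halvings of [[c, d]] the bounds on the pieces add up to
    [(F d - F c) (d - c) / 2 ^ n]. *)
Lemma halving_const D F : (forall c d, c <= d ->
    `|D d - D c| <= (F d - F c) * (d - c)) -> forall x y, D x = D y.
Proof.
move=> H.
have H2 n c d : c <= d -> `|D d - D c| * 2 ^+ n <= (F d - F c) * (d - c).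
  elim: n c d => [|n IH] c d cd; first by rewrite expr0 mulr1; exact: H.
  pose m := (c + d) / 2.
  have cm : c <= m by rewrite /m ler_pdivlMr//; lra.
  have md : m <= d by rewrite /m ler_pdivrMr//; lra.
  have := IH _ _ cm; have := IH _ _ md.
  have -> : d - m = (d - c) / 2 by rewrite /m; field.
  have -> : m - c = (d - c) / 2 by rewrite /m; field.
  have : `|D d - D c| <= `|D d - D m| + `|D m - D c|.
    by rewrite (le_trans _ (ler_normD _ _))// addrA subrK.
  have : 0 <= 2 ^+ n :> R by rewrite exprn_ge0.
  rewrite exprS; move: (2 ^+ n) (`|D d - D c|) (`|D d - D m|) (`|D m - D c|).
  move=> w p q r w0 pqr h1 h2.
  have h3 : p * w <= (q + r) * w by rewrite ler_wpM2r.
  lra.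
have HH c d : c <= d -> D c = D d.
  move=> cd; apply/eqP; rewrite -subr_eq0 -normr_eq0 eq_le normr_ge0 andbT.
  rewrite leNgt; apply/negP => p0.
  pose n := (Num.truncn ((F d - F c) * (d - c) / `|D c - D d|)).+1.
  have : (F d - F c) * (d - c) < `|D d - D c| * 2 ^+ n.
    rewrite distrC -ltr_pdivrMl// mulrC.
    apply: (@lt_le_trans _ _ n%:R); first exact: Num.Theory.truncnS_gt.
    by rewrite -natrX ler_nat ltnW// ltn_expl.
  by rewrite ltNge H2.
by move=> x y; have [/HH//|/ltW/HH] := leP x y.
Qed.

Section Fixed.
Variables (h : R -> R) (K M : R).
Hypotheses (K0 : 0 <= K) (hlip : forall x y, `|h y - h x| <= M * `|y - x|)
  (hconv : semiconvex K h).

Local Notation q := (quotient h).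
Local Notation rd := (right_derivative h).

Lemma quotient_bound t s : s != 0 -> `|q t s| <= M.
Proof.
move=> s0; rewrite /quotient normrM normfV ler_pdivrMl ?normr_gt0// mulrC.
by have := hlip t (t + s); rewrite addrAC subrr add0r.
Qed.

Lemma lip_const_ge0 : 0 <= M.
Proof. by have := hlip 0 1; rewrite subr0 normr1 mulr1; apply: le_trans. Qed.

(** Up to a constant, [q t s + K / 2 * s] is the slope from [t] to [t + s] of
    the convex function [h x + K x^2 / 2]. *)
Lemma quotient_mono t s s' : 0 < s -> s <= s' ->
  q t s + K / 2 * s <= q t s' + K / 2 * s'.
Proof.
move=> s0; rewrite le_eqVlt => /predU1P[->//|ss'].
have s'0 := lt_trans s0 ss'.
have := @hconv t (t + s) (t + s'); rewrite ltrDl ltrD2l => /(_ s0 ss').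
have -> : t + s' - (t + s) = s' - s by ring.
have -> : t + s' - t = s' by ring.
have -> : t + s - t = s by ring.
move=> H; rewrite /quotient.
rewrite -(@ler_pM2l _ (s * s')) ?mulr_gt0//.
have -> : s * s' * (s^-1 * (h (t + s) - h t) + K / 2 * s) =
          s' * (h (t + s) - h t) + K / 2 * (s * s * s').
  by field; rewrite gt_eqF.
have -> : s * s' * (s'^-1 * (h (t + s') - h t) + K / 2 * s') =
          s * (h (t + s') - h t) + K / 2 * (s * s' * s').
  by field; rewrite gt_eqF.
lra.
Qed.

Lemma right_derivative_cvg t : q t s @[s --> 0^'+] --> rd t.
Proof.
pose A := [set q t s + K / 2 * s | s in [set s | 0 < s]].
have Alb : has_lbound A.
  exists (- M) => _ [s /= s0 <-].
  have := @quotient_bound t s (lt0r_neq0 s0); rewrite ler_norml => /andP[H _].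
  by rewrite (le_trans H)// lerDl mulr_ge0 ?divr_ge0// ltW.
have A0 : A !=set0 by exists (q t 1 + K / 2 * 1), 1 => //=.
suff H : q t s @[s --> 0^'+] --> inf A.
  by rewrite /right_derivative (cvg_lim _ H).
apply/cvgrPdist_le => e e0.
have e2 : 0 < e / 2 by rewrite divr_gt0.
have [_ [s1 /= s10 <-] Hs1] := @inf_adherent _ A _ e2 (conj A0 Alb).
near=> s.
have s0 : 0 < s by near: s; exact: nbhs_right_gt.
have ss1 : s <= s1 by near: s; exact: nbhs_right_le.
have Ks : (K + 1) * s <= e.
  rewrite mulrC -ler_pdivlMr ?ltr_wpDl//.
  by near: s; apply: nbhs_right_le; rewrite divr_gt0// ltr_wpDl.
have L : inf A <= q t s + K / 2 * s by apply: ge_inf => //; exists s.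
have U := quotient_mono t s0 ss1.
have Kp : 0 <= K / 2 * s by rewrite mulr_ge0 ?divr_ge0// ltW.
by rewrite ler_norml; apply/andP; split; lra.
Unshelve. all: by end_near. Qed.

Lemma right_derivativeP t e : 0 < e -> exists2 d, 0 < d & forall s, 0 < s -> s < d ->
  `|rd t - q t s| <= e.
Proof.
move=> e0; have /cvgrPdist_le /(_ e e0) := @right_derivative_cvg t.
case=> d /= d0 H; exists d => // s s0 sd; apply: H => //=.
by rewrite sub0r normrN gtr0_norm.
Qed.

Lemma right_derivative_le t s : 0 < s -> rd t <= q t s + K / 2 * s.
Proof.
move=> s0; apply/ler_addgt0Pr => e e0.
have [d d0 H] := right_derivativeP t e0.
pose s' := Num.min s (d / 2).
have s'0 : 0 < s' by rewrite lt_min s0 divr_gt0.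
have s'd : s' < d by rewrite gt_min; apply/orP; right; rewrite ltr_pdivrMr//; lra.
have s's : s' <= s by rewrite ge_min lexx.
have := H s' s'0 s'd; have := quotient_mono t s'0 s's.
rewrite ler_norml => h1 /andP[_ h2].
have : 0 <= K / 2 * s' by rewrite mulr_ge0 ?divr_ge0// ltW.
lra.
Qed.

Lemma right_derivative_ge t s : 0 < s -> q (t - s) s - K / 2 * s <= rd t.
Proof.
move=> s0; apply/ler_addgt0Pr => e e0.
have e2 : 0 < e / 2 by rewrite divr_gt0.
have [d d0 H] := right_derivativeP t e2.
pose s' := Num.min (e / 2 / (K + 1)) (d / 2).
have K1 : 0 < K + 1 by rewrite ltr_wpDl.
have s'0 : 0 < s' by rewrite lt_min !divr_gt0.
have s'd : s' < d by rewrite gt_min; apply/orP; right; rewrite ltr_pdivrMr//; lra.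
have Ks : s' * (K + 1) <= e / 2 by rewrite -ler_pdivlMr// ge_min lexx.
have := H s' s'0 s'd; rewrite ler_norml => /andP[h1 h2].
have := @hconv (t - s) t (t + s'); rewrite ltrBlDr !ltrDl => /(_ s0 s'0).
have -> : t + s' - (t - s) = s + s' by ring.
have -> : t + s' - t = s' by ring.
have -> : t - (t - s) = s by ring.
move=> C.
have {C} : q (t - s) s <= q t s' + K / 2 * (s + s').
  rewrite /quotient subrK -(@ler_pM2l _ (s * s')) ?mulr_gt0//.
  have -> : s * s' * (s^-1 * (h t - h (t - s))) = s' * (h t - h (t - s)).
    by field; rewrite gt_eqF.
  have -> : s * s' * (s'^-1 * (h (t + s') - h t) + K / 2 * (s + s')) =
      s * (h (t + s') - h t) + K / 2 * (s' * s * (s + s')).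
    by field; rewrite gt_eqF.
  lra.
by nra.
Qed.

Lemma right_derivative_mono c d : c <= d -> rd c + K * c <= rd d + K * d.
Proof.
rewrite le_eqVlt => /predU1P[->//|cd].
have s0 : 0 < d - c by rewrite subr_gt0.
have := right_derivative_le c s0; have := right_derivative_ge d s0.
have -> : d - (d - c) = c by ring.
by lra.
Qed.

Lemma right_derivative_bound t : `|rd t| <= M.
Proof.
apply/ler_addgt0Pr => e e0.
have [d d0 H] := right_derivativeP t e0.
have d2 : 0 < d / 2 by rewrite divr_gt0.
have dd : d / 2 < d by rewrite ltr_pdivrMr//; lra.
have := H _ d2 dd; have := @quotient_bound t (d / 2) (lt0r_neq0 d2).
rewrite !ler_norml => /andP[h1 h2] /andP[h3 h4].
by apply/andP; split; lra.
Qed.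

(** Monotonicity of [rd x + K x] bounds [rd y] from below. From above, [rd y]
    is at most [q y s + K / 2 * s], which depends continuously on [y] once [s]
    is fixed. *)
Lemma right_derivative_rcont t : rd y @[y --> t^'+] --> rd t.
Proof.
apply/cvgrPdist_le => e e0.
have e4 : 0 < e / 4 by rewrite divr_gt0.
have [d d0 H] := right_derivativeP t e4.
have K1 : 0 < K + 1 by rewrite ltr_wpDl.
pose s := Num.min (d / 2) (e / 4 / (K + 1)).
have s0 : 0 < s by rewrite lt_min !divr_gt0.
have sd : s < d by rewrite gt_min ltr_pdivrMr//; apply/orP; left; lra.
have Ks : s * (K + 1) <= e / 4 by rewrite -ler_pdivlMr// ge_min lexx orbT.
have := H s s0 sd; rewrite ler_norml => /andP[h1 h2].
have M0 := lip_const_ge0.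
have M1 : 0 < M + 1 by rewrite ltr_wpDl.
near=> y.
have ty : t < y by near: y; exact: nbhs_right_gt.
have y1 : (K + 1) * (y - t) <= e / 4.
  rewrite mulrC -ler_pdivlMr// lerBlDl.
  by near: y; apply: nbhs_right_le; rewrite ltrDl !divr_gt0.
have y2 : (M + 1) * (y - t) <= e / 8 * s.
  rewrite mulrC -ler_pdivlMr// lerBlDl.
  by near: y; apply: nbhs_right_le; rewrite ltrDl !(divr_gt0, mulr_gt0).
have mono := right_derivative_mono (ltW ty).
have up := right_derivative_le y s0.
have qy : q y s <= q t s + e / 4.
  rewrite /quotient -(@ler_pM2l _ s)// mulrA mulfV ?gt_eqF// mul1r mulrDr mulrA mulfV ?gt_eqF// mul1r.
  have := hlip (t + s) (y + s); have := hlip t y.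
  have -> : y + s - (t + s) = y - t by ring.
  rewrite (gtr0_norm (_ : 0 < y - t)) ?subr_gt0// !ler_norml => /andP[a1 a2] /andP[a3 a4].
  nra.
by rewrite ler_norml; apply/andP; split; nra.
Unshelve. all: by end_near. Qed.

Lemma right_derivative_measurable : measurable_fun setT rd.
Proof. by apply: right_continuous_measurable => x; exact: right_derivative_rcont. Qed.

Lemma right_derivative_locint : locally_integrable setT rd.
Proof. exact: bounded_locint right_derivative_measurable right_derivative_bound. Qed.

(** Let [V] be a primitive of the right derivative. As [rd x + K x] is
    nondecreasing, the increments of [h] and [V] over [[c, d]] both lie
    between [(rd c - K (d - c)) (d - c)] and [(rd d + K (d - c)) (d - c)], so
    [halving_const] shows that [h - V] is constant. *)
Lemma right_derivative_primitive : is_primitive h rd.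
Proof.
have Ird := right_derivative_locint.
have [V pV] : exists V, is_primitive V rd.
  by eexists; exact: is_primitive_integral Ird.
pose D x := h x - V x.
have DC : forall x y, D x = D y.
  apply: (@halving_const D (fun x => rd x + 2 * K * x)) => c d.
  rewrite le_eqVlt => /predU1P[->|cd].
    by rewrite !subrr normr0 mulr0.
  have s0 : 0 < d - c by rewrite subr_gt0.
  have up := right_derivative_le c s0; have lo := right_derivative_ge d s0.
  have cs : c + (d - c) = d by ring.
  have ds : d - (d - c) = c by ring.
  rewrite ds in lo.
  have E : q c (d - c) * (d - c) = h d - h c.
    by rewrite /quotient cs mulrAC mulVf ?gt_eqF// mul1r.
  have V1 : V d - V c <= (rd d + K * (d - c)) * (d - c).
    rewrite (pV _ _ (ltW cd)) -(Rintegral_seg_cst _ (ltW cd)).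
    apply: le_Rintegral_seg => //; first exact: locint_cst.
    move=> x /andP[cx xd]; have := right_derivative_mono xd.
    have : 0 <= K * (x - c) by rewrite mulr_ge0// subr_ge0.
    lra.
  have V2 : (rd c - K * (d - c)) * (d - c) <= V d - V c.
    rewrite (pV _ _ (ltW cd)) -(Rintegral_seg_cst _ (ltW cd)).
    apply: le_Rintegral_seg => //; first exact: locint_cst.
    move=> x /andP[cx xd]; have := right_derivative_mono cx.
    have : 0 <= K * (d - x) by rewrite mulr_ge0// subr_ge0.
    lra.
  have U1 : rd c * (d - c) <= h d - h c + K / 2 * (d - c) * (d - c).
    by rewrite -E -mulrDl ler_pM2r.
  have U2 : h d - h c - K / 2 * (d - c) * (d - c) <= rd d * (d - c).
    by rewrite -E -mulrBl ler_pM2r.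
  have P : 0 <= K * (d - c) * (d - c) by rewrite !mulr_ge0// ltW.
  have -> : D d - D c = (h d - h c) - (V d - V c) by rewrite /D; ring.
  rewrite ler_norml; apply/andP; split; lra.
move=> a b ab; rewrite -(pV _ _ ab).
by have := DC a b; rewrite /D => e; lra.
Qed.

End Fixed.

Lemma right_derivative_unique h t l : quotient h t s @[s --> 0^'+] --> l ->
  right_derivative h t = l.
Proof. by move=> H; rewrite /right_derivative (cvg_lim _ H). Qed.

Lemma right_derivative_periodic h : circle_periodic h ->
  circle_periodic (right_derivative h).
Proof.
move=> ph t; rewrite /right_derivative.
suff -> : quotient h (t + 2 * pi) = quotient h t by [].
by apply/funext => s; rewrite /quotient addrAC !ph.
Qed.

End Semiconvex.

(** * Support functions of bounded plane sets *)

Section SupportFunction.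
Context {R : realType}.
Local Notation mu := (@lebesgue_measure R).
Implicit Types (Om : set (R * R)) (h v : R -> R) (t s a b c : R) (x y z P : R * R).

(** The derivative in [t] of [dot x (eitheta t)], and also the coordinate of
    [x] along the supporting lines orthogonal to [eitheta t]. *)
Definition dot' x t := x.2 * cos t - x.1 * sin t.

Lemma dot_eitheta x t : dot x (eitheta t) = x.1 * cos t + x.2 * sin t.
Proof. by []. Qed.

Lemma dot_derive x t : is_derive t (1 : R) (fun t => dot x (eitheta t)) (dot' x t).
Proof.
have D1 := @is_deriveZ _ _ _ cos x.1 t 1 _ (is_derive_cos t).
have D2 := @is_deriveZ _ _ _ sin x.2 t 1 _ (is_derive_sin t).
have := is_deriveD D1 D2; rewrite /dot' /GRing.scale/= mulrN [- _ + _]addrC.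
exact.
Qed.

Lemma dotD x t s : dot x (eitheta (t + s)) = dot x (eitheta t) * cos s + dot' x t * sin s.
Proof. by rewrite /dot /dot' /= cosD sinD; ring. Qed.

(** Interpolation between two angles by a solution of [S + S'' = 0]: the role
    of affine interpolation is played by sinusoids. *)
Lemma dot_three x a b t : dot x (eitheta t) * sin (b - a) =
  dot x (eitheta a) * sin (b - t) + dot x (eitheta b) * sin (t - a).
Proof. by rewrite /dot /= !sinB; ring. Qed.

Lemma dot_lip x B : `|x.1| <= B -> `|x.2| <= B ->
  forall t s, `|dot x (eitheta s) - dot x (eitheta t)| <= 2 * B * `|s - t|.
Proof.
move=> x1 x2 t s.
have -> : dot x (eitheta s) - dot x (eitheta t) =
    x.1 * (cos s - cos t) + x.2 * (sin s - sin t) by rewrite /dot/=; ring.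
rewrite (le_trans (ler_normD _ _))// !normrM -mulrA mulr_natl mulr2n.
by apply: lerD; apply: ler_pM => //; [exact: cos_lip|exact: sin_lip].
Qed.

Lemma dot'_lip x B : `|x.1| <= B -> `|x.2| <= B ->
  forall t s, `|dot' x s - dot' x t| <= 2 * B * `|s - t|.
Proof.
move=> x1 x2 t s.
have -> : dot' x s - dot' x t =
    x.2 * (cos s - cos t) + - x.1 * (sin s - sin t) by rewrite /dot'; ring.
rewrite (le_trans (ler_normD _ _))// !normrM normrN -mulrA mulr_natl mulr2n.
by apply: lerD; apply: ler_pM => //; [exact: cos_lip|exact: sin_lip].
Qed.

Lemma dot_bound x B t : `|x.1| <= B -> `|x.2| <= B -> `|dot x (eitheta t)| <= 2 * B.
Proof.
move=> x1 x2; rewrite /dot/= (le_trans (ler_normD _ _))// !normrM mulr_natl mulr2n.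
by apply: lerD; rewrite -[leRHS]mulr1; apply: ler_pM => //; [exact: cos_max|exact: sin_max].
Qed.

Lemma dot_semiconvex x B : `|x.1| <= B -> `|x.2| <= B ->
  semiconvex (4 * B) (fun t => dot x (eitheta t)).
Proof.
move=> x1 x2 u t w ut tw.
have B0 : 0 <= B by exact: le_trans (normr_ge0 _) x1.
pose S t := dot x (eitheta t).
have cS : continuous S.
  by move=> r; apply: differentiable_continuous; apply/derivable1_diffP; case: (dot_derive x r).
have [|c1 /itvP c1i e1] := @MVT_segment _ S (dot' x) u t (ltW ut) (fun r _ => dot_derive x r).
  exact: continuous_subspaceT.
have [|c2 /itvP c2i e2] := @MVT_segment _ S (dot' x) t w (ltW tw) (fun r _ => dot_derive x r).
  exact: continuous_subspaceT.
have := dot'_lip x1 x2 c1 c2.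
have c12 : 0 <= c2 - c1 by rewrite subr_ge0 (@le_trans _ _ t)// ?c1i ?c2i.
have cuw : c2 - c1 <= w - u by rewrite lerB ?c1i ?c2i.
rewrite (ger0_norm c12) ler_norml => /andP[H _].
have {}H : - (2 * B * (w - u)) <= dot' x c2 - dot' x c1.
  by rewrite (le_trans _ H)// lerN2 ler_wpM2l// mulr_ge0.
have p0 : 0 <= (w - t) * (t - u) by rewrite mulr_ge0// subr_ge0 ltW.
have := ler_wpM2l p0 H.
rewrite -/(S t) -/(S u) -/(S w).
have -> : (w - t) * S u + (t - u) * S w =
    (w - u) * S t + (t - u) * (S w - S t) - (w - t) * (S t - S u) by ring.
rewrite e1 e2; lra.
Qed.

Definition in_box B Om := forall x, Om x -> `|x.1| <= B /\ `|x.2| <= B.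

Lemma bounded_in_box Om : bounded_set Om -> exists2 B, 0 <= B & in_box B Om.
Proof.
move=> [M [_ HM]]; exists (`|M| + 1); first by rewrite addr_ge0.
move=> x Omx; have := HM (`|M| + 1) _ x Omx.
rewrite (le_lt_trans (ler_norm M)) ?ltrDl// => /(_ isT) /=.
by rewrite prod_normE ge_max => /andP[].
Qed.

Lemma in_box_bounded Om B : in_box B Om -> bounded_set Om.
Proof.
move=> OmB; exists B; split; first exact: num_real.
move=> M BM x /OmB[x1 x2] /=.
by rewrite prod_normE ge_max !(le_trans _ (ltW BM)).
Qed.

Lemma continuous_dot t : continuous (fun x => dot x (eitheta t)).
Proof.
move=> x; rewrite /dot; apply: cvgD.
  by apply: cvgM; [exact: cvg_fst|exact: cvg_cst].
by apply: cvgM; [exact: cvg_snd|exact: cvg_cst].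
Qed.

Lemma closed_halfplane t c : closed [set x | dot x (eitheta t) <= c].
Proof.
apply: (@preimage_closed _ _ (fun x => dot x (eitheta t)) [set r | r <= c]).
  by move=> x _; exact: continuous_dot.
exact: closed_le.
Qed.

Lemma closure_halfplane Om t c : (forall x, Om x -> dot x (eitheta t) <= c) ->
  forall x, closure Om x -> dot x (eitheta t) <= c.
Proof.
move=> H x clx.
have : closure [set x | dot x (eitheta t) <= c] x by exact: closure_subset clx.
by rewrite -(closure_id _).1//; exact: closed_halfplane.
Qed.

Lemma closure_in_box Om B : in_box B Om -> in_box (B + 1) (closure Om).
Proof.
move=> OmB x clx.
have [y [Omy xy]] := clx _ (nbhsx_ballx x 1 ltr01).
have [y1 y2] := OmB y Omy.
move: xy => [/= xy1 xy2]; rewrite /ball/= in xy1 xy2.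
split.
  rewrite -[x.1](subrK y.1) (le_trans (ler_normD _ _))// addrC lerD// ltW//.
rewrite -[x.2](subrK y.2) (le_trans (ler_normD _ _))// addrC lerD// ltW//.
Qed.

Lemma cvg_quotient_harmonic (f : R -> R) t (l : R) :
  quotient f t s @[s --> (0 : R)^'+] --> l ->
  quotient f t n.+2%:R^-1 @[n --> \oo] --> l.
Proof.
move=> /cvg_at_rightP H; apply: (H (fun n => n.+2%:R^-1)).
split; first by move=> n; rewrite invr_gt0.
have := @cvg_harmonic R; rewrite -(cvg_shiftS _).
exact.
Qed.

Lemma is_derive_quotient (f : R -> R) t (l : R) : is_derive t (1 : R) f l ->
  quotient f t s @[s --> (0 : R)^'+] --> l.
Proof.
move=> [/cvg_ex[m Hm] El].
have -> : l = m by rewrite -El; exact/cvg_lim.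
have -> : quotient f t = (fun s : R => s^-1 *: ((f \o shift t) (s *: (1 : R)) - f t)).
  by apply/funext => s; rewrite /quotient /GRing.scale/= mulr1 (addrC t s).
exact: cvg_dnbhs_at_right Hm.
Qed.

Section Bounded.
Variables (Om : set (R * R)) (B : R).
Hypotheses (B0 : 0 <= B) (OmB : in_box B (closure Om)) (Om0 : Om !=set0).
Local Notation h := (support_function Om).

Lemma support_set_nonempty t : [set dot x (eitheta t) | x in closure Om] !=set0.
Proof. by case: Om0 => x Omx; exists (dot x (eitheta t)), x => //; exact: subset_closure. Qed.

Lemma support_set_ubound t : has_ubound [set dot x (eitheta t) | x in closure Om].
Proof.
exists (2 * B) => _ [x /OmB[x1 x2] <-].
by have := dot_bound t x1 x2; rewrite ler_norml => /andP[].
Qed.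

Lemma support_ub x t : closure Om x -> dot x (eitheta t) <= h t.
Proof.
by move=> clx; apply: sup_upper_bound;
  [split; [exact: support_set_nonempty|exact: support_set_ubound]|exists x].
Qed.

Lemma support_le_closure t c : (forall x, closure Om x -> dot x (eitheta t) <= c) -> h t <= c.
Proof.
move=> H; apply: ge_sup; first exact: support_set_nonempty.
by move=> _ [x clx <-]; exact: H.
Qed.

Lemma support_le t c : (forall x, Om x -> dot x (eitheta t) <= c) -> h t <= c.
Proof. by move=> H; apply: support_le_closure; exact: closure_halfplane H. Qed.

Lemma support_periodic : circle_periodic h.
Proof.
move=> t; rewrite /support_function; congr sup.
by apply: eq_imagel => x _; rewrite /dot/= mulr_natl cosD2pi sinD2pi.
Qed.

Lemma support_bound t : `|h t| <= 2 * B.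
Proof.
rewrite ler_norml; apply/andP; split.
  have [x Omx] := Om0; have clx := subset_closure Omx.
  have [x1 x2] := OmB clx.
  apply: le_trans (support_ub t clx).
  by have := dot_bound t x1 x2; rewrite ler_norml => /andP[].
apply: support_le_closure => x /OmB[x1 x2].
by have := dot_bound t x1 x2; rewrite ler_norml => /andP[].
Qed.

Lemma support_lip t s : `|h s - h t| <= 2 * B * `|s - t|.
Proof.
have H u w : h u - h w <= 2 * B * `|u - w|.
  rewrite lerBlDr; apply: support_le_closure => x clx.
  have [x1 x2] := OmB clx.
  have := dot_lip x1 x2 w u; rewrite ler_norml => /andP[_].
  have := support_ub w clx; lra.
rewrite ler_norml H andbT lerNl opprB (le_trans (H _ _))//.
by rewrite distrC.
Qed.

Lemma support_semiconvex : semiconvex (4 * B) h.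
Proof.
move=> u t w ut tw.
have wu : 0 < w - u by lra.
rewrite mulrC -ler_pdivlMr//; apply: support_le_closure => x clx.
have [x1 x2] := OmB clx; rewrite ler_pdivlMr// mulrC.
apply: (le_trans (dot_semiconvex x1 x2 ut tw)).
rewrite lerD2r; apply: lerD; rewrite ler_wpM2l ?support_ub// subr_ge0 ltW//.
Qed.

(** On an arc shorter than [pi] the weights in [dot_three] are nonnegative,
    and [h] is a supremum of functions that satisfy it. *)
Lemma support_trig_convex a b t : a <= t -> t <= b -> b - a < pi ->
  h t * sin (b - a) <= h a * sin (b - t) + h b * sin (t - a).
Proof.
move=> at_ tb bapi.
have [ba0|ba0] := eqVneq b a.
  by rewrite ba0 (_ : t = a) ?subrr ?sin0 ?mulr0 ?addr0//; apply/eqP; rewrite eq_le at_ -ba0 tb.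
have sba : 0 < sin (b - a).
  by rewrite sin_gt0_pi// bapi andbT subr_gt0 lt_neqAle eq_sym ba0 (le_trans at_).
rewrite -ler_pdivlMr//; apply: support_le_closure => x clx.
rewrite ler_pdivlMr// dot_three; apply: lerD; apply: ler_wpM2r;
  rewrite ?support_ub// sin_ge0_pi// subr_ge0 ?at_ ?tb/=; lra.
Qed.

Lemma cos_gt0_small s : `|s| < 1 -> 0 < cos s.
Proof.
rewrite ltr_norml => /andP[s0 s1]; apply: cos_gt0_pihalf.
by have := @pihalf_ge1 R => p1; apply/andP; split; lra.
Qed.

(** The finite difference form of [h'' + h >= 0]. *)
Lemma support_midpoint t s : 0 <= s -> s < 1 -> 2 * cos s * h t <= h (t + s) + h (t - s).
Proof.
move=> s0 s1.
have c0 : 0 < cos s by apply: cos_gt0_small; rewrite ger0_norm.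
have c2 : 0 < 2 * cos s by rewrite mulr_gt0.
rewrite mulrC -ler_pdivlMr//; apply: support_le_closure => x clx.
rewrite ler_pdivlMr//.
have -> : dot x (eitheta t) * (2 * cos s) =
    dot x (eitheta (t + s)) + dot x (eitheta (t - s)).
  by rewrite !dotD cosN sinN; ring.
by apply: lerD; exact: support_ub.
Qed.

Let K0 : 0 <= 4 * B. Proof. exact: mulr_ge0. Qed.

Local Notation rd := (right_derivative h).

Lemma support_quotient_cvg t : quotient h t s @[s --> 0^'+] --> rd t.
Proof. exact: (right_derivative_cvg K0 support_lip support_semiconvex). Qed.

Lemma support_primitive : is_primitive h rd.
Proof. exact: (right_derivative_primitive K0 support_lip support_semiconvex). Qed.

Lemma support_rd_measurable : measurable_fun setT rd.
Proof. exact: (right_derivative_measurable K0 support_lip support_semiconvex). Qed.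

Lemma support_rd_bound t : `|rd t| <= 2 * B.
Proof. exact: (right_derivative_bound K0 support_lip support_semiconvex). Qed.

Lemma support_rd_locint : locally_integrable setT rd.
Proof. exact: (right_derivative_locint K0 support_lip support_semiconvex). Qed.

Lemma support_W1inf : W1inf h.
Proof.
exact: W1inf_of_primitive support_periodic support_rd_measurable support_rd_bound
  support_primitive.
Qed.

Lemma support_continuous : continuous h.
Proof. exact: is_primitive_continuous support_rd_locint support_primitive. Qed.

(** The inequality [h'' + h >= 0] tested against [v]: summation by parts turns
    the positive quantity
      \int (h(t + s) + h(t - s) - 2 cos s h(t)) v(t)
    into difference quotients of [h] and [v], to which dominated convergence
    applies as [s] tends to zero. *)
Lemma support_convex : (forall t, 0 <= h t) -> convex_support h.
Proof.
move=> h0 v Wv v0; case: (Wv) => pv cv _.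
have ph := support_periodic; have ch := support_continuous.
have Ih := continuous_locint ch; have Iv := continuous_locint cv.
have pvw := W1inf_primitive Wv; have Ivw := W1inf_locint Wv.
have per (f : R -> R) : locally_integrable setT f -> circle_periodic f ->
    \int[mu]_(t in period) f t = \int[mu]_(t in `[0, 2 * pi]) f t.
  by move=> If pf; rewrite (Rintegral_period 0 pf If) add0r.
have twopi0 : 0 <= 2 * pi :> R by rewrite ltW// twopi_gt0.
pose C := \int[mu]_(t in `[0, 2 * pi]) (h t * v t).
have C0 : 0 <= C by apply: Rintegral_ge0 => t _; rewrite mulr_ge0.
have key n : \int[mu]_(t in `[0, 2 * pi])
    (quotient h t n.+2%:R^-1 * quotient v t n.+2%:R^-1) <= C.
  set s := n.+2%:R^-1 : R.
  have s0 : 0 < s by rewrite invr_gt0.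
  have s1 : s < 1 by rewrite invf_lt1// ltr1n.
  pose hs t := h (t + s); pose vs t := v (t + s).
  have chs : continuous hs by exact: continuous_translate.
  have cvs : continuous vs by exact: continuous_translate.
  have phs : circle_periodic hs by move=> t; rewrite /hs addrAC ph.
  have pvs : circle_periodic vs by move=> t; rewrite /vs addrAC pv.
  have IM (f g : R -> R) : continuous f -> continuous g -> locally_integrable setT (fun r : R => f r * g r).
    by move=> cf cg; apply: locint_cM => //; exact: continuous_locint.
  have shift (f : R -> R) : continuous f -> circle_periodic f ->
      \int[mu]_(t in `[0, 2 * pi]) f (t + s) = \int[mu]_(t in `[0, 2 * pi]) f t.
    move=> cf pf; rewrite Rintegral_shift; last exact: continuous_locint.
    by rewrite add0r [2 * pi + s]addrC -(Rintegral_period s pf) ?per//; exact: continuous_locint.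
  have Es : \int[mu]_(t in `[0, 2 * pi]) (hs t * vs t) = C.
    apply: (shift (fun t => h t * v t)); first by move=> x; apply: cvgM; [exact: ch|exact: cv].
    by move=> t; rewrite ph pv.
  pose hm t := h (t - s).
  have chm : continuous hm by exact: continuous_translate.
  have Em : \int[mu]_(t in `[0, 2 * pi]) (hm t * v t) =
            \int[mu]_(t in `[0, 2 * pi]) (h t * vs t).
    rewrite -(shift (fun t => hm t * v t)).
    - by apply: eq_Rintegral => t _; rewrite /hm addrK.
    - by move=> x; apply: cvgM; [exact: chm|exact: cv].
    - by move=> t; rewrite /hm pv addrAC ph.
  have pos : 0 <= \int[mu]_(t in `[0, 2 * pi]) ((hs t + hm t - 2 * cos s * h t) * v t).
    apply: Rintegral_ge0 => t _; rewrite mulr_ge0// subr_ge0.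
    by apply: support_midpoint => //; exact: ltW.
  have E1 : \int[mu]_(t in `[0, 2 * pi]) ((hs t + hm t - 2 * cos s * h t) * v t) =
     \int[mu]_(t in `[0, 2 * pi]) (hs t * v t) + \int[mu]_(t in `[0, 2 * pi]) (h t * vs t)
     - 2 * cos s * C.
    rewrite -Em -RintegralZ_seg; last exact: IM.
    rewrite -RintegralD_seg; [|exact: IM|exact: IM].
    rewrite -RintegralB_seg; [|by apply: locintD; exact: IM|by apply: locintZ; exact: IM].
    by apply: eq_Rintegral => t _; ring.
  have E2 : \int[mu]_(t in `[0, 2 * pi]) (quotient h t s * quotient v t s) =
     s^-1 ^+ 2 * (C + C - \int[mu]_(t in `[0, 2 * pi]) (hs t * v t) -
                 \int[mu]_(t in `[0, 2 * pi]) (h t * vs t)).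
    rewrite -{1}Es -RintegralD_seg; [|exact: IM|exact: IM].
    rewrite -RintegralB_seg; [|by apply: locintD; exact: IM|exact: IM].
    rewrite -RintegralB_seg; [|by apply: locintB; [apply: locintD; exact: IM|exact: IM]|exact: IM].
    rewrite -RintegralZ_seg; last first.
      by apply: locintB; [apply: locintB; [apply: locintD; exact: IM|exact: IM]|exact: IM].
    by apply: eq_Rintegral => t _; rewrite /quotient -/(hs t) -/(vs t); ring.
  rewrite E2; rewrite E1 in pos.
  have cs := cos_ge_quadratic s.
  rewrite exprVn mulrC ler_pdivrMr ?exprn_gt0//.
  have : (1 - s ^+ 2 / 2) * C <= cos s * C by rewrite ler_wpM2r.
  lra.
have [A A0 HA] := W1inf_bound 0 (2 * pi + 1) Wv.
have lim : \int[mu]_(t in `[0, 2 * pi]) (quotient h t n.+2%:R^-1 * quotient v t n.+2%:R^-1)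
    @[n --> \oo] --> \int[mu]_(t in `[0, 2 * pi]) (rd t * wderiv v t).
  have mq f s : continuous f -> measurable_fun setT (fun t => quotient f t s).
    move=> cf; apply: continuous_measurable_fun => t.
    apply: cvgM; first exact: cvg_cst.
    by apply: cvgB; [exact: (continuous_translate cf)|exact: cf].
  apply: (dominated_cvg_seg (w := fun=> 2 * B * A)).
  - by move=> n; apply: measurable_funM; exact: mq.
  - by apply: measurable_funM; [exact: support_rd_measurable|exact: locint_measurable].
  - exact: locint_cst.
  - apply: ae_imply (is_primitive_ae_derive Ivw pvw) => t dt _.
    have c1 := cvg_quotient_harmonic (@support_quotient_cvg t).
    have c2 := cvg_quotient_harmonic (is_derive_quotient dt).
    exact: (cvgM c1 c2).
  - move=> n t /andP[t0 t2pi]; rewrite normrM; apply: ler_pM => //.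
      by apply: (quotient_bound support_lip); rewrite invr_neq0.
    set s := n.+2%:R^-1 : R; have s0 : 0 < s by rewrite invr_gt0.
    have s1 : s < 1 by rewrite invf_lt1// ltr1n.
    have sV : `|s^-1| = s^-1 by rewrite gtr0_norm ?invr_gt0.
    rewrite /quotient normrM sV -(ler_pM2l s0) mulrA mulfV ?gt_eqF// mul1r.
    have := primitive_lip_ae A0 Ivw pvw HA t0 (_ : t <= t + s) (_ : t + s <= 2 * pi + 1).
    rewrite addrAC subrr add0r [s * A]mulrC; apply; first by rewrite lerDl ltW.
    by apply: lerD => //; exact: ltW.
have {lim} lim : \int[mu]_(t in `[0, 2 * pi]) (rd t * wderiv v t) <= C.
  by apply: (cvgr_to_le lim); apply: nearW.
have Irdw : locally_integrable setT (fun t : R => rd t * wderiv v t).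
  rewrite (_ : (fun _ => _) = (fun t => wderiv v t * rd t)); last by apply/funext => t; rewrite mulrC.
  exact: locintM Ivw support_rd_measurable support_rd_bound.
have Ihv : locally_integrable setT (fun t : R => h t * v t) by exact: locint_cM.
rewrite (_ : \int[mu]_(t in period) _ = \int[mu]_(t in `[0, 2 * pi]) (h t * v t - rd t * wderiv v t)).
  by rewrite RintegralB_seg ?subr_ge0//.
transitivity (\int[mu]_(t in period) (h t * v t - rd t * wderiv v t)).
  apply: ae_eq_Rintegral.
  - exact: measurable_itv.
  - apply: measurable_funTS; apply: measurable_funB; first exact: locint_measurable.
    apply: measurable_funM; last exact: locint_measurable.
    by apply: locint_measurable; apply: W1inf_locint; exact: support_W1inf.
  - by apply: measurable_funTS; apply: measurable_funB; exact: locint_measurable.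
  - by apply: ae_imply (wderiv_primitive support_rd_locint support_primitive) => t ->.
rewrite /period Rintegral_itv_bndo_bndc//.
apply: (@locint_itv _ _ _ 0 (2 * pi)); first exact: locintB.
by move=> t /=; rewrite !in_itv/= => /andP[-> /ltW].
Qed.

End Bounded.

(** The convex hull of [Om] and [(1 - tau) Om + tau P]: the convex sets through
    which [Om] is deformed towards the convex hull of [Om] and [P]. *)
Definition pulled Om P (tau : R) : set (R * R) :=
  [set z | exists y s, [/\ Om y, 0 <= s <= tau & z = (1 - s) *: y + s *: P]].

Lemma dot_combination y P s t : dot ((1 - s) *: y + s *: P) (eitheta t) =
  (1 - s) * dot y (eitheta t) + s * dot P (eitheta t).
Proof. by rewrite /dot /= /GRing.scale/=; ring. Qed.

Section Pulled.
Variables (Om : set (R * R)) (P : R * R) (tau : R) (h : R -> R).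
Hypotheses (t01 : 0 < tau < 1) (OmH : is_Omega h Om).

Lemma pulled_open : open (pulled Om P tau).
Proof.
have [oOm _ _ _ _] := OmH; have /andP[tau0 tau1] := t01.
have -> : pulled Om P tau = \bigcup_(s in [set s | 0 <= s <= tau])
    ((fun z => (1 - s)^-1 *: (z - s *: P)) @^-1` Om).
  apply/seteqP; split=> [z [y [s [Omy st ->]]]|z [s /= /andP[s0 st] Omz]].
    exists s => //=; rewrite addrK scalerA mulVf ?scale1r//.
    by have /andP[_ ?] := st; rewrite gt_eqF// subr_gt0 (le_lt_trans _ tau1).
  exists ((1 - s)^-1 *: (z - s *: P)), s; split=> //; first by rewrite s0.
  rewrite scalerA mulfV ?scale1r ?subrK//.
  by rewrite gt_eqF// subr_gt0 (le_lt_trans st).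
apply: bigcup_open => s _; apply: open_comp => // z _.
apply: (@continuous_comp _ _ _ (fun z => z - s *: P) (fun z => (1 - s)^-1 *: z)).
  by apply: cvgB; [exact: cvg_id|exact: cvg_cst].
exact: scaler_continuous.
Qed.

Lemma pulled_sub : Om `<=` pulled Om P tau.
Proof.
move=> y Omy; exists y, 0; split=> //; last by rewrite subr0 scale1r scale0r addr0.
by have /andP[/ltW -> _] := t01; rewrite lexx.
Qed.

Lemma pulled_bounded : bounded_set (pulled Om P tau).
Proof.
have [_ _ bOm _ _] := OmH; have /andP[tau0 tau1] := t01.
have [B B0 OmB] := bounded_in_box bOm.
apply: (@in_box_bounded _ (B + (`|P.1| + `|P.2|))) => _ [y [s [Omy /andP[s0 st] ->]]].
have [y1 y2] := OmB _ Omy.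
have s1 : s <= 1 by rewrite (le_trans st)// ltW.
have s1' : 0 <= 1 - s by rewrite subr_ge0.
have aux (p q : R) : `|p| <= B -> `|(1 - s) * p + s * q| <= B + `|q|.
  move=> pB; rewrite (le_trans (ler_normD _ _))// !normrM (ger0_norm s0) (ger0_norm s1').
  apply: lerD; last by rewrite ler_piMl.
  by rewrite (le_trans _ pB)// ler_piMl// lerBlDr lerDl.
split=> /=; rewrite /GRing.scale/=.
  by rewrite (le_trans (aux _ _ y1))// lerD2l lerDl.
by rewrite (le_trans (aux _ _ y2))// lerD2l lerDr.
Qed.

Lemma pulled_convex : convex_domain (pulled Om P tau).
Proof.
have [_ _ _ cOm _] := OmH; have /andP[tau0 tau1] := t01.
move=> z1 z2 l; rewrite !inE => -[y1 [s1 [Om1 /andP[s10 s1t] e1]]] [y2 [s2 [Om2 /andP[s20 s2t] e2]]].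
pose k := l%:num.
have k0 : 0 <= k by rewrite /k ge0.
have k1 : k <= 1 by rewrite /k le1.
pose s := k * s1 + (1 - k) * s2.
have kk0 : 0 <= 1 - k by rewrite subr_ge0.
have s0 : 0 <= s by rewrite addr_ge0// mulr_ge0.
have st : s <= tau.
  have : k * s1 <= k * tau by rewrite ler_wpM2l.
  have : (1 - k) * s2 <= (1 - k) * tau by rewrite ler_wpM2l.
  by rewrite /s; lra.
have s1_ : 0 < 1 - s by rewrite subr_gt0 (le_lt_trans st).
(* A convex combination of points of the slices [s1] and [s2] lies in the
   slice of parameter [s]; [m] is the weight left to [y1] inside [Om]. *)
pose m := k * (1 - s1) / (1 - s).
have m0 : 0 <= m.
  rewrite /m divr_ge0 ?(ltW s1_)// mulr_ge0// subr_ge0.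
  by rewrite (le_trans s1t)// ltW.
have m1 : m <= 1.
  rewrite ler_pdivrMr// mul1r /s.
  have : 0 <= (1 - k) * (1 - s2) by rewrite mulr_ge0// subr_ge0 (le_trans s2t)// ltW.
  lra.
have m01 : Itv.spec (@Itv.num_sem R) (Itv.Real `[0, 1]%Z) m.
  by rewrite /= /Itv.num_sem num_real/= in_itv/= m0 m1.
have := cOm y1 y2 (Itv.mk m01); rewrite !inE => /(_ Om1 Om2) Omy.
exists (m *: y1 + (1 - m) *: y2), s; split=> //; first by rewrite s0.
have -> : conv l z1 z2 = k *: (z1 : R * R) + (1 - k) *: (z2 : R * R) by [].
rewrite e1 e2.
have ms : (1 - s) * m = k * (1 - s1) by rewrite /m mulrC mulfVK// gt_eqF.
have ms' : (1 - s) * (1 - m) = (1 - k) * (1 - s2).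
  by rewrite mulrBr mulr1 ms /s; ring.
rewrite !scalerDr !scalerA ms ms' /s scalerDl.
by rewrite !addrA; congr (_ + _); rewrite -!addrA; congr (_ + _); rewrite addrC.
Qed.

(** The slice [(1 - s) Om + s P] has the support function [(1 - s) h t + s S t], where
    [S t = dot P (eitheta t)]. It is affine in [s], hence largest at [s = 0] or at
    [s = tau]. *)
Lemma pulled_support t : support_function (pulled Om P tau) t =
  h t + tau * Num.max (dot P (eitheta t) - h t) 0.
Proof.
have [_ Om0 bOm _ supp] := OmH; have /andP[tau0 tau1] := t01.
have [B B0 OmB] := bounded_in_box bOm.
have [B' B'0 pB] := bounded_in_box pulled_bounded.
have OmB1 := closure_in_box OmB; have pB1 := closure_in_box pB.
have p0 : pulled Om P tau !=set0.
  by have [y Omy] := Om0; exists y; exact: pulled_sub.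
apply/eqP; rewrite eq_le; apply/andP; split.
  apply: (support_le p0) => _ [y [s [Omy /andP[s0 st] ->]]].
  rewrite dot_combination.
  have yh : dot y (eitheta t) <= h t.
    by rewrite -supp; apply: (support_ub OmB1 Om0); exact: subset_closure.
  have s1 : s <= 1 by rewrite (le_trans st)// ltW.
  have H1 : (1 - s) * dot y (eitheta t) <= (1 - s) * h t.
    by rewrite ler_wpM2l// subr_ge0.
  have H2 : s * (dot P (eitheta t) - h t) <= s * Num.max (dot P (eitheta t) - h t) 0.
    by rewrite ler_wpM2l// le_max lexx.
  have H3 : s * Num.max (dot P (eitheta t) - h t) 0 <= tau * Num.max (dot P (eitheta t) - h t) 0.
    by rewrite ler_wpM2r// le_max lexx orbT.
  lra.
have sub s y : Om y -> 0 <= s <= tau ->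
    (1 - s) * dot y (eitheta t) + s * dot P (eitheta t) <= support_function (pulled Om P tau) t.
  move=> Omy st; rewrite -dot_combination; apply: (support_ub pB1 p0).
  by apply: subset_closure; exists y, s.
have [Ph|hP] := leP (dot P (eitheta t) - h t) 0.
  rewrite mulr0 addr0 -supp; apply: (support_le Om0) => y Omy.
  by have := sub 0 y Omy; rewrite subr0 mul1r mul0r addr0 lexx (ltW tau0); apply.
have tt : 0 < 1 - tau by rewrite subr_gt0.
have : h t <= (support_function (pulled Om P tau) t - tau * dot P (eitheta t)) / (1 - tau).
  rewrite -supp; apply: (support_le Om0) => y Omy.
  rewrite ler_pdivlMr// mulrC lerBrDr; apply: sub => //.
  by rewrite lexx ltW.
rewrite ler_pdivlMr//; lra.
Qed.

Lemma pulled_Omega : is_Omega (fun t => h t + tau * Num.max (dot P (eitheta t) - h t) 0)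
  (pulled Om P tau).
Proof.
split.
- exact: pulled_open.
- by have [_ [y Omy] _ _ _] := OmH; exists y; exact: pulled_sub.
- exact: pulled_bounded.
- exact: pulled_convex.
- exact: pulled_support.
Qed.

End Pulled.
End SupportFunction.

(** * Uniform second order estimates near a compact set *)

Section CompactEstimates.
Context {R : realType} {V : normedModType R}.
Implicit Types (F : V -> R) (x y v : V) (K U : set V).

(** The radius and the bound are tied as [d] and [d^-1], so that the condition
    only weakens as [d] decreases: a covering argument then gives one [d] for
    the whole of [K]. *)
Lemma compact_nbhd_bound U K F : open U -> compact K -> K `<=` U ->
  (forall x, U x -> {for x, continuous F}) ->
  exists2 d : R, 0 < d & forall x y, K x -> `|y - x| < d -> U y /\ `|F y| <= d^-1.
Proof.
move=> oU cK KU cF.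
pose P (d : R) x := forall y, `|y - x| < d -> U y /\ `|F y| <= d^-1.
have /compact_near_coveringP/(_ R (0^'+) (fun d x => P d x) _) := cK.
case.
  move=> x Kx.
  have Ux := KU _ Kx.
  have : \forall y \near x, U y /\ `|F y| <= `|F x| + 1.
    near=> y; split; first by near: y; exact: open_nbhs_nbhs.
    have : `|F x - F y| <= 1.
      by near: y; have /cvgrPdist_le := cF _ Ux; apply.
    have := ler_normD (F y - F x) (F x); rewrite subrK distrC; lra.
  case/nbhs_ballP => r /= r0 Hr.
  have M0 : 0 < `|F x| + 1 by rewrite ltr_wpDl.
  exists (ball x (r / 2), [set d | 0 < d /\ d < Num.min (r / 2) (`|F x| + 1)^-1]).
    split => /=; first by apply: nbhsx_ballx; rewrite divr_gt0.
    near=> d; split; first by near: d; exact: nbhs_right_gt.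
    by near: d; apply: nbhs_right_lt; rewrite lt_min divr_gt0// invr_gt0.
  move=> [x' d] /= [xx' [d0]]; rewrite lt_min => /andP[dr dM] y yx'.
  have [|Uy Fy] := Hr y.
    rewrite -ball_normE/= in xx' *.
    rewrite -(subrK x' x) -addrA (le_lt_trans (ler_normD _ _))//.
    rewrite [r]splitr ltrD// distrC (lt_trans yx')//.
  split=> //; rewrite (le_trans Fy)// -[leLHS]invrK lef_pV2 ?posrE ?invr_gt0//.
  exact: ltW.
move=> d /= d0 Hd; exists (d / 2); first by rewrite divr_gt0.
move=> x y Kx; apply: (Hd (d / 2)) => //=.
  by rewrite sub0r normrN gtr0_norm ?divr_gt0// ltr_pdivrMr//; lra.
by rewrite divr_gt0.
Unshelve. all: by end_near. Qed.

Lemma compact_gt0_bound K F : compact K ->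
  (forall x, K x -> {for x, continuous F}) -> (forall x, K x -> 0 < F x) ->
  exists2 d : R, 0 < d & forall x, K x -> d <= F x.
Proof.
move=> cK cF F0.
have /compact_near_coveringP/(_ R (0^'+) (fun d x => d <= F x) _) := cK.
case.
  move=> x Kx.
  have Fx2 : 0 < F x / 2 by rewrite divr_gt0// F0.
  exists ([set y | F x / 2 <= F y], [set d | d <= F x / 2]); last first.
    by move=> [y d] /= [H1 H2]; exact: le_trans H1.
  split => /=.
    have /cvgrPdist_le/(_ _ Fx2) := cF _ Kx; apply: filterS => y /=.
    by rewrite ler_norml => /andP[_]; lra.
  by near=> d; near: d; exact: nbhs_right_le.
move=> d /= d0 Hd; exists (d / 2); first by rewrite divr_gt0.
move=> x Kx; apply: (Hd (d / 2)) => //=.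
  by rewrite sub0r normrN gtr0_norm ?divr_gt0// ltr_pdivrMr//; lra.
by rewrite divr_gt0.
Unshelve. all: by end_near. Qed.

Lemma is_derive_along F x v (t : R) : differentiable F (x + t *: v) ->
  is_derive t (1 : R) (fun s => F (x + s *: v)) ('d F (x + t *: v) v).
Proof.
move=> dF.
have E : (fun h : R => h^-1 *: (((fun s => F (x + s *: v)) \o shift t) (h *: (1 : R)) - F (x + t *: v)))
  = (fun h : R => h^-1 *: ((F \o shift (x + t *: v)) (h *: v) - F (x + t *: v))).
  apply/funext => h /=.
  have -> : h *: (1 : R) + t = h + t by rewrite /GRing.scale/= mulr1.
  by rewrite scalerDl addrCA.
have D := diff_derivable (v := v) dF.
apply: DeriveDef; first by rewrite /derivable E; exact: D.
rewrite -(deriveE v dF) /derive; move: E => /= E; by rewrite E.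
Qed.

Lemma differential_mvt F x v :
  (forall t : R, 0 <= t <= 1 -> differentiable F (x + t *: v)) ->
  exists2 t : R, 0 <= t <= 1 & F (x + v) - F x = 'd F (x + t *: v) v.
Proof.
move=> dF.
have D (t : R) : 0 <= t <= 1 ->
    is_derive t (1 : R) (fun s => F (x + s *: v)) ('d F (x + t *: v) v).
  by move=> /dF; exact: is_derive_along.
have [| |t t01] := @MVT_segment _ (fun s => F (x + s *: v))
  (fun s => 'd F (x + s *: v) v) 0 1 ler01.
- by move=> t; rewrite in_itv/= => /andP[/ltW t0 /ltW t1]; apply: D; rewrite t0.
- apply: derivable_within_continuous => t; rewrite in_itv/= => /D.
  by case.
rewrite subr0 mulr1 scale1r scale0r addr0 => e.
by exists t => //; move: t01; rewrite in_itv.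
Qed.

End CompactEstimates.

Section JetEstimates.
Context {R : realType}.
Local Notation J := (R * R * R)%type.
Implicit Types (G : J -> R) (th u q a b : R).

Let e1 : J := (1, 0, 0).
Let e2 : J := (0, 1, 0).
Let e3 : J := (0, 0, 1).

Let increment_le (g1 g2 g3 c s s' w z : R) : g1 - g2 <= w -> g2 - g3 = c * s' ->
  (s' - s) * c <= z -> g1 - g3 <= w + s * c + z.
Proof. by rewrite mulrBl; lra. Qed.

Let increment_norm_le (g1 g2 g3 c s s' w w' : R) : `|g2 - g1| <= c * `|s' - s| ->
  `|g3 - g2| <= c * `|w' - w| -> `|g1 - g3| <= c * (`|s - s'| + `|w - w'|).
Proof.
rewrite [`|s - s'|]distrC [`|w - w'|]distrC [`|g1 - g3|]distrC mulrDr => H1 H2.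
by have := ler_normD (g3 - g2) (g2 - g1); rewrite addrA subrK; lra.
Qed.

Lemma jet_add1 th u q a : ((th, u, q) : J) + a *: e1 = (th + a, u, q).
Proof. by congr (_, _, _); rewrite /= /GRing.scale/= ?mulr1 ?mulr0 ?addr0. Qed.

Lemma jet_add2 th u q a : ((th, u, q) : J) + a *: e2 = (th, u + a, q).
Proof. by congr (_, _, _); rewrite /= /GRing.scale/= ?mulr1 ?mulr0 ?addr0. Qed.

Lemma jet_add3 th u q a : ((th, u, q) : J) + a *: e3 = (th, u, q + a).
Proof. by congr (_, _, _); rewrite /= /GRing.scale/= ?mulr1 ?mulr0 ?addr0. Qed.

Lemma jet_norm (x : J) : `|x| = Num.max (Num.max `|x.1.1| `|x.1.2|) `|x.2|.
Proof. by rewrite !prod_normE. Qed.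

Definition jet_bounds G (A H Q : set R) C al d (Gq : J -> R) :=
  [/\ 0 <= C, 0 < al, 0 < d &
    [/\ forall th u q a b, A th -> H u -> Q q -> `|a| < d -> `|b| < d ->
          G (th, u + a, q + b) - G (th, u, q) <=
          C * `|a| + Gq (th, u, q) * b + C * b ^+ 2,
        forall th th' u u' q, A th -> A th' -> H u -> H u' -> Q q ->
          `|th - th'| < d -> `|u - u'| < d ->
          `|Gq (th, u, q) - Gq (th', u', q)| <= C * (`|th - th'| + `|u - u'|),
        forall th u q q', A th -> H u -> Q q -> Q q' ->
          al * (q - q') ^+ 2 <= (Gq (th, u, q) - Gq (th, u, q')) * (q - q'),
        forall th u q q', A th -> H u -> Q q -> Q q' ->
          `|Gq (th, u, q) - Gq (th, u, q')| <= C * `|q - q'|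
      & forall th u q a b, A th -> H u -> Q q -> `|a| < d -> `|b| < d ->
          `|G (th, u + a, q + b)| <= C /\ {for (th, u + a, q + b), continuous G}]].

(** The uses of [G] being C^2 with [G_qq > 0]: a one-sided expansion at
    first order in [u] and second order in [q], the Lipschitz continuity of
    [G_q], and its strong monotonicity in [q]. *)
Lemma jet_estimates G (U : set J) (A H Q : set R) : open U -> C2_on U G ->
  compact A -> compact H -> compact Q -> is_interval Q ->
  A `*` H `*` Q `<=` U ->
  (forall x, (A `*` H `*` Q) x -> 0 < 'D_e3 ('D_e3 G) x) ->
  exists C al d Gq, jet_bounds G A H Q C al d Gq.
Proof.
move=> oU [C1G C2G] cA cH cQ iQ KU Gqq0.
set K := A `*` H `*` Q in KU Gqq0 *.
have cK : compact K by apply: compact_setX => //; exact: compact_setX.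
pose Gq y := 'd G y e3.
pose Gqq y := 'd Gq y e3.
have C1Gq : C1_on U Gq by exact: C2G.
have bound (F : J -> R) : (forall x, U x -> {for x, continuous F}) ->
    exists2 d : R, 0 < d & forall x y, K x -> `|y - x| < d -> U y /\ `|F y| <= d^-1.
  exact: compact_nbhd_bound.
have [du du0 Hdu] := bound (fun y => 'd G y e2) (fun x Ux => (C1G x Ux).2 e2).
have [d1 d10 Hd1] := bound (fun y => 'd Gq y e1) (fun x Ux => (C1Gq x Ux).2 e1).
have [d2 d20 Hd2] := bound (fun y => 'd Gq y e2) (fun x Ux => (C1Gq x Ux).2 e2).
have [d3 d30 Hd3] := bound Gqq (fun x Ux => (C1Gq x Ux).2 e3).
have GqqE x : K x -> 'D_e3 ('D_e3 G) x = Gqq x.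
  move=> Kx; have Ux := KU _ Kx.
  rewrite /Gqq -deriveE; last by case: (C1Gq x Ux).
  apply: near_eq_derive; near=> y; rewrite deriveE//.
  have Uy : U y by near: y; exact: open_nbhs_nbhs.
  by case: (C1G y Uy).
have [al al0 Hal] : exists2 d : R, 0 < d & forall x, K x -> d <= Gqq x.
  apply: compact_gt0_bound => // x Kx; first exact: ((C1Gq x (KU _ Kx)).2 e3).
  by rewrite -GqqE// Gqq0.
have CG x : U x -> {for x, continuous G}.
  by move=> Ux; apply: differentiable_continuous; case: (C1G _ Ux).
have [dG dG0 HdG] := bound G CG.
pose d := Num.min (Num.min (Num.min du d1) (Num.min d2 d3)) dG.
have d0 : 0 < d by rewrite !lt_min du0 d10 d20 d30.
have [dle1 dle2 dle3 dle4 dle5] : [/\ d <= du, d <= d1, d <= d2, d <= d3 & d <= dG].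
  by rewrite /d !ge_min !lexx !orbT.
have Cle (r : R) : 0 < r -> d <= r -> r^-1 <= d^-1.
  by move=> r0 dr; rewrite lef_pV2 ?posrE.
have Kin th u q : A th -> H u -> Q q -> K (th, u, q) by move=> *; split.
have Qmid q q' (t : R) : Q q -> Q q' -> 0 <= t <= 1 -> Q (q + t * (q' - q)).
  move=> Qq Qq' /andP[t0 t1].
  have [qq'|/ltW q'q] := leP q q'.
    apply: (iQ q q') => //; apply/andP; split; nra.
  by apply: (iQ q' q) => //; apply/andP; split; nra.
have lin (F : J -> R) y (a : R) v : 'd F y (a *: v) = a * 'd F y v.
  by rewrite linearZ.
have dV0 : 0 <= d^-1 by rewrite invr_ge0 ltW.
have step (F : J -> R) y v (a M : R) :
    (forall t : R, 0 <= t <= 1 -> differentiable F (y + (t * a) *: v) /\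
       `|'d F (y + (t * a) *: v) v| <= M) ->
    `|F (y + a *: v) - F y| <= M * `|a|.
  move=> HF; have [t t01|t t01 ->] := @differential_mvt _ _ F y (a *: v).
    by rewrite scalerA; case: (HF t t01).
  by rewrite lin normrM mulrC ler_wpM2r// scalerA; case: (HF t t01).
have ta t a : 0 <= t <= 1 -> `|t * a| <= `|a|.
  by move=> /andP[t0 t1]; rewrite normrM ger0_norm// ler_piMl.
have normJ (x : J) (e : R) : `|x.1.1| < e -> `|x.1.2| < e -> `|x.2| < e -> `|x| < e.
  by rewrite jet_norm !gt_max => -> -> ->.
exists d^-1, al, d, Gq; split => //; split.
- move=> th u q a b Ath Hu Qq ad bd.
  have K0 := Kin _ _ _ Ath Hu Qq.
  have S1 : `|G (th, u + a, q + b) - G (th, u, q + b)| <= d^-1 * `|a|.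
    rewrite -jet_add2; apply: step => t t01; rewrite jet_add2.
    have [|Uy B] := Hdu (th, u, q) (th, u + t * a, q + b) K0.
      by apply: lt_le_trans dle1; apply: normJ; rewrite /= ?[_ + _ - _]addrAC ?subrr ?add0r ?normr0// (le_lt_trans (ta _ _ t01)).
    split; first by case: (C1G _ Uy).
    by rewrite (le_trans B)// Cle.
  have [t t01|t t01 S2] := @differential_mvt _ _ G (th, u, q) (b *: e3).
    rewrite scalerA jet_add3.
    have [|Uy B] := Hdu (th, u, q) (th, u, q + t * b) K0.
      by apply: lt_le_trans dle1; apply: normJ; rewrite /= ?[_ + _ - _]addrAC ?subrr ?add0r ?normr0// (le_lt_trans (ta _ _ t01)).
    by case: (C1G _ Uy).
  have S3 : `|Gq (th, u, q + t * b) - Gq (th, u, q)| <= d^-1 * `|t * b|.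
    rewrite -jet_add3; apply: step => s s01; rewrite jet_add3.
    have [|Uy B] := Hd3 (th, u, q) (th, u, q + s * (t * b)) K0.
      by apply: lt_le_trans dle4; apply: normJ; rewrite /= ?[_ + _ - _]addrAC ?subrr ?add0r ?normr0// (le_lt_trans (ta _ _ s01))// (le_lt_trans (ta _ _ t01)).
    split; first by case: (C1Gq _ Uy).
    by rewrite (le_trans B)// Cle.
  move: S2; rewrite lin scalerA !jet_add3 -/(Gq _) => S2.
  have S4 : (Gq (th, u, q + t * b) - Gq (th, u, q)) * b <= d^-1 * b ^+ 2.
    rewrite (le_trans (ler_norm _))// normrM -(real_normK (num_real b)) expr2 mulrA ler_wpM2r//.
    by rewrite (le_trans S3)// ler_wpM2l// ta.
  move: S1; rewrite ler_norml => /andP[_ S1].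
  exact: increment_le S1 S2 S4.
- move=> th th' u u' q Ath Ath' Hu Hu' Qq td ud.
  have S1 : `|Gq (th', u, q) - Gq (th, u, q)| <= d^-1 * `|th' - th|.
    rewrite -[in X in `|X|](subrKC th th') -jet_add1; apply: step => s s01; rewrite jet_add1.
    have [|Uy B] := Hd1 (th, u, q) (th + s * (th' - th), u, q) (Kin _ _ _ Ath Hu Qq).
      by apply: lt_le_trans dle2; apply: normJ; rewrite /= ?[_ + _ - _]addrAC ?subrr ?add0r ?normr0// (le_lt_trans (ta _ _ s01))// distrC.
    split; first by case: (C1Gq _ Uy).
    by rewrite (le_trans B)// Cle.
  have S2 : `|Gq (th', u', q) - Gq (th', u, q)| <= d^-1 * `|u' - u|.
    rewrite -[in X in `|X|](subrKC u u') -jet_add2; apply: step => s s01; rewrite jet_add2.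
    have [|Uy B] := Hd2 (th', u, q) (th', u + s * (u' - u), q) (Kin _ _ _ Ath' Hu Qq).
      by apply: lt_le_trans dle3; apply: normJ; rewrite /= ?[_ + _ - _]addrAC ?subrr ?add0r ?normr0// (le_lt_trans (ta _ _ s01))// distrC.
    split; first by case: (C1Gq _ Uy).
    by rewrite (le_trans B)// Cle.
  exact: increment_norm_le S1 S2.
- move=> th u q q' Ath Hu Qq Qq'.
  have inK t : 0 <= t <= 1 -> K (th, u, q' + t * (q - q')).
    by move=> t01; apply: Kin => //; exact: Qmid.
  have [t t01|t t01] := @differential_mvt _ _ Gq (th, u, q') ((q - q') *: e3).
    rewrite scalerA jet_add3.
    by case: (C1Gq _ (KU _ (inK t t01))).
  rewrite lin scalerA !jet_add3 subrKC => ->.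
  have := Hal _ (inK t t01); rewrite /Gqq; set z := 'd Gq _ _ => zal.
  by rewrite [leRHS]mulrAC -[in leRHS]expr2 [leRHS]mulrC ler_wpM2r ?sqr_ge0.
- move=> th u q q' Ath Hu Qq Qq'.
  rewrite -[in X in `|X|](subrKC q' q) -jet_add3; apply: step => s s01; rewrite jet_add3.
  have Ks : K (th, u, q' + s * (q - q')) by apply: Kin => //; exact: Qmid.
  have [|Uy B] := Hd3 _ (th, u, q' + s * (q - q')) Ks.
    by rewrite subrr normr0.
  split; first by case: (C1Gq _ Uy).
  by rewrite (le_trans B)// Cle.
- move=> th u q a b Ath Hu Qq ad bd.
  have [|Uy B] := HdG (th, u, q) (th, u + a, q + b) (Kin _ _ _ Ath Hu Qq).
    by apply: lt_le_trans dle5; apply: normJ; rewrite /= ?[_ + _ - _]addrAC ?subrr ?add0r ?normr0.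
  by split; [rewrite (le_trans B)// Cle|exact: CG].
Unshelve. all: by end_near. Qed.

End JetEstimates.

(** * The hull of the one-sided derivatives *)

Section Slopes.
Context {R : realType}.
Local Notation mu := (@lebesgue_measure R).
Implicit Types (h : R -> R) (a b c s t x y M : R).

(** The part of the angle [t] made of whole turns. *)
Definition turns t : R := 2 * pi * (Num.floor (t / (2 * pi)))%:~R.

Lemma turns_itv t : 0 <= t - turns t < 2 * pi.
Proof.
have p0 := twopi_gt0 (R := R); rewrite /turns.
have := Num.Theory.floor_le (t / (2 * pi)); have := Num.Theory.floorD1_gt (t / (2 * pi)).
rewrite ltr_pdivrMr// ler_pdivlMr// intrD => h1 h2.
by apply/andP; split; lra.
Qed.

Lemma periodic_turns (V : Type) (f : R -> V) t x : circle_periodic f ->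
  f (x + turns t) = f x.
Proof.
move=> pf; rewrite /turns; case: (Num.floor _) => n.
  by rewrite -pmulrn mulr_natr circle_periodicZ.
rewrite NegzE mulrNz mulrN -pmulrn mulr_natr.
by rewrite -(circle_periodicZ pf n.+1) subrK.
Qed.

Lemma period_reduction t : exists2 T0 : R, 0 <= t - T0 < 2 * pi &
  forall (V : Type) (f : R -> V), circle_periodic f -> forall x, f (x + T0) = f x.
Proof.
exists (turns t); first exact: turns_itv.
by move=> V f pf x; exact: periodic_turns.
Qed.

Lemma periodic_range_compact h : circle_periodic h -> continuous h -> compact (range h).
Proof.
move=> ph ch.
have -> : range h = h @` `[0, 2 * pi]%classic.
  rewrite eqEsubset; split; last by move=> _ [t _ <-]; exists t.
  move=> _ [t _ <-]; have [T0 /andP[t1 t2] pT] := period_reduction t.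
  exists (t - T0); first by rewrite /= in_itv/= t1 ltW.
  by rewrite -(pT _ h ph (t - T0)) subrK.
apply: continuous_compact; last exact: segment_compact.
exact: continuous_subspaceT.
Qed.

Section Fixed.
Variables (h : R -> R) (M : R).
Hypotheses (hlip : forall x y, `|h y - h x| <= M * `|y - x|)
  (hcvg : forall t, quotient h t s @[s --> 0^'+] --> right_derivative h t).

Local Notation Q := (conv_derivatives h).

Lemma conv_right_derivative t : Q (right_derivative h t).
Proof. by move=> I [_ HI]; apply: HI; exists t; left; exact: hcvg. Qed.

Lemma conv_derivatives_closed : closed Q.
Proof. by apply: closed_bigI => I [[]]. Qed.

Lemma conv_derivatives_interval : is_interval Q.
Proof.
move=> x y Qx Qy z xzy I [[cI iI] HI].
by apply: (iI x y) => //; [apply: Qx|apply: Qy].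
Qed.

Lemma conv_derivatives_bound x : Q x -> `|x| <= M.
Proof.
move=> /(_ `[- M, M]%classic) H; rewrite ler_norml.
suff : `[- M, M]%classic x by rewrite /= in_itv.
apply: H; split.
  by split; [exact: interval_closed|exact: interval_is_interval].
have cI : closed `[- M, M]%classic by exact: interval_closed.
have B t s : s != 0 -> `[- M, M]%classic (quotient h t s).
  by move=> s0; rewrite /= in_itv/= -ler_norml; exact: quotient_bound.
move=> l [t [tl|tl]].
  have H' : \forall s \near (0:R)^'+, `[- M, M]%classic (quotient h t s).
    by near=> s; apply: B; near: s; exact: nbhs_right_neq.
  exact: (@closed_cvg _ _ (0^'+) _ (quotient h t) `[- M, M]%classic cI H' l tl).
have H' : \forall s \near (0:R)^'-, `[- M, M]%classic (quotient h t s).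
  by near=> s; apply: B; near: s; exact: nbhs_left_neq.
exact: (@closed_cvg _ _ (0^'-) _ (quotient h t) `[- M, M]%classic cI H' l tl).
Unshelve. all: by end_near. Qed.

Lemma conv_derivatives_compact : compact Q.
Proof.
apply: (subclosed_compact conv_derivatives_closed (@segment_compact _ (- M) M)).
by move=> x /conv_derivatives_bound; rewrite /= in_itv/= ler_norml.
Qed.

Lemma lip_continuous : continuous h.
Proof.
move=> x; apply/cvgrPdist_le => e e0.
have M0 := lip_const_ge0 hlip.
have M1 : 0 < M + 1 by rewrite ltr_wpDl.
near=> y; rewrite distrC (le_trans (hlip _ _))//.
have : `|x - y| < e / (M + 1).
  by near: y; apply: cvgr_dist_lt => //; rewrite divr_gt0.
rewrite ltr_pdivlMr// distrC; have := normr_ge0 (y - x); nra.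
Unshelve. all: by end_near. Qed.

(** A mean value theorem for a function with right derivatives only: the right
    derivative is at least the mean slope where [h t - m t] is minimal, at most
    the mean slope where it is maximal. *)
Lemma conv_derivatives_slope a b : a < b -> Q ((h b - h a) / (b - a)).
Proof.
move=> ab; set m := _ / _.
have ba0 : 0 < b - a by rewrite subr_gt0.
have mE : h b - h a = m * (b - a) by rewrite /m divfK// gt_eqF.
have key (k : R -> R) : continuous k -> k a = k b ->
    exists2 t, a <= t < b & forall s, a <= s <= b -> k t <= k s.
  move=> ck kab.
  have [|c] := @EVT_min _ k a b (ltW ab); first exact: continuous_subspaceT.
  rewrite in_itv/= => /andP[ac cb] kc.
  have [cb'|cb'] := ltP c b; first by exists c => [|s sab]; [rewrite ac|apply: kc].
  exists a => [|s sab]; first by rewrite lexx.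
  by rewrite kab (_ : b = c) ?kc//; apply/eqP; rewrite eq_le cb'.
have clin (e : R) : continuous (fun t => e * (h t - m * t)).
  move=> t; apply: cvgM; first exact: cvg_cst.
  by apply: cvgB; [exact: lip_continuous|apply: cvgM; [exact: cvg_cst|exact: cvg_id]].
have cv t := @hcvg t.
have [t1 /andP[at1 t1b] H1] : exists2 t, a <= t < b &
    forall s, a <= s <= b -> 1 * (h t - m * t) <= 1 * (h s - m * s).
  by apply: key; [exact: clin|lra].
have [t2 /andP[at2 t2b] H2] : exists2 t, a <= t < b &
    forall s, a <= s <= b -> (-1) * (h t - m * t) <= (-1) * (h s - m * s).
  by apply: key; [exact: clin|lra].
have L1 : m <= right_derivative h t1.
  rewrite -(cvg_lim _ (cv t1))//; apply: limr_ge; first by apply/cvg_ex; eexists; exact: cv.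
  near=> s; have s0 : 0 < s by near: s; exact: nbhs_right_gt.
  have sb : s <= b - t1 by near: s; apply: nbhs_right_le; rewrite subr_gt0.
  rewrite /quotient ler_pdivlMl//; have sab : a <= t1 + s <= b by apply/andP; split; lra.
  by have := H1 _ sab; lra.
have L2 : right_derivative h t2 <= m.
  rewrite -(cvg_lim _ (cv t2))//; apply: limr_le; first by apply/cvg_ex; eexists; exact: cv.
  near=> s; have s0 : 0 < s by near: s; exact: nbhs_right_gt.
  have sb : s <= b - t2 by near: s; apply: nbhs_right_le; rewrite subr_gt0.
  rewrite /quotient ler_pdivrMl//; have sab : a <= t2 + s <= b by apply/andP; split; lra.
  by have := H2 _ sab; lra.
apply: (conv_derivatives_interval (conv_right_derivative t2) (conv_right_derivative t1)).
by rewrite L2.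
Unshelve. all: by end_near. Qed.

End Fixed.
End Slopes.

(** * The trigonometric chord *)

Section Chord.
Context {R : realType}.
Implicit Types (h : R -> R) (P : R * R) (a b c s t x y B : R).

Lemma sin_ge_half s : 0 <= s <= 1 -> s / 2 <= sin s.
Proof.
move=> /andP[s0 s1].
have [|x x01] := @MVT_segment R (sin : R -> R) (cos : R -> R) 0 s s0.
  by apply: derivable_within_continuous => x _; exact: derivable_sin.
rewrite sin0 !subr0 => ->.
have := cos_ge_quadratic x; move: x01; rewrite in_itv/= => /andP[x0 x1].
have : x ^+ 2 <= 1 by rewrite expr_le1// (le_trans x1).
by move=> ? ?; rewrite mulrC ler_wpM2r//; lra.
Qed.

(** [chord h a b] is the intersection of the supporting lines orthogonal to
    [eitheta a] and [eitheta b]. *)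
Definition chord h a b : R * R :=
  let k := (h b - h a * cos (b - a)) / sin (b - a) in
  (h a * cos a - k * sin a, h a * sin a + k * cos a).

Section Fixed.
Variables (h : R -> R) (B a b : R).
Hypotheses (B0 : 0 <= B) (ab : a < b) (ba1 : b - a <= 1)
  (hbnd : forall t, `|h t| <= 2 * B)
  (hlip : forall x y, `|h y - h x| <= 2 * B * `|y - x|)
  (htrig : forall a b t, a <= t -> t <= b -> b - a < pi ->
    h t * sin (b - a) <= h a * sin (b - t) + h b * sin (t - a))
  (hper : circle_periodic h) (hpos : forall t, 0 < h t).

Local Notation S t := (dot (chord h a b) (eitheta t)).
Let ba0 : 0 < b - a. Proof. by rewrite subr_gt0. Qed.

Let sin_gt0 : 0 < sin (b - a).
Proof.
have : (b - a) / 2 <= sin (b - a) by apply: sin_ge_half; rewrite ba1 ltW.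
by apply: lt_le_trans; rewrite divr_gt0.
Qed.

Lemma chordE t : S t = h a * cos (t - a) +
  (h b - h a * cos (b - a)) / sin (b - a) * sin (t - a).
Proof. by rewrite dot_eitheta /chord/=; set k := _ / _; rewrite cosB sinB; ring. Qed.

Lemma chord_left : S a = h a.
Proof. by rewrite chordE subrr cos0 sin0 mulr1 mulr0 addr0. Qed.

Lemma chord_right : S b = h b.
Proof. by rewrite chordE divfK ?gt_eqF// addrC subrK. Qed.

Lemma chord_interpolation t : S t * sin (b - a) = h a * sin (b - t) + h b * sin (t - a).
Proof. by rewrite dot_three chord_left chord_right. Qed.

Lemma chord_in_box : `|(chord h a b).1| <= 8 * B /\ `|(chord h a b).2| <= 8 * B.
Proof.
rewrite /chord/=; set k := _ / _.
(* [k] is the derivative at [a] of the sinusoid that interpolates [h] at [a]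
   and [b]: a difference quotient of [h] up to a term of order [b - a]. *)
have kB : `|k| <= 6 * B.
  rewrite /k normrM normfV (gtr0_norm sin_gt0) ler_pdivrMr//.
  have -> : h b - h a * cos (b - a) = (h b - h a) + h a * (1 - cos (b - a)) by ring.
  rewrite (le_trans (ler_normD _ _))//.
  have := hlip a b; rewrite (gtr0_norm ba0) => h1.
  have h2 : `|h a * (1 - cos (b - a))| <= 2 * B * ((b - a) / 2).
    rewrite normrM ler_pM// ger0_norm ?subr_ge0 ?cos_le1//.
    have := cos_ge_quadratic (b - a).
    have : (b - a) ^+ 2 <= b - a by rewrite expr2 ler_piMl// ltW.
    lra.
  have h3 : (b - a) / 2 <= sin (b - a) by apply: sin_ge_half; rewrite ba1 ltW.
  have h4 : 6 * B * ((b - a) / 2) <= 6 * B * sin (b - a) by rewrite ler_wpM2l// mulr_ge0.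
  lra.
have trig (x y c d : R) : `|x| <= 2 * B -> `|y| <= 6 * B -> `|c| <= 1 -> `|d| <= 1 ->
    `|x * c| + `|y * d| <= 8 * B.
  move=> hx hy hc hd; rewrite !normrM.
  have : `|x| * `|c| <= `|x| by rewrite ler_piMr.
  have : `|y| * `|d| <= `|y| by rewrite ler_piMr.
  lra.
have cs1 t : `|cos t| <= 1 by rewrite ler_norml cos_geN1 cos_le1.
have sn1 t : `|sin t| <= 1 by rewrite ler_norml sin_geN1 sin_le1.
split.
  by rewrite (le_trans (ler_normB _ _))// trig.
by rewrite (le_trans (ler_normD _ _))// trig.
Qed.

Lemma chord_ge t : a <= t <= b -> h t <= S t.
Proof.
move=> /andP[at_ tb]; rewrite -(ler_pM2r sin_gt0) chord_interpolation; apply: htrig => //.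
by have p2 := @pi_ge2 R; apply: le_lt_trans ba1 _; lra.
Qed.

(** There are three cases. If [t] is within [pi] of [a], then [b] lies on a
    short arc from [a] to [t], and trigonometric convexity of [h] on that arc
    is the claim; an arc from [t] to [b] through [a + 2 * pi] is symmetric.
    Otherwise both weights in [chord_interpolation] are nonpositive, so the
    left-hand side is at most zero, and [h] is positive. *)
Lemma chord_le t : b <= t <= a + 2 * pi -> S t <= h t.
Proof.
move=> /andP[bt ta]; have p2 := @pi_ge2 R.
rewrite -(ler_pM2r sin_gt0) chord_interpolation.
have [t1|t1] := ltP (t - a) pi.
  have := @htrig a t b (ltW ab) bt t1.
  have -> : sin (b - t) = - sin (t - b) by rewrite -sinN opprB.
  lra.
have [t2|t2] := leP (t - b) pi.
  have s1 : sin (b - t) <= 0.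
    have -> : b - t = - (t - b) by ring.
    by rewrite sinN oppr_le0 sin_ge0_pi// subr_ge0 bt.
  have s2 : sin (t - a) <= 0.
    rewrite -(subrK pi (t - a)) sinD sinpi cospi mulr0 addr0 mulrN1 oppr_le0 sin_ge0_pi//; apply/andP; split; lra.
  have := hpos a; have := hpos b; have := hpos t => h1 h2 h3.
  have : 0 < h t * sin (b - a) by rewrite mulr_gt0.
  have : h a * sin (b - t) <= 0 by rewrite mulr_ge0_le0// ltW.
  have : h b * sin (t - a) <= 0 by rewrite mulr_ge0_le0// ltW.
  lra.
have := @htrig (t - 2 * pi) b a; rewrite lerBlDr ta => /(_ isT (ltW ab)).
have -> : h (t - 2 * pi) = h t by rewrite -(hper (t - 2 * pi)) subrK.
have -> : sin (b - (t - 2 * pi)) = - sin (t - b).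
  have -> : b - (t - 2 * pi) = - (t - b) + 2 * pi by ring.
  by rewrite mulr_natl sinD2pi sinN.
have -> : sin (a - (t - 2 * pi)) = - sin (t - a).
  have -> : a - (t - 2 * pi) = - (t - a) + 2 * pi by ring.
  by rewrite mulr_natl sinD2pi sinN.
have -> : sin (b - t) = - sin (t - b) by rewrite -sinN opprB.
have p2' : b - (t - 2 * pi) < pi by lra.
by move=> /(_ p2'); lra.
Qed.

End Fixed.
End Chord.

(** * Integrals that do not see a null set *)

Section NullSet.
Context {R : realType}.
Local Notation mu := (@lebesgue_measure R).
Implicit Types (f g : R -> \bar R) (N D : set R).

Import HBNNSimple.

Local Open Scope ereal_scope.

(** The integral of a nonnegative function is a supremum over the simple
    functions below it, and cutting these off on [N] does not change their
    integrals. This covers integrands that are not measurable. *)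
Lemma ge0_le_integral_null f g N : measurable N -> mu N = 0 ->
  (forall x, 0 <= f x) -> (forall x, 0 <= g x) -> (forall x, ~ N x -> f x <= g x) ->
  \int[mu]_x f x <= \int[mu]_x g x.
Proof.
move=> mN N0 f0 g0 fg; rewrite !ge0_integralTE//.
apply: ge_ereal_sup => _ [h /= hf <-].
have mNC : measurable (~` N) by exact: measurableC.
pose k := proj_nnsfun h mNC.
apply: (@le_trans _ _ (sintegral mu k)); last first.
  apply: ereal_sup_ubound; exists k => // x; rewrite /k/= mindicE.
  have [xN|xN] := boolP (x \in ~` N).
    by rewrite mulr1 (le_trans (hf x))// fg//; move: xN; rewrite inE.
  by rewrite mulr0.
rewrite -(patch_setT (fun=> 0%R) h) -(patch_setT (fun=> 0%R) k) -!integral_nnsfun//.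
rewrite le_eqVlt; apply/orP; left; apply/eqP; apply: ae_eq_integral => //.
- exact/measurable_EFinP.
- exact/measurable_EFinP.
- exists N; split => // x /= H; apply: contrapT => Nx; apply: H => _.
  by rewrite /k/= mindicE mem_set// mulr1.
Qed.

Lemma integral_null f g D N : measurable N -> mu N = 0 ->
  (forall x, D x -> ~ N x -> f x = g x) -> \int[mu]_(x in D) f x = \int[mu]_(x in D) g x.
Proof.
move=> mN N0 fg.
have E (u v : R -> \bar R) : (forall x, 0 <= u x) -> (forall x, 0 <= v x) ->
    (forall x, ~ N x -> u x = v x) -> \int[mu]_x u x = \int[mu]_x v x.
  move=> u0 v0 uv; apply/eqP; rewrite eq_le; apply/andP; split;
    by apply: (ge0_le_integral_null mN) => // x Nx; rewrite uv.
have fgD x : ~ N x -> (f \_ D) x = (g \_ D) x.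
  by move=> Nx; rewrite !patchE; case: ifPn => // /set_mem Dx; exact: fg.
rewrite integral_mkcond [RHS]integral_mkcond integralE [RHS]integralE.
by congr (_ - _); apply: E => // x Nx; rewrite ?funeposE ?funenegE fgD.
Qed.

End NullSet.

(** * Support functions of bounded convex sets *)

Section SupportLike.
Context {R : realType}.
Local Notation mu := (@lebesgue_measure R).
Implicit Types (h : R -> R).

(** The properties of the support function of a convex set in the box of
    half-side [B], with their constants. *)
Definition support_like B h := [/\ 0 <= B, circle_periodic h,
  forall t, `|h t| <= 2 * B, forall x y, `|h y - h x| <= 2 * B * `|y - x| &
  semiconvex (4 * B) h /\ forall a b t, a <= t -> t <= b -> b - a < pi ->
    h t * sin (b - a) <= h a * sin (b - t) + h b * sin (t - a)].

Lemma is_Omega_support_like h Om : is_Omega h Om -> exists B, support_like B h.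
Proof.
move=> [oOm Om0 bOm _ hE].
have [B B0 OmB] := bounded_in_box bOm.
have -> : h = support_function Om by apply/funext => t; rewrite hE.
have B1 : 0 <= B + 1 by exact: addr_ge0.
have cB := closure_in_box OmB.
exists (B + 1); split => //.
- exact: support_periodic.
- exact: support_bound.
- by move=> x y; exact: support_lip.
- split; first exact: support_semiconvex.
  by move=> a b t; exact: (support_trig_convex cB Om0).
Qed.

Lemma is_Omega_W1inf h Om : is_Omega h Om -> W1inf h.
Proof.
move=> [oOm Om0 bOm _ hE].
have [B B0 OmB] := bounded_in_box bOm.
have -> : h = support_function Om by apply/funext => t; rewrite hE.
have B1 : 0 <= B + 1 by exact: addr_ge0.
exact: (support_W1inf B1 (closure_in_box OmB)).
Qed.

Lemma is_Omega_convex_support h Om : is_Omega h Om -> (forall t, 0 <= h t) ->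
  convex_support h.
Proof.
move=> [oOm Om0 bOm _ hE].
have [B B0 OmB] := bounded_in_box bOm.
have -> : h = support_function Om by apply/funext => t; rewrite hE.
have B1 : 0 <= B + 1 by exact: addr_ge0.
exact: (support_convex B1 (closure_in_box OmB)).
Qed.

Section Fixed.
Variables (h : R -> R) (B : R).
Hypothesis hB : support_like B h.

Lemma slike_ge0 : 0 <= B. Proof. by case: hB. Qed.
Let K0 : 0 <= 4 * B. Proof. by rewrite mulr_ge0// slike_ge0. Qed.
Lemma slike_periodic : circle_periodic h. Proof. by case: hB. Qed.
Lemma slike_lip x y : `|h y - h x| <= 2 * B * `|y - x|. Proof. by case: hB. Qed.
Lemma slike_semiconvex : semiconvex (4 * B) h. Proof. by case: hB => _ _ _ _ []. Qed.

Lemma slike_continuous : continuous h.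
Proof. exact: lip_continuous slike_lip. Qed.

Lemma slike_cvg t : quotient h t s @[s --> 0^'+] --> right_derivative h t.
Proof. exact: (right_derivative_cvg K0 slike_lip slike_semiconvex). Qed.

Lemma slike_primitive : is_primitive h (right_derivative h).
Proof. exact: (right_derivative_primitive K0 slike_lip slike_semiconvex). Qed.

Lemma slike_rd_measurable : measurable_fun setT (right_derivative h).
Proof. exact: (right_derivative_measurable K0 slike_lip slike_semiconvex). Qed.

Lemma slike_rd_bound t : `|right_derivative h t| <= 2 * B.
Proof. exact: (right_derivative_bound K0 slike_lip slike_semiconvex). Qed.

Lemma slike_rd_rcont t : right_derivative h s @[s --> t^'+] --> right_derivative h t.
Proof. exact: (right_derivative_rcont K0 slike_lip slike_semiconvex). Qed.

Lemma slike_rd_locint : locally_integrable setT (right_derivative h).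
Proof. exact: bounded_locint slike_rd_measurable slike_rd_bound. Qed.

Lemma slike_rd_periodic : circle_periodic (right_derivative h).
Proof. exact: right_derivative_periodic slike_periodic. Qed.

(** The cost only depends on [h], although the representative of its derivative
    under the integral is an arbitrary one and need not make the integrand
    measurable. *)
Lemma integral_jet_wderiv (G : R * R * R -> R) :
  (\int[mu]_(t in period) (G (t, h t, wderiv h t))%:E =
   \int[mu]_(t in period) (G (t, h t, right_derivative h t))%:E)%E.
Proof.
have [N [mN N0 HN]] := wderiv_primitive slike_rd_locint slike_primitive.
apply: (integral_null mN N0) => t _ Nt; congr (G _)%:E.
by congr (_, _, _); apply: contrapT => H; apply: Nt; apply: HN.
Qed.

End Fixed.
End SupportLike.

(** * The first variation *)

Section RightContinuity.
Context {R : realType}.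
Local Notation mu := (@lebesgue_measure R).

Lemma jet_right_continuous (G : R * R * R -> R) (u q : R -> R) t :
  {for (t, u t, q t), continuous G} ->
  u s @[s --> t^'+] --> u t -> q s @[s --> t^'+] --> q t ->
  G (s, u s, q s) @[s --> t^'+] --> G (t, u t, q t).
Proof.
move=> cG cu cq.
apply: (@cvg_comp _ _ _ (fun s => (s, u s, q s)) G); last exact: cG.
have ct : s @[s --> t^'+] --> t by exact/cvg_at_right_filter/cvg_id.
exact: (cvg_pair (cvg_pair ct cu) cq).
Qed.

Lemma le_Rintegral_seg_open (f g : R -> R) a b : a <= b -> locally_integrable setT f ->
  locally_integrable setT g -> (forall x, a <= x < b -> f x <= g x) ->
  \int[mu]_(x in `[a, b]) f x <= \int[mu]_(x in `[a, b]) g x.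
Proof.
move=> ab If Ig fg.
have I (k : R -> R) : locally_integrable setT k -> mu.-integrable `[a, b[ (EFin \o k).
  by move=> Ik; apply: locintS => //; exists a, b => x /=; rewrite !in_itv/= => /andP[-> /ltW].
rewrite -!Rintegral_itv_bndo_bndc; do ?exact: I.
apply: le_Rintegral => //; do ?exact: I.
Qed.

End RightContinuity.

Section Lift.
Context {R : realType}.
Local Notation mu := (@lebesgue_measure R).
Implicit Types (h : R -> R) (P : R * R) (t s a b tau : R).

(** The increase of the support function, per unit of [tau], when the convex
    set is pulled towards [P]. *)
Definition lift h P t := Num.max (dot P (eitheta t) - h t) 0.

Lemma lift_ge0 h P t : 0 <= lift h P t.
Proof. by rewrite le_max lexx orbT. Qed.

Lemma lift_periodic h P : circle_periodic h -> circle_periodic (lift h P).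
Proof. by move=> ph t; rewrite /lift ph /dot/= mulr_natl cosD2pi sinD2pi. Qed.

Variables (h : R -> R) (Om : set (R * R)) (P : R * R) (B : R).
Hypotheses (hOm : is_Omega h Om) (hB : support_like B h).

Local Notation v := (lift h P).
Local Notation lifted tau := (fun t => h t + tau * v t).
Local Notation rd := right_derivative.

(** The lift is twice the difference of the support functions of
    [pulled Om P 2^-1] and of [Om], from which its one-sided regularity follows. *)
Lemma lift_regular : exists M, [/\ forall t, `|v t| <= M, forall t, `|rd v t| <= M,
  forall t, quotient v t s @[s --> 0^'+] --> rd v t,
  forall t, rd v s @[s --> t^'+] --> rd v t & is_primitive v (rd v)].
Proof.
have t01 : 0 < (2^-1 : R) < 1 by rewrite invr_gt0 ltr0n/= invf_lt1// ltr1n.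
have kOm := pulled_Omega P t01 hOm.
have [B' kB] := is_Omega_support_like kOm.
set k := (fun t => h t + 2^-1 * _) in kOm kB.
have vE t : v t = 2 * (k t - h t) by rewrite /k -/(v t); field.
have qE t s : quotient v t s = 2 * (quotient k t s - quotient h t s).
  by rewrite /quotient !vE; ring.
have cv t : quotient v t s @[s --> 0^'+] --> 2 * (rd k t - rd h t).
  rewrite (_ : quotient v t = fun s => 2 * (quotient k t s - quotient h t s)).
    by apply: cvgM; [exact: cvg_cst|apply: cvgB; [exact: (slike_cvg kB)|exact: (slike_cvg hB)]].
  by apply/funext => s; exact: qE.
have rdE t : rd v t = 2 * (rd k t - rd h t) by exact: right_derivative_unique (cv t).
have B0 := slike_ge0 hB; have B'0 := slike_ge0 kB.
exists (2 * (2 * B' + 2 * B)); split.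
- move=> t; rewrite vE normrM ger0_norm// ler_wpM2l// (le_trans (ler_normB _ _))// lerD//.
    by case: kB => _ _ ->.
  by case: hB => _ _ ->.
- move=> t; rewrite rdE normrM ger0_norm// ler_wpM2l// (le_trans (ler_normB _ _))// lerD//.
    exact: (slike_rd_bound kB).
  exact: (slike_rd_bound hB).
- by move=> t; rewrite rdE.
- move=> t; rewrite rdE; under eq_fun do rewrite rdE.
  by apply: cvgM; [exact: cvg_cst|apply: cvgB; [exact: (slike_rd_rcont kB)|exact: (slike_rd_rcont hB)]].
- move=> a b ab; rewrite !vE.
  under eq_Rintegral do rewrite rdE.
  rewrite RintegralZ_seg; last by apply: locintB; [exact: (slike_rd_locint kB)|exact: (slike_rd_locint hB)].
  rewrite RintegralB_seg; [|exact: (slike_rd_locint kB)|exact: (slike_rd_locint hB)].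
  by rewrite -(slike_primitive kB ab) -(slike_primitive hB ab); ring.
Qed.

Lemma right_derivative_lifted tau t : rd (lifted tau) t = rd h t + tau * rd v t.
Proof.
apply: right_derivative_unique.
have [M [_ _ cv _ _]] := lift_regular.
rewrite (_ : quotient _ t = fun s => quotient h t s + tau * quotient v t s); last first.
  by apply/funext => s; rewrite /quotient; ring.
by apply: cvgD; [exact: (slike_cvg hB)|apply: cvgM; [exact: cvg_cst|exact: cv]].
Qed.

Lemma lift_rd_measurable : measurable_fun setT (rd v).
Proof. by have [M [_ _ _ rc _]] := lift_regular; exact: right_continuous_measurable. Qed.

Lemma lift_rd_locint : locally_integrable setT (rd v).
Proof.
have [M [_ vM _ _ _]] := lift_regular.
exact: bounded_locint lift_rd_measurable vM.
Qed.

Lemma lift_primitive : is_primitive v (rd v).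
Proof. by have [M []] := lift_regular. Qed.

Lemma lift_W1inf : W1inf v.
Proof.
have [M [_ vM _ _ pv]] := lift_regular.
apply: W1inf_of_primitive lift_rd_measurable vM pv.
exact: lift_periodic (slike_periodic hB).
Qed.

Lemma lift_right_derivative_eq t (l : R) (k : R -> R) d : 0 < d ->
  (forall s, t <= s < t + d -> v s = k s) -> quotient k t s @[s --> 0^'+] --> l ->
  rd v t = l.
Proof.
move=> d0 vk ck; apply: right_derivative_unique.
apply: cvg_trans ck; apply: near_eq_cvg; near=> s.
have s0 : 0 < s by near: s; exact: nbhs_right_gt.
have sd : s < d by near: s; exact: nbhs_right_lt.
by rewrite /quotient !vk//; apply/andP; split; lra.
Unshelve. all: by end_near. Qed.

End Lift.

(** Real arithmetic of the gain from [G_qq > 0]: when [y = x + e] is the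
    derivative of the perturbation and [x] the deviation from the mean slope,
    the monotonicity of [G_q] yields [- al x^2], which absorbs every
    error that is not of order [l^2]. *)
Lemma quadratic_gain (R : realType) (al C D E l x e y p pm p0 : R) :
  0 < al -> 0 <= C -> 0 <= D -> 0 <= E -> 0 <= l -> y = x + e -> `|e| <= E * l ->
  `|p - pm| <= D * l -> al * x ^+ 2 <= - ((pm - p0) * x) -> `|pm - p0| <= C * `|x| ->
  p * y <= p0 * y - al / 8 * y ^+ 2 +
    ((C * E) ^+ 2 / (2 * al) + 2 * D ^+ 2 / al + al * E ^+ 2 / 2) * l ^+ 2.
Proof.
move=> al0 C0 D0 E0 l0 yE el pl mono lip.
have H1 : (p - pm) * y <= D * l * `|y|.
  by rewrite (le_trans (ler_norm _))// normrM ler_wpM2r.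
have H2 : (pm - p0) * e <= C * E * l * `|x|.
  rewrite (le_trans (ler_norm _))// normrM (le_trans (ler_pM _ _ lip el))//.
  by rewrite le_eqVlt; apply/orP; left; apply/eqP; ring.
have nx : `|x| ^+ 2 = x ^+ 2 by rewrite real_normK ?num_real.
have ny : `|y| ^+ 2 = y ^+ 2 by rewrite real_normK ?num_real.
have ne : e ^+ 2 <= E ^+ 2 * l ^+ 2.
  rewrite -(real_normK (num_real e)) -exprMn lerXn2r// nnegrE//.
  exact: mulr_ge0.
have H3 : C * E * l * `|x| <= al / 2 * x ^+ 2 + (C * E) ^+ 2 / (2 * al) * l ^+ 2.
  rewrite -subr_ge0 -nx.
  have -> : al / 2 * `|x| ^+ 2 + (C * E) ^+ 2 / (2 * al) * l ^+ 2 - C * E * l * `|x| =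
    (al * `|x| - C * E * l) ^+ 2 / (2 * al) by field; rewrite gt_eqF.
  by rewrite divr_ge0 ?sqr_ge0// mulr_ge0// ltW.
have H4 : D * l * `|y| <= al / 8 * y ^+ 2 + 2 * D ^+ 2 / al * l ^+ 2.
  rewrite -subr_ge0 -ny.
  have -> : al / 8 * `|y| ^+ 2 + 2 * D ^+ 2 / al * l ^+ 2 - D * l * `|y| =
    (al * `|y| - 4 * D * l) ^+ 2 / (8 * al) by field; rewrite gt_eqF.
  by rewrite divr_ge0 ?sqr_ge0// mulr_ge0// ltW.
have H5 : al / 2 * (y ^+ 2 / 2 - e ^+ 2) <= al / 2 * x ^+ 2.
  apply: ler_wpM2l; first by rewrite divr_ge0// ltW.
  rewrite yE.
  have := sqr_ge0 (x - e); rewrite sqrrB sqrrD; lra.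
have H6 : al / 2 * e ^+ 2 <= al * E ^+ 2 / 2 * l ^+ 2.
  have -> : al * E ^+ 2 / 2 * l ^+ 2 = al / 2 * (E ^+ 2 * l ^+ 2) by field.
  by rewrite ler_wpM2l// divr_ge0// ltW.
have -> : p * y = p0 * y + (p - pm) * y + (pm - p0) * e + (pm - p0) * x by rewrite yE; ring.
move: H3 H4 H6; set k1 := (C * E) ^+ 2 / _; set k2 := 2 * D ^+ 2 / al.
set k3 := al * E ^+ 2 / 2; move: k1 k2 k3 => k1 k2 k3 H3 H4 H6.
by lra.
Qed.

Section Variation.
Context {R : realType}.
Local Notation mu := (@lebesgue_measure R).
Local Notation rd := right_derivative.
Variables (S_ad : set (set (R * R))) (k1 k2 : R -> \bar R)
  (J Rfun Cfun : set (R * R) -> R) (r : (R -> R) -> R) (G : R * R * R -> R)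
  (h0 : R -> R) (Om0 : set (R * R)) (B : R).
Hypotheses (k2_periodic : circle_periodic k2) (k2_lsc : lower_semicontinuous k2)
  (F_ad : forall h Om, W1inf h -> convex_support h -> is_Omega h Om ->
     (S_ad Om <-> between k1 k2 h))
  (h0_Om0 : is_Omega h0 Om0) (h0_gt0 : forall t, 0 < h0 t)
  (Om0_adm : S_ad Om0)
  (Om0_opt : forall Om, S_ad Om -> convex_domain Om -> J Om0 <= J Om)
  (J_sum : forall Om, J Om = Rfun Om + Cfun Om)
  (Rfun_r : forall h Om, W1inf h -> convex_support h -> is_Omega h Om ->
     between k1 k2 h -> Rfun Om = r h)
  (Cfun_G : forall h Om, W1inf h -> convex_support h -> is_Omega h Om ->
     between k1 k2 h ->
     (Cfun Om)%:E = (\int[mu]_(t in period) (G (t, h t, wderiv h t))%:E)%E)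
  (hB : support_like B h0).

Let between0 : between k1 k2 h0.
Proof.
apply/(F_ad (is_Omega_W1inf h0_Om0) _ h0_Om0) => //.
by apply: (is_Omega_convex_support h0_Om0) => t; exact: ltW.
Qed.

Lemma cost_of_support h Om : is_Omega h Om -> (forall t, 0 <= h t) ->
  between k1 k2 h ->
  S_ad Om /\ J Om = r h + \int[mu]_(t in period) G (t, h t, rd h t).
Proof.
move=> hOm h_ge0 bh.
have [B' hB'] := is_Omega_support_like hOm.
have Wh := is_Omega_W1inf hOm; have ch := is_Omega_convex_support hOm h_ge0.
split; first exact/(F_ad Wh ch hOm).
rewrite J_sum (Rfun_r Wh ch hOm bh); congr (_ + _).
by have := Cfun_G Wh ch hOm bh; rewrite (integral_jet_wderiv hB') /Rintegral => <-.
Qed.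

(** Optimality of [Om0] against the pulled sets. As pulling increases the
    support function, the upper constraint is the only one to be checked. *)
Lemma variation_ge0 P tau : 0 < tau < 1 ->
  (forall t, ((h0 t + tau * lift h0 P t)%:E <= k2 t)%E) ->
  0 <= (r (fun t => h0 t + tau * lift h0 P t) - r h0) +
    (\int[mu]_(t in period)
       G (t, h0 t + tau * lift h0 P t, rd h0 t + tau * rd (lift h0 P) t) -
     \int[mu]_(t in period) G (t, h0 t, rd h0 t)).
Proof.
move=> t01 le2; have [t0 t1] := andP t01.
have kOm := pulled_Omega P t01 h0_Om0.
have inc t : h0 t <= h0 t + tau * lift h0 P t.
  by rewrite lerDl mulr_ge0 ?lift_ge0// ltW.
have [|t|Sk Jk] := cost_of_support kOm.
- by move=> t; rewrite (le_trans _ (inc t))// ltW.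
- apply/andP; split => //; have /andP[+ _] := between0 t.
  by move=> /le_trans; apply; rewrite lee_fin.
have [|_ J0] := cost_of_support h0_Om0 _ between0; first by move=> t; exact: ltW.
have := Om0_opt Sk (pulled_convex t01 h0_Om0); rewrite J0 Jk.
under [X in _ <= _ + X -> _]eq_Rintegral do rewrite (right_derivative_lifted P h0_Om0 hB).
rewrite /lift; lra.
Qed.

(** Lower semicontinuity of [k2] and continuity of [h0] leave some room near
    each point, and compactness makes it uniform. *)
Lemma upper_room a b : (`[a, b] `<=` strictly_between k1 k2 h0) ->
  exists2 d : R, 0 < d & forall t, a <= t <= b -> ((h0 t + d)%:E <= k2 t)%E.
Proof.
move=> abU.
have /compact_near_coveringP/(_ R (0^'+) (fun d t => ((h0 t + d)%:E <= k2 t)%E) _) :=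
  @segment_compact R a b.
case.
  move=> t /abU/andP[_ tk].
  have [e e0 te] : exists2 e : R, 0 < e & ((h0 t + e)%:E < k2 t)%E.
    move: tk; case: (k2 t) => [u| |]//; last by exists 1; rewrite ?ltry.
    rewrite lte_fin => hu; exists ((u - h0 t) / 2); first by rewrite divr_gt0// subr_gt0.
    by rewrite lte_fin; lra.
  have [V Vt HV] := k2_lsc te.
  have e2 : 0 < e / 2 by rewrite divr_gt0.
  exists (V `&` [set s | h0 s <= h0 t + e / 2], [set d | d <= e / 2]).
    split => /=; last by near=> d; near: d; exact: nbhs_right_le.
    apply: filterI => //.
    have /cvgrPdist_le/(_ _ e2) := slike_continuous hB (x := t).
    by apply: filterS => y /=; rewrite ler_norml => /andP[+ _]; lra.
  move=> [s d] /= [[Vs hs] de]; apply: ltW.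
  by apply: le_lt_trans (HV _ Vs); rewrite lee_fin; lra.
move=> d /= d0 Hd; exists (d / 2); first by rewrite divr_gt0.
move=> t tab; apply: (Hd (d / 2)) => //=.
  by rewrite sub0r normrN gtr0_norm ?divr_gt0// ltr_pdivrMr//; lra.
by rewrite divr_gt0.
Unshelve. all: by end_near. Qed.

Section FirstOrder.
Variables (a b C al d : R) (Gq : R * R * R -> R) (g : R -> R)
  (L : (R -> R) -> R).
Hypotheses (ab : a < b) (ba1 : b - a <= 1) (bad : (1 + 2 * B) * (b - a) < d)
  (abA : -1 <= a /\ b <= 2 * pi + 1)
  (abU : `[a, b] `<=` strictly_between k1 k2 h0)
  (jb : jet_bounds G `[-1, 2 * pi + 1]%classic (range h0) (conv_derivatives h0)
     C al d Gq)
  (G_periodic : forall u q, circle_periodic (fun t => G (t, u, q)))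
  (rL : is_frechet_derivative r h0 L)
  (Lg : forall v, W1inf v -> L v = \int[mu]_(t in period) (g t * v t)).

Local Notation P := (chord h0 a b).
Local Notation v := (lift h0 P).
Local Notation S t := (dot P (eitheta t)).
Local Notation Q := (conv_derivatives h0).

Let B0 := slike_ge0 hB.
Let C0 : 0 <= C. Proof. by case: jb. Qed.
Let al0 : 0 < al. Proof. by case: jb. Qed.
Let d0 : 0 < d. Proof. by case: jb. Qed.
Let ba0 : 0 < b - a. Proof. by rewrite subr_gt0. Qed.
Let htrig a' b' t : a' <= t -> t <= b' -> b' - a' < pi ->
    h0 t * sin (b' - a') <= h0 a' * sin (b' - t) + h0 b' * sin (t - a').
Proof. by case: hB => _ _ _ _ [_]; apply. Qed.
Let hbnd t : `|h0 t| <= 2 * B. Proof. by case: hB. Qed.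
Let Pbox : `|P.1| <= 8 * B /\ `|P.2| <= 8 * B.
Proof. exact: (chord_in_box B0 ab ba1 hbnd (slike_lip hB)). Qed.

Lemma lift_chord_in t : a <= t <= b -> v t = S t - h0 t.
Proof.
move=> tab; apply/max_idPl; rewrite subr_ge0.
exact: (chord_ge ab ba1 htrig).
Qed.

Lemma lift_chord_out t : b <= t <= a + 2 * pi -> v t = 0.
Proof.
move=> tab; apply/max_idPr; rewrite subr_le0.
exact: (chord_le ab ba1 htrig (slike_periodic hB) h0_gt0).
Qed.

Lemma rd_lift_chord_in t : a <= t < b -> rd v t = dot' P t - rd h0 t.
Proof.
move=> /andP[at_ tb]; have bt0 : 0 < b - t by rewrite subr_gt0.
apply: (@lift_right_derivative_eq _ _ _ _ _ (fun t => S t - h0 t) _ bt0).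
  by move=> s /andP[ts sb]; apply: lift_chord_in; apply/andP; split; lra.
rewrite (_ : quotient _ t = fun s => quotient (fun t => S t) t s - quotient h0 t s); last first.
  by apply/funext => s; rewrite /quotient; ring.
apply: cvgB; last exact: (slike_cvg hB).
exact: is_derive_quotient (dot_derive P t).
Qed.

Lemma rd_lift_chord_out t : b <= t < a + 2 * pi -> rd v t = 0.
Proof.
move=> /andP[bt ta]; have ta0 : 0 < a + 2 * pi - t by rewrite subr_gt0.
apply: (@lift_right_derivative_eq _ _ _ _ _ (fun=> 0) _ ta0).
  by move=> s /andP[ts sb]; apply: lift_chord_out; apply/andP; split; lra.
rewrite (_ : quotient _ t = fun=> 0); first exact: cvg_cst.
by apply/funext => s; rewrite /quotient subrr mulr0.
Qed.

(** Modulo a turn, either [t] is on the arc, where [upper_room] applies, or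
    the lift vanishes at [t]. *)
Lemma lifted_le_upper : exists2 tau0 : R, 0 < tau0 & forall tau, 0 < tau <= tau0 ->
  forall t, ((h0 t + tau * v t)%:E <= k2 t)%E.
Proof.
have [e e0 He] := upper_room abU.
have [M [vM _ _ _ _]] := lift_regular P h0_Om0 hB.
have M0 : 0 <= M by exact: le_trans (vM 0).
have M1 : 0 < M + 1 by rewrite ltr_wpDl.
exists (e / (M + 1)); first by rewrite divr_gt0.
move=> tau /andP[t0]; rewrite ler_pdivlMr// => te t.
have [T0 /andP[tT1 tT2] pT] := period_reduction (t - a).
pose s := t - T0.
have -> : t = s + T0 by rewrite subrK.
rewrite (pT _ _ (slike_periodic hB)) (pT _ _ (lift_periodic _ (slike_periodic hB))).
rewrite (pT _ _ k2_periodic).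
have [sb|bs] := leP s b.
  have sab : a <= s <= b by rewrite sb andbT /s; lra.
  apply: le_trans (He _ sab); rewrite lee_fin lerD2l.
  have := vM s; rewrite ger0_norm ?lift_ge0// => vs.
  by have : tau * v s <= tau * M; [rewrite ler_wpM2l// ltW|lra].
rewrite lift_chord_out ?mulr0 ?addr0; first by have /andP[] := between0 s.
by rewrite (ltW bs)/= /s; lra.
Qed.

(** Brings an angle into the window on which [jet_bounds] is stated. The
    window exceeds a period by one on each side, so that it contains every arc
    of length at most one that is centred in the period. *)
Lemma jet_mem t : exists2 s, [/\ -1 <= s <= 2 * pi + 1, h0 t = h0 s & rd h0 t = rd h0 s] &
  forall u q, G (t, u, q) = G (s, u, q) /\
    ({for (s, u, q), continuous G} -> {for (t, u, q), continuous G}).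
Proof.
have [T0 /andP[t1 t2] pT] := period_reduction t.
have tE : t = (t - T0) + T0 by rewrite subrK.
exists (t - T0); first split.
- by apply/andP; split; lra.
- by rewrite [in LHS]tE (pT _ _ (slike_periodic hB)).
- by rewrite [in LHS]tE (pT _ _ (slike_rd_periodic hB)).
have GE s u q : G (s, u, q) = G (s - T0, u, q).
  by rewrite -(pT _ _ (G_periodic u q) (s - T0)) subrK.
move=> u q; split; first exact: GE.
move=> cG.
have shE (y : R * R * R) : y - (T0, 0, 0) = (y.1.1 - T0, y.1.2, y.2).
  by case: y => [[s' u'] q']; congr (_, _, _); rewrite /= subr0.
have GE' : G = G \o (fun y => y - (T0, 0, 0)).
  by apply/funext => -[[s' u'] q'] /=; rewrite shE; exact: GE.
rewrite GE'; apply: continuous_comp; last by rewrite shE.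
by apply: cvgB; [exact: cvg_id|exact: cvg_cst].
Qed.

Lemma jet_locint tau M : 0 <= tau -> tau * M < d -> (forall t, `|v t| <= M) ->
  (forall t, `|rd v t| <= M) ->
  locally_integrable setT (fun t => G (t, h0 t + tau * v t, rd h0 t + tau * rd v t)).
Proof.
move=> t0 tM vM rM.
have small (x : R) : `|x| <= M -> `|tau * x| < d.
  by move=> xM; rewrite normrM ger0_norm// (le_lt_trans _ tM)// ler_wpM2l.
have [_ _ _ [_ _ _ _ bnd]] := jb.
have key t : `|G (t, h0 t + tau * v t, rd h0 t + tau * rd v t)| <= C /\
    {for (t, h0 t + tau * v t, rd h0 t + tau * rd v t), continuous G}.
  have [s [sA -> ->] Gs] := jet_mem t.
  have [-> cG] := Gs (h0 s + tau * v t) (rd h0 s + tau * rd v t).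
  have [|||||bG cG'] := bnd s (h0 s) (rd h0 s) (tau * v t) (tau * rd v t).
  - by rewrite /= in_itv.
  - by exists s.
  - by apply: conv_right_derivative => ?; exact: (slike_cvg hB).
  - exact: small.
  - exact: small.
  - by split=> //; exact: cG.
have [M' [_ _ _ rc _]] := lift_regular P h0_Om0 hB.
apply: (@bounded_locint _ _ C); last by move=> t; case: (key t).
apply: right_continuous_measurable => t.
apply: (@jet_right_continuous _ G (fun t => h0 t + tau * v t) (fun t => rd h0 t + tau * rd v t)).
- by case: (key t).
- apply: cvgD; first exact/cvg_at_right_filter/(slike_continuous hB).
  apply: cvgM; first exact: cvg_cst.
  apply/cvg_at_right_filter/is_primitive_continuous.
    exact: (lift_rd_locint P h0_Om0 hB).
  exact: (lift_primitive P h0_Om0 hB).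
- apply: cvgD; first exact: (slike_rd_rcont hB).
  by apply: cvgM; [exact: cvg_cst|exact: rc].
Qed.

Let m := (h0 b - h0 a) / (b - a).
Let p0 := Gq (a, h0 a, m).
Let C6 := (C * (16 * B)) ^+ 2 / (2 * al) + 2 * (C * (1 + 2 * B)) ^+ 2 / al +
  al * (16 * B) ^+ 2 / 2.

(** The interpolating sinusoid has the slope [m] somewhere on the arc, and its
    derivative is Lipschitz. *)
Lemma chord_slope t : a <= t <= b -> `|dot' P t - m| <= 16 * B * (b - a).
Proof.
move=> /andP[at_ tb].
have [|x] := @MVT_segment _ (fun t => S t) (dot' P) a b (ltW ab) (fun x _ => dot_derive P x).
  apply: derivable_within_continuous => x _.
  by have [] := dot_derive P x.
rewrite in_itv/= => /andP[ax xb].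
rewrite chord_left (chord_right h0 ab ba1) => E.
have -> : m = dot' P x by rewrite /m E mulfK// gt_eqF.
have [P1 P2] := Pbox.
rewrite (le_trans (dot'_lip P1 P2 x t))//.
have -> : 2 * (8 * B) = 16 * B by ring.
rewrite ler_wpM2l ?mulr_ge0// ler_norml; apply/andP; split; lra.
Qed.

Let window t : a <= t <= b -> `[-1, 2 * pi + 1]%classic t.
Proof.
have [a1 b1] := abA.
by rewrite /= in_itv/= => /andP[at_ tb]; rewrite (le_trans a1)// (le_trans tb).
Qed.

Let rdQ t : Q (rd h0 t).
Proof. by apply: conv_right_derivative => ?; exact: (slike_cvg hB). Qed.

Let mQ : Q m.
Proof.
apply: (conv_derivatives_slope (slike_lip hB)) => // ?; exact: (slike_cvg hB).
Qed.

(** Here [G_q] is compared with [p0], its value at the left end of the arc and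
    at the mean slope; the contribution of the constant [p0] integrates to
    zero over the arc. *)
Lemma chord_gain t : a <= t < b ->
  Gq (t, h0 t, rd h0 t) * rd v t <=
  p0 * rd v t - al / 8 * rd v t ^+ 2 + C6 * (b - a) ^+ 2.
Proof.
move=> tab; have /andP[at_ tb] := tab.
have tab' : a <= t <= b by rewrite at_ ltW.
have aab : a <= a <= b by rewrite lexx ltW.
have [_ _ _ [_ lip2 mono lipq _]] := jb.
have Bl : `|h0 t - h0 a| <= 2 * B * (t - a).
  by have := slike_lip hB a t; rewrite (ger0_norm (_ : 0 <= t - a)) ?subr_ge0.
have dl : 2 * B * (t - a) <= 2 * B * (b - a).
  by apply: ler_wpM2l; [rewrite mulr_ge0|lra].
have B2 : 0 <= 2 * B * (b - a) by rewrite mulr_ge0 ?mulr_ge0// ltW.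
apply: (@quadratic_gain _ al C (C * (1 + 2 * B)) (16 * B) (b - a) (m - rd h0 t)
  (dot' P t - m) _ _ (Gq (a, h0 a, rd h0 t))) => //.
- by rewrite mulr_ge0// addr_ge0// mulr_ge0.
- by rewrite mulr_ge0.
- exact: ltW.
- by rewrite rd_lift_chord_in//; ring.
- exact: chord_slope.
- rewrite (le_trans (lip2 _ _ _ _ _ _ _ _ _ _ _ _))//; do ?exact: window.
  + rewrite ger0_norm ?subr_ge0// (le_lt_trans _ bad)// mulrDl mul1r.
    by move: B2 at_ tb; move: (2 * B * _) => z; lra.
  + rewrite (le_lt_trans Bl)// (le_lt_trans dl)// (le_lt_trans _ bad)//.
    by rewrite ler_wpM2r ?lerDr// ltW.
  + rewrite -mulrA ler_wpM2l// (ger0_norm (_ : 0 <= t - a)) ?subr_ge0//; lra.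
- have := mono a (h0 a) (rd h0 t) m (window aab) _ (rdQ t) mQ.
  rewrite -/p0; set q := rd h0 t; set z := Gq _.
  have -> : (m - q) ^+ 2 = (q - m) ^+ 2 by ring.
  by rewrite -[m - q]opprB mulrN opprK; apply; exists a.
- rewrite [`|m - _|]distrC; apply: lipq => //; exact: window.
Qed.

(** Off the arc the two integrands coincide. On it, the expansion in
    [jet_bounds] and [chord_gain] apply, and the integral of [p0 * rd v] is
    zero since [v] vanishes at both ends. *)
Lemma cost_increment tau M : 0 < tau -> tau * M < d -> (forall t, `|v t| <= M) ->
  (forall t, `|rd v t| <= M) ->
  \int[mu]_(t in period) G (t, h0 t + tau * v t, rd h0 t + tau * rd v t) -
  \int[mu]_(t in period) G (t, h0 t, rd h0 t) <=
  tau * (C * \int[mu]_(t in `[a, b]) v t - al / 8 * \int[mu]_(t in `[a, b]) rd v t ^+ 2 +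
         (C6 * (b - a) ^+ 2 + C * tau * M ^+ 2) * (b - a)).
Proof.
move=> t0 tM vM rM.
have M0 : 0 <= M by exact: le_trans (vM 0).
have I1 := jet_locint (ltW t0) tM vM rM.
have I0 : locally_integrable setT (fun t => G (t, h0 t, rd h0 t)).
  have := @jet_locint 0 M (lexx _) _ vM rM; rewrite mul0r => /(_ d0).
  rewrite (_ : (fun t => _) = (fun t => G (t, h0 t, rd h0 t)))//.
  by apply/funext => t; rewrite !mul0r !addr0.
have perh := slike_periodic hB; have perrd := slike_rd_periodic hB.
have perv := lift_periodic P perh; have perrv := right_derivative_periodic perv.
rewrite (Rintegral_period a _ I1); last first.
  by move=> t; rewrite perh perrd perv perrv; exact: G_periodic.
rewrite (Rintegral_period a _ I0); last first.
  by move=> t; rewrite perh perrd; exact: G_periodic.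
rewrite -RintegralB_seg//.
have p2 := @pi_ge2 R.
have ba2 : b <= a + 2 * pi by move: ba1 p2; move: pi => x; lra.
have ID := locintB I1 I0.
rewrite (Rintegral_chasles ID (ltW ab) ba2).
have out : \int[mu]_(t in `[b, a + 2 * pi]) (G (t, h0 t + tau * v t, rd h0 t + tau * rd v t) -
    G (t, h0 t, rd h0 t)) <= 0.
  rewrite -[leRHS](_ : \int[mu]_(t in `[b, a + 2 * pi]) 0 = 0); last by rewrite Rintegral_seg_cst// mul0r.
  apply: le_Rintegral_seg_open => //; first exact: locint_cst.
  move=> t /andP[bt ta]; rewrite lift_chord_out; last by rewrite bt ltW.
  rewrite rd_lift_chord_out; last by rewrite bt.
  by rewrite !mulr0 !addr0 subrr.
have Iv : locally_integrable setT v.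
  apply: continuous_locint; apply: is_primitive_continuous (lift_primitive P h0_Om0 hB).
  exact: (lift_rd_locint P h0_Om0 hB).
have Irv := lift_rd_locint P h0_Om0 hB.
have Irv2 : locally_integrable setT (fun t => rd v t ^+ 2).
  apply: (@bounded_locint _ _ (M ^+ 2)).
    exact: (measurable_funX 2 (lift_rd_measurable P h0_Om0 hB)).
  by move=> t; rewrite normrX lerXn2r// nnegrE.
pose K := C6 * (b - a) ^+ 2 + C * tau * M ^+ 2.
have pt t : a <= t < b ->
    G (t, h0 t + tau * v t, rd h0 t + tau * rd v t) - G (t, h0 t, rd h0 t) <=
    tau * ((C * v t + p0 * rd v t) - al / 8 * rd v t ^+ 2 + K).
  move=> tab; have /andP[at_ tb] := tab.
  have tab' : a <= t <= b by rewrite at_ ltW.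
  have small (x : R) : `|x| <= M -> `|tau * x| < d.
    by move=> xM; rewrite normrM gtr0_norm// (le_lt_trans _ tM)// ler_wpM2l// ltW.
  have [_ _ _ [E1 _ _ _ _]] := jb.
  apply: le_trans (E1 t (h0 t) (rd h0 t) (tau * v t) (tau * rd v t) _ _ _ _ _) _ => //.
  - exact: window.
  - exact: small.
  - exact: small.
  rewrite ger0_norm; last by rewrite mulr_ge0 ?lift_ge0// ltW.
  have H1 := chord_gain tab.
  have H2 : rd v t ^+ 2 <= M ^+ 2.
    by rewrite -(real_normK (num_real (rd v t))) lerXn2r// nnegrE.
  have -> : C * (tau * v t) + Gq (t, h0 t, rd h0 t) * (tau * rd v t) + C * (tau * rd v t) ^+ 2 =
    tau * (C * v t + Gq (t, h0 t, rd h0 t) * rd v t + C * tau * rd v t ^+ 2) by ring.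
  apply: ler_wpM2l; first exact: ltW.
  have H3 : C * tau * rd v t ^+ 2 <= C * tau * M ^+ 2.
    by apply: ler_wpM2l => //; rewrite mulr_ge0// ltW.
  by rewrite /K; lra.
have L1 : \int[mu]_(t in `[a, b]) (G (t, h0 t + tau * v t, rd h0 t + tau * rd v t) -
    G (t, h0 t, rd h0 t)) <=
  \int[mu]_(t in `[a, b]) (tau * ((C * v t + p0 * rd v t) - al / 8 * rd v t ^+ 2 + K)).
  apply: le_Rintegral_seg_open => //; first exact: ltW.
  apply: locintZ; apply: locintD; last exact: locint_cst.
  by apply: locintB; [apply: locintD; exact: locintZ|exact: locintZ].
apply: le_trans (lerD L1 out) _; rewrite addr0 RintegralZ_seg; last first.
  apply: locintD; last exact: locint_cst.
  by apply: locintB; [apply: locintD; exact: locintZ|exact: locintZ].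
apply: ler_wpM2l; first exact: ltW.
rewrite RintegralD_seg; [|by apply: locintB; [apply: locintD; exact: locintZ|exact: locintZ]|exact: locint_cst].
rewrite RintegralB_seg; [|by apply: locintD; exact: locintZ|exact: locintZ].
rewrite RintegralD_seg; [|exact: locintZ|exact: locintZ].
rewrite !RintegralZ_seg// Rintegral_seg_cst; last exact: ltW.
have aab : a <= a <= b by rewrite lexx ltW.
have abb : a <= b <= b by rewrite lexx ltW.
have va : v a = 0 by rewrite lift_chord_in// chord_left subrr.
have vb : v b = 0 by rewrite lift_chord_in// (chord_right h0 ab ba1) subrr.
rewrite -(lift_primitive P h0_Om0 hB (ltW ab)) va vb subrr mulr0 addr0.
exact: lexx.
Qed.

(** The first order condition: divide [variation_ge0] by [tau] and let [tau]
    tend to zero. The quadratic gain is of first order in [tau] and survives,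
    whereas the error of the expansion of [G] is of second order and
    disappears. *)
Lemma first_variation :
  0 <= \int[mu]_(t in period) (g t * v t) + C * \int[mu]_(t in `[a, b]) v t -
    al / 8 * \int[mu]_(t in `[a, b]) rd v t ^+ 2 + C6 * (b - a) ^+ 3.
Proof.
have [M [vM rM _ _ pv]] := lift_regular P h0_Om0 hB.
have M0 : 0 <= M by exact: le_trans (vM 0).
have Wv := lift_W1inf P h0_Om0 hB.
have Irv := lift_rd_locint P h0_Om0 hB.
have [tau1 tau10 Htau1] := lifted_le_upper.
rewrite -(Lg Wv).
have [Llin _ Lder] := rL.
have LZ (c : R) w : W1inf w -> L (c *: w) = c * L w.
  move=> Ww; have W0 : W1inf (0 : R -> R).
    apply: (@W1inf_of_primitive _ _ (fun=> 0) 0) => //.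
      by move=> x; rewrite normr0.
    by move=> x y xy; rewrite Rintegral_seg_cst// mul0r subrr.
  have L0 : L 0 = 0.
    have := Llin 1 0 0 W0 W0; rewrite scale1r addr0 mul1r => /eqP.
    by rewrite -subr_eq0 opprD addrA subrr sub0r oppr_eq0 => /eqP.
  by have := Llin c w 0 Ww W0; rewrite addr0 L0 addr0.
apply/ler_addgt0Pr => e e0.
(* [N] and [Cq] are one more than what is to be multiplied by [tau], hence
   positive. *)
pose N := 2 * M + 1.
have N0 : 0 < N by rewrite /N ltr_wpDl// mulr_ge0.
have [dr dr0 Hdr] := Lder (e / (2 * N)) (divr_gt0 e0 (mulr_gt0 (ltr0Sn _ 1) N0)).
pose Cq := C * M ^+ 2 * (b - a) + 1.
have Cq0 : 0 < Cq by rewrite ltr_wpDl// !mulr_ge0 ?sqr_ge0// ltW.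
have [tau [tau0 [tle1 tleh tled tler tleq]]] : exists tau : R, 0 < tau /\
    [/\ tau <= tau1, tau <= 1 / 2, tau * N <= d, tau * N <= dr / 2 & tau * Cq <= e / 2].
  exists (Num.min (Num.min tau1 (1 / 2)) (Num.min (d / N) (Num.min (dr / 2 / N) (e / 2 / Cq)))).
  rewrite -!ler_pdivlMr// !lt_min !ge_min !lexx !orbT tau10 !divr_gt0//.
have tle' : 0 < tau < 1 by apply/andP; split=> //; lra.
have tauM : tau * M < d by apply: lt_le_trans tled; rewrite ltr_pM2l// /N; lra.
have := variation_ge0 tle' (Htau1 tau _); rewrite tau0 tle1 => /(_ isT) V.
have CI := cost_increment tau0 tauM vM rM.
have Wtv : W1inf (tau *: v).
  apply: (@W1inf_of_primitive _ _ (fun t => tau * rd v t) (tau * M)).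
  - by move=> t; rewrite /= /GRing.scale/= (lift_periodic P (slike_periodic hB)).
  - by apply: measurable_funM => //; exact: (lift_rd_measurable P h0_Om0 hB).
  - by move=> t; rewrite normrM gtr0_norm// ler_wpM2l// ltW.
  - exact: is_primitiveZ.
have norm_tv : (W1inf_norm (tau *: v) <= (tau * (2 * M))%:E)%E.
  have -> : tau * (2 * M) = tau * M + tau * M by ring.
  apply: (@W1inf_norm_le _ _ (fun t => tau * rd v t)).
  - by rewrite mulr_ge0// ltW.
  - by rewrite mulr_ge0// ltW.
  - exact: locintZ.
  - exact: is_primitiveZ.
  - by move=> t; rewrite normrM gtr0_norm// ler_wpM2l// ltW.
  - by move=> t; rewrite normrM gtr0_norm// ler_wpM2l// ltW.
have small : (W1inf_norm (tau *: v) < dr%:E)%E.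
  apply: le_lt_trans norm_tv _; rewrite lte_fin.
  have : tau * (2 * M) <= tau * N by rewrite ler_pM2l// /N; lra.
  lra.
have := Hdr _ Wtv small; rewrite LZ//.
have -> : h0 + tau *: v = (fun t => h0 t + tau * v t) by [].
set r1 := r _ => Fr.
have {}Fr : `|r1 - r h0 - tau * L v| <= tau * (e / 2).
  rewrite -lee_fin (le_trans Fr)//.
  have e2N : (0 <= (e / (2 * N))%:E)%E by rewrite lee_fin divr_ge0 ?mulr_ge0 ?ltW.
  apply: le_trans (lee_wpmul2l e2N norm_tv) _; rewrite -EFinM lee_fin.
  have -> : e / (2 * N) * (tau * (2 * M)) = tau * (e / 2) * (2 * M / N) by field; rewrite gt_eqF.
  rewrite ler_piMr//; first by rewrite mulr_ge0 ?divr_ge0 ?ltW.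
  by rewrite ler_pdivrMr// mul1r /N; lra.
move: Fr; rewrite ler_norml => /andP[_ Fr].
rewrite -(ler_pM2l tau0) mulr0.
have tq : tau * (C * M ^+ 2 * (b - a)) <= e / 2.
  by apply: le_trans tleq; rewrite ler_pM2l// /Cq lerDl.
have tq2 : tau * (tau * (C * M ^+ 2 * (b - a))) <= tau * (e / 2) by rewrite ler_pM2l.
move: V CI Fr tq2; rewrite -/r1; move: (\int[mu]_(t in period) _) (\int[mu]_(t in period) _) => i1 i0.
move: (\int[mu]_(t in `[a, b]) _) (\int[mu]_(t in `[a, b]) _) => iv irv.
move: (r1) (r h0) (L v) => x1 x0 xl V CI Fr tq2.
have := le_trans V (lerD (_ : x1 - x0 <= tau * xl + tau * (e / 2)) CI).
have -> : x1 - x0 <= tau * xl + tau * (e / 2) by lra.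
move=> /(_ isT) {V} V; apply: le_trans V _.
have -> : (C6 * (b - a) ^+ 2 + C * tau * M ^+ 2) * (b - a) =
  C6 * (b - a) ^+ 3 + tau * (C * M ^+ 2 * (b - a)) by ring.
move: (C6 * _) (C * M ^+ 2 * (b - a)) tq2 => c6 cc tq2.
rewrite !(mulrDr, mulrBr) in tq2 *; lra.
Qed.

End FirstOrder.
End Variation.

(** * Midpoint estimate *)

Section GainArithmetic.
Context {R : realType}.

(** If [X < I], then the right-hand side is at most [(K1 + K2) * X * I], and
    [I] can be simplified. *)
Lemma le_of_quadratic (be K1 K2 X I : R) : 0 < be -> 0 <= K1 -> 0 <= K2 -> 0 < X ->
  be * I ^+ 2 <= K1 * X * I + K2 * X ^+ 2 -> I <= (1 + (K1 + K2) / be) * X.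
Proof.
move=> be0 K10 K20 X0 H; rewrite leNgt; apply/negP => HI.
have q0 : 0 <= (K1 + K2) / be by rewrite divr_ge0 ?addr_ge0// ltW.
have XI : X < I.
  by apply: le_lt_trans HI; rewrite ler_peMl ?lerDl//; exact: ltW.
have I0 : 0 < I by exact: lt_trans XI.
have H1 : K2 * X ^+ 2 <= K2 * X * I.
  by rewrite expr2 mulrA ler_wpM2l ?mulr_ge0// ltW.
have : be * I * I <= (K1 + K2) * X * I by rewrite -mulrA -expr2; lra.
rewrite ler_pM2r// => H2.
have H3 : be * ((1 + (K1 + K2) / be) * X) = be * X + (K1 + K2) * X.
  by field; rewrite gt_eqF.
have : be * ((1 + (K1 + K2) / be) * X) < be * I by rewrite ltr_pM2l.
have : 0 < be * X by rewrite mulr_gt0.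
lra.
Qed.

End GainArithmetic.

Section Midpoint.
Context {R : realType}.
Local Notation mu := (@lebesgue_measure R).
Local Notation rd := right_derivative.

(** Integrate [f^2 >= 2 k |f| - k^2] with [k] the mean of [|f|]. *)
Lemma square_integral_ge (f : R -> R) (a b M : R) : a < b -> measurable_fun setT f ->
  (forall t, `|f t| <= M) ->
  (\int[mu]_(t in `[a, b]) `|f t|) ^+ 2 <=
  (b - a) * \int[mu]_(t in `[a, b]) f t ^+ 2.
Proof.
move=> ab mf fM; set I := \int[mu]_(t in _) _.
have ba0 : 0 < b - a by rewrite subr_gt0.
have If : locally_integrable setT f by exact: bounded_locint fM.
have If2 : locally_integrable setT (fun t => f t ^+ 2).
  apply: (@bounded_locint _ _ (M ^+ 2)); first exact: (measurable_funX 2 mf).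
  by move=> t; rewrite normrX lerXn2r// nnegrE (le_trans _ (fM 0)).
pose k := I / (b - a).
have : \int[mu]_(t in `[a, b]) (2 * k * `|f t| - k ^+ 2) <= \int[mu]_(t in `[a, b]) f t ^+ 2.
  apply: le_Rintegral_seg => //.
    by apply: locintB; [apply: locintZ; exact: locint_norm|exact: locint_cst].
  move=> t _; have := sqr_ge0 (`|f t| - k); rewrite sqrrB real_normK ?num_real//.
  by lra.
rewrite RintegralB_seg; [|by apply: locintZ; exact: locint_norm|exact: locint_cst].
rewrite RintegralZ_seg; last exact: locint_norm.
rewrite Rintegral_seg_cst ?(ltW ab)// -/I => H.
have E : (2 * k * I - k ^+ 2 * (b - a)) * (b - a) = I ^+ 2.
  by rewrite /k; field; rewrite gt_eqF.
by rewrite mulrC -E ler_pM2r.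
Qed.

Variables (S_ad : set (set (R * R))) (k1 k2 : R -> \bar R)
  (J Rfun Cfun : set (R * R) -> R) (r : (R -> R) -> R) (G : R * R * R -> R)
  (h0 : R -> R) (Om0 : set (R * R)) (B : R).
Hypotheses (k2_periodic : circle_periodic k2) (k2_lsc : lower_semicontinuous k2)
  (F_ad : forall h Om, W1inf h -> convex_support h -> is_Omega h Om ->
     (S_ad Om <-> between k1 k2 h))
  (h0_Om0 : is_Omega h0 Om0) (h0_gt0 : forall t, 0 < h0 t)
  (Om0_adm : S_ad Om0)
  (Om0_opt : forall Om, S_ad Om -> convex_domain Om -> J Om0 <= J Om)
  (J_sum : forall Om, J Om = Rfun Om + Cfun Om)
  (Rfun_r : forall h Om, W1inf h -> convex_support h -> is_Omega h Om ->
     between k1 k2 h -> Rfun Om = r h)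
  (Cfun_G : forall h Om, W1inf h -> convex_support h -> is_Omega h Om ->
     between k1 k2 h ->
     (Cfun Om)%:E = (\int[mu]_(t in period) (G (t, h t, wderiv h t))%:E)%E)
  (hB : support_like B h0).

(** The constant of [quadratic_gain] for the deviation [16 * B] of the slope
    of the chord ([chord_slope]) and the Lipschitz constant [C * (1 + 2 * B)]
    of [G_q] along the graph of [h0]. *)
Definition gain_error (C al : R) : R := (C * (16 * B)) ^+ 2 / (2 * al) +
  2 * (C * (1 + 2 * B)) ^+ 2 / al + al * (16 * B) ^+ 2 / 2.

(** The factor [4] is due to the second difference being twice a value at the
    middle of an arc of length [2 * s]; the term [8 * B] is the price of
    replacing a sinusoid by a straight line. *)
Definition midpoint_const (C al : R) : R :=
  4 * (1 + (1 + C + gain_error C al) / (al / 8)) + 8 * B.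

Lemma gain_error_ge0 C al : 0 <= C -> 0 < al -> 0 <= gain_error C al.
Proof.
move=> C0 /ltW al0; have B0 := slike_ge0 hB.
apply: addr_ge0; first (apply: addr_ge0; apply: divr_ge0).
- exact: sqr_ge0.
- exact: mulr_ge0.
- by rewrite mulr_ge0 ?sqr_ge0.
- exact: al0.
- by apply: divr_ge0 => //; rewrite mulr_ge0 ?sqr_ge0.
Qed.

(** Let [v] be the lift towards the chord point of the arc, [I] the integral
    of its derivative in absolute value and [Y] that of [|g| + 1]. The second
    difference is [2 v(c)] up to [O(s^2)], and [v <= I]. In [first_variation]
    the terms in [v] are then at most a multiple of [I Y], while the gain is
    at least a multiple of [I^2 / s] by [square_integral_ge]. Hence [I] is at
    most a multiple of [s Y]. *)
Lemma midpoint_estimate_chord (c s C al d : R) (Gq : R * R * R -> R) (g : R -> R)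
  (L : (R -> R) -> R) (a := c - s) (b := c + s) :
  0 < s -> s <= 1 / 2 -> (1 + 2 * B) * (2 * s) < d -> 0 <= c < 2 * pi ->
  `[a, b] `<=` strictly_between k1 k2 h0 ->
  jet_bounds G `[-1, 2 * pi + 1]%classic (range h0) (conv_derivatives h0) C al d Gq ->
  (forall u q, circle_periodic (fun t => G (t, u, q))) ->
  is_frechet_derivative r h0 L ->
  locally_integrable setT g -> circle_periodic g ->
  (forall v, W1inf v -> L v = \int[mu]_(t in period) (g t * v t)) ->
  h0 b + h0 a - 2 * h0 c <=
  midpoint_const C al * s * \int[mu]_(t in `[a, b]) (`|g t| + 1).
Proof.
move=> s0 s1 sd c_per abU jb G_periodic rL Ig g_periodic Lg.
have [C0 al0 _ _] := jb.
have B0 := slike_ge0 hB.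
set P := chord h0 a b; set v := lift h0 P.
pose S t := dot P (eitheta t).
have ab : a < b by rewrite /a /b; lra.
have baE : b - a = 2 * s by rewrite /a /b; ring.
have ba1 : b - a <= 1 by rewrite baE; lra.
have bad : (1 + 2 * B) * (b - a) < d by rewrite baE.
have [c0 c1] := andP c_per.
have abA : -1 <= a /\ b <= 2 * pi + 1.
  by rewrite /a /b; move: c1; move: pi => x *; split; lra.
have FV := first_variation k2_periodic k2_lsc F_ad h0_Om0 h0_gt0 Om0_adm Om0_opt
  J_sum Rfun_r Cfun_G hB ab ba1 bad abA abU jb G_periodic rL Lg.
rewrite -/(gain_error C al) in FV.
have aab : a <= a <= b by rewrite lexx ltW.
have acb : a <= c <= b by rewrite /a /b; apply/andP; split; lra.
have htrig a' b' t : a' <= t -> t <= b' -> b' - a' < pi ->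
    h0 t * sin (b' - a') <= h0 a' * sin (b' - t) + h0 b' * sin (t - a').
  by case: hB => _ _ _ _ [_]; apply.
have vin t : a <= t <= b -> v t = S t - h0 t.
  exact: (lift_chord_in hB ab ba1).
have vout t : b <= t <= a + 2 * pi -> v t = 0.
  exact: (lift_chord_out h0_gt0 hB ab ba1).
have [M []] := lift_regular P h0_Om0 hB.
rewrite -/v => vM rM _ _ pv.
have mrv : measurable_fun setT (rd v) by exact: (lift_rd_measurable P h0_Om0 hB).
have Irv : locally_integrable setT (rd v) by exact: (lift_rd_locint P h0_Om0 hB).
have cv : continuous v by exact: is_primitive_continuous pv.
have Iv : locally_integrable setT v by exact: continuous_locint.
have Igv : locally_integrable setT (fun t => g t * v t) by exact: locint_cM.
have va : v a = 0 by rewrite vin// /S chord_left subrr.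
pose I := \int[mu]_(t in `[a, b]) `|rd v t|.
pose Y := \int[mu]_(t in `[a, b]) (`|g t| + 1).
have In : locally_integrable setT (fun t => `|rd v t|) by exact: locint_norm.
have Ign : locally_integrable setT (fun t => `|g t|) by exact: locint_norm.
have vI t : a <= t <= b -> v t <= I.
  move=> /andP[at_ tb].
  have -> : v t = \int[mu]_(x in `[a, t]) rd v x by rewrite -(pv _ _ at_) va subr0.
  rewrite (le_trans (ler_norm _))// (le_trans (Rintegral_seg_norm _ _ Irv))//.
  exact: Rintegral_seg_subset.
have Y2 : 2 * s <= Y.
  rewrite -baE -[leLHS]mul1r -Rintegral_seg_cst ?(ltW ab)//.
  apply: le_Rintegral_seg; [exact: locint_cst|by apply: locintD => //; exact: locint_cst|].
  by move=> t _; rewrite lerDr.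
have YE : Y = \int[mu]_(t in `[a, b]) `|g t| + 2 * s.
  rewrite /Y RintegralD_seg//; last exact: locint_cst.
  by rewrite Rintegral_seg_cst ?(ltW ab)// mul1r baE.
have I0 : 0 <= I by apply: (le_trans _ (vI _ aab)); rewrite va.
have gE : \int[mu]_(t in period) (g t * v t) = \int[mu]_(t in `[a, b]) (g t * v t).
  have pgv : circle_periodic (fun t => g t * v t).
    have vper : circle_periodic v := lift_periodic P (slike_periodic hB).
    by move=> t; rewrite g_periodic vper.
  rewrite (Rintegral_period a pgv Igv); apply: Rintegral_support.
    have := @pi_ge2 R => p2 t; rewrite /= !in_itv/= => /andP[-> tb] /=.
    by move: tb s1 p2; move: pi => x; lra.
  move=> t; rewrite /= in_itv/= => /andP[at_ ta]; rewrite at_/= -ltNge => bt.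
  by rewrite vout ?mulr0// ta (ltW bt).
have G1 : \int[mu]_(t in `[a, b]) (g t * v t) <= I * \int[mu]_(t in `[a, b]) `|g t|.
  rewrite -RintegralZ_seg//; apply: le_Rintegral_seg => //; first exact: locintZ.
  move=> t tab; rewrite mulrC (@le_trans _ _ (v t * `|g t|))//.
    by rewrite ler_wpM2l ?lift_ge0// ler_norm.
  by rewrite ler_wpM2r// vI.
have G2 : \int[mu]_(t in `[a, b]) v t <= I * (2 * s).
  rewrite -baE -Rintegral_seg_cst ?(ltW ab)//.
  by apply: le_Rintegral_seg => //; exact: locint_cst.
have SQ := square_integral_ge ab mrv rM; rewrite -/I baE in SQ.
rewrite gE baE in FV.
have g0 := gain_error_ge0 C0 al0.
have s20 : 0 < 2 * s by rewrite mulr_gt0.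
have Y0 : 0 < Y by exact: lt_le_trans Y2.
have X0 : 0 < 2 * s * Y by rewrite mulr_gt0.
have al8 : 0 < al / 8 by rewrite divr_gt0.
have HI : I <= (1 + (1 + C + gain_error C al) / (al / 8)) * (2 * s * Y).
  apply: le_of_quadratic => //; first by rewrite addr_ge0.
  set i2 := \int[mu]_(t in _) rd v t ^+ 2 in SQ FV.
  set ig := \int[mu]_(t in _) (g t * v t) in G1 FV.
  set iv := \int[mu]_(t in _) v t in G2 FV.
  set ia := \int[mu]_(t in _) `|g t| in G1 YE.
  have ia0 : 0 <= ia by apply: Rintegral_ge0.
  have H1 : al / 8 * I ^+ 2 <= 2 * s * (al / 8 * i2).
    by rewrite [leRHS]mulrCA ler_pM2l.
  have H2 : al / 8 * i2 <= I * ia + C * (I * (2 * s)) + gain_error C al * (2 * s) ^+ 3.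
    have : C * iv <= C * (I * (2 * s)) by rewrite ler_wpM2l.
    lra.
  have H3 : I * ia + C * (I * (2 * s)) <= (1 + C) * Y * I.
    have -> : (1 + C) * Y * I = I * ia + C * (I * (2 * s)) + (I * (2 * s) + C * I * ia).
      by rewrite YE; ring.
    by rewrite lerDl addr_ge0// !mulr_ge0// ltW.
  have H4 : gain_error C al * (2 * s) ^+ 3 * (2 * s) <= gain_error C al * (2 * s * Y) ^+ 2.
    rewrite -mulrA ler_wpM2l//.
    have -> : (2 * s) ^+ 3 * (2 * s) = (2 * s * (2 * s)) ^+ 2 by ring.
    apply: lerXn2r; last by rewrite ler_pM2l.
      by rewrite nnegrE ltW// mulr_gt0.
    by rewrite nnegrE ltW.
  have H5 : 2 * s * (al / 8 * i2) <= 2 * s * ((1 + C) * Y * I + gain_error C al * (2 * s) ^+ 3).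
    by rewrite ler_pM2l//; lra.
  rewrite (le_trans H1)// (le_trans H5)// mulrDr.
  have -> : (1 + C) * (2 * s * Y) * I = 2 * s * ((1 + C) * Y * I) by ring.
  by rewrite lerD2l [leLHS]mulrC.
have [P1 P2] : `|P.1| <= 8 * B /\ `|P.2| <= 8 * B.
  apply: (chord_in_box B0 ab ba1 _ (slike_lip hB)); by case: hB.
have Sc : - S c <= 16 * B.
  have := dot_bound c P1 P2; rewrite ler_norml -/(S c) => /andP[+ _].
  by move: (S c) => z; lra.
have cosE : h0 b + h0 a = 2 * cos s * S c.
  rewrite -(chord_right h0 ab ba1) -[h0 a](chord_left h0 a b).
  by rewrite -/P /S /b /a !dotD cosN sinN; ring.
rewrite cosE.
have vc : S c = v c + h0 c by rewrite vin// subrK.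
have cos1 : 2 * (1 - cos s) <= s ^+ 2.
  by have := cos_ge_quadratic s; lra.
have cos0 : 0 <= 2 * (1 - cos s) by rewrite mulr_ge0// subr_ge0 cos_le1.
have H6 : 2 * cos s * S c - 2 * h0 c <= 2 * v c + s ^+ 2 * (16 * B).
  have -> : 2 * cos s * S c - 2 * h0 c = 2 * v c - 2 * (1 - cos s) * S c by rewrite vc; ring.
  rewrite lerD2l -mulrN.
  apply: (le_trans (ler_wpM2l cos0 Sc)); rewrite ler_wpM2r// mulr_ge0//.
rewrite (le_trans H6)// /midpoint_const -/Y.
have H7 : s ^+ 2 * (16 * B) <= 8 * B * s * Y.
  have -> : s ^+ 2 * (16 * B) = 8 * B * s * (2 * s) by ring.
  by rewrite ler_wpM2l// !mulr_ge0// ltW.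
have H8 := le_trans (vI c acb) HI.
move: H8; set K := 1 + _ / _ => H8.
have -> : (4 * K + 8 * B) * s * Y = 2 * (K * (2 * s * Y)) + 8 * B * s * Y by ring.
by apply: lerD => //; rewrite ler_pM2l.
Qed.

(** Second differences of the optimal support function are controlled by the
    derivative of [r]: this is the regularity of [h0] in integrated form. *)
Lemma midpoint_estimate (U : set (R * R * R)) g L : open U -> jet_hull h0 `<=` U ->
  C2_on U G -> (forall x, jet_hull h0 x ->
     0 < 'D_((0, 0, 1) : R * R * R) ('D_((0, 0, 1) : R * R * R) G) x) ->
  circle_periodic k1 -> (forall u q, circle_periodic (fun t => G (t, u, q))) ->
  is_frechet_derivative r h0 L -> locally_integrable setT g -> circle_periodic g ->
  (forall v, W1inf v -> L v = \int[mu]_(t in period) (g t * v t)) ->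
  exists K s0 : R, [/\ 0 <= K, 0 < s0 & forall c s, 0 < s <= s0 ->
    `[c - s, c + s] `<=` strictly_between k1 k2 h0 ->
    h0 (c + s) + h0 (c - s) - 2 * h0 c <=
    K * s * \int[mu]_(t in `[c - s, c + s]) (`|g t| + 1)].
Proof.
move=> oU hullU C2G Gqq k1_periodic G_periodic rL Ig g_periodic Lg.
have B0 := slike_ge0 hB.
have hcvg t := @slike_cvg _ _ _ hB t.
have [C [al [d [Gq jb]]]] : exists C al d Gq,
    jet_bounds G `[-1, 2 * pi + 1]%classic (range h0) (conv_derivatives h0) C al d Gq.
  apply: (@jet_estimates _ _ U) => //.
  - exact: segment_compact.
  - exact: periodic_range_compact (slike_periodic hB) (slike_continuous hB).
  - exact: conv_derivatives_compact (slike_lip hB).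
  - exact: conv_derivatives_interval.
  - by move=> x [[_ hx] qx]; apply: hullU; split.
  - by move=> x [[_ hx] qx]; apply: Gqq; split.
have [C0 al0 d0 _] := jb.
have B1 : 0 < 1 + 2 * B by rewrite ltr_wpDr// mulr_ge0.
(* The first bound on [s] makes arcs shorter than one, the second keeps the
   points [(t, h0 t)] along an arc within the distance [d] of each other. *)
exists (midpoint_const C al), (Num.min (1 / 2) (d / (1 + 2 * B) / 3)); split.
- apply: addr_ge0; last by rewrite mulr_ge0.
  apply: mulr_ge0 => //; apply: addr_ge0 => //; apply: divr_ge0.
    by apply: addr_ge0; [exact: addr_ge0|exact: gain_error_ge0].
  by rewrite divr_ge0// ltW.
- by rewrite lt_min !divr_gt0.
move=> c s /andP[s0]; rewrite le_min => /andP[s1 s2] cU.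
have sd : (1 + 2 * B) * (2 * s) < d.
  rewrite mulrC -ltr_pdivlMr//.
  have : 0 < d / (1 + 2 * B) by rewrite divr_gt0.
  move: s2; move: (d / _) => x; lra.
have [T0 cT pT] := period_reduction c.
pose c' := c - T0.
have cE : c = c' + T0 by rewrite subrK.
have E1 x (f : R -> R) : circle_periodic f -> f (c + x) = f (c' + x).
  by move=> pf; rewrite cE addrAC (pT _ _ pf).
have hp := slike_periodic hB.
have cU' : `[c' - s, c' + s] `<=` strictly_between k1 k2 h0.
  move=> t; rewrite /= in_itv/= => tc.
  have : strictly_between k1 k2 h0 (t + T0).
    apply: cU; rewrite /= in_itv/= cE; lra.
  by rewrite /strictly_between/= (pT _ _ k1_periodic) (pT _ _ k2_periodic) (pT _ _ hp).
have := midpoint_estimate_chord s0 s1 sd cT cU' jb G_periodic rL Ig g_periodic Lg.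
have E0 : h0 c = h0 c' by rewrite cE (pT _ _ hp).
rewrite (E1 s _ hp) (E1 (- s) _ hp) E0 -/c'.
move=> /le_trans; apply; rewrite le_eqVlt; apply/orP; left; apply/eqP; congr (_ * _).
have -> : c - s = c' - s + T0 by rewrite cE; ring.
have -> : c + s = c' + s + T0 by rewrite cE; ring.
rewrite -Rintegral_shift; last by apply: locintD; [exact: locint_norm|exact: locint_cst].
by apply: eq_Rintegral => t _; rewrite (pT _ _ g_periodic).
Qed.

End Midpoint.

(** * Functions in L^p of the circle *)

Section CircleLp.
Context {R : realType}.
Local Notation mu := (@lebesgue_measure R).
Implicit Types (f g : R -> R) (p : \bar R).

Definition wrap (t : R) : R := t - turns t.

Lemma wrap_period t : period (wrap t).
Proof. by rewrite /period /= in_itv/= turns_itv. Qed.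

Lemma periodic_wrap (V : Type) (f : R -> V) t : circle_periodic f -> f (wrap t) = f t.
Proof. by move=> pf; rewrite -(periodic_turns t (wrap t) pf) subrK. Qed.

Lemma measurable_wrap : measurable_fun setT wrap.
Proof.
apply: right_continuous_measurable => t.
have p0 := twopi_gt0 (R := R).
have := wrap_period t; rewrite /period /= in_itv/= => /andP[w0 w1].
apply/cvgrPdist_le => e e0; near=> s.
have ts : t < s by near: s; exact: nbhs_right_gt.
have st : s < t + (2 * pi - wrap t) by near: s; apply: nbhs_right_lt; rewrite ltrDl subr_gt0.
have se : s < t + e by near: s; apply: nbhs_right_lt; rewrite ltrDl.
suff fE : Num.floor (s / (2 * pi)) = Num.floor (t / (2 * pi)).
  rewrite /wrap /turns fE opprB addrA subrK.
  by rewrite distrC ger0_norm; lra.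
apply: Num.Theory.floor_def; rewrite ler_pdivlMr// ltr_pdivrMr// intrD.
move: w0 st; rewrite /wrap /turns; set k := _%:~R => w0 st; apply/andP; split; lra.
Unshelve. all: by end_near. Qed.

Lemma periodic_measurable f : circle_periodic f -> measurable_fun period f ->
  measurable_fun setT f.
Proof.
move=> pf mf.
have mp : measurable (@period R) by exact: measurable_itv.
have -> : f = (f \_ period) \o wrap.
  apply/funext => t /=; rewrite patchE ifT; first by rewrite periodic_wrap.
  by rewrite inE; exact: wrap_period.
apply: measurableT_comp; last exact: measurable_wrap.
by apply/(measurable_restrictT f mp).
Qed.

Lemma periodic_locint f : circle_periodic f ->
  mu.-integrable period (EFin \o f) -> locally_integrable setT f.
Proof.
move=> pf If.
have p0 := twopi_gt0 (R := R).
have mf : measurable_fun setT f.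
  by apply: periodic_measurable => //; have /integrableP[/measurable_EFinP] := If.
pose g : R -> \bar R := fun x => `|f x|%:E.
have mg : measurable_fun setT g by exact/measurable_EFinP/measurableT_comp.
have g0 x : (0 <= g x)%E by rewrite lee_fin.
have I1 : (\int[mu]_(x in `[0%R, (2 * pi)%R]) g x < +oo)%E.
  have /integrableP[_] := If; rewrite /period integral_itv_bndo_bndc//.
  exact: measurable_funTS.
have step (n : nat) : (\int[mu]_(x in `[(2 * pi *- n)%R, (2 * pi *+ n)%R]) g x < +oo)%E.
  elim: n => [|n IH]; first by rewrite mulr0n oppr0 set_itv1 integral_set1.
  have shift (s : R) : (forall x, f (x + s) = f x) ->
      (\int[mu]_(x in `[s, (2 * pi + s)%R]) g x < +oo)%E.
    move=> fs; rewrite -[X in `[X, _]]add0r -ge0_integral_shift//.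
    by under eq_integral do rewrite /g fs.
  have A1 := shift (2 * pi *+ n) (circle_periodicZ pf n).
  have A2 : (\int[mu]_(x in `[(2 * pi *- n.+1)%R, (2 * pi *- n)%R]) g x < +oo)%E.
    have := shift (2 * pi *- n.+1); rewrite mulrSr opprD addrCA subrr addr0 -opprD -mulrSr; apply.
    by move=> x; rewrite -(circle_periodicZ pf n.+1) subrK.
  have leU (A D : set R) : measurable A -> measurable D ->
      (\int[mu]_(x in A `|` D) g x <= \int[mu]_(x in A) g x + \int[mu]_(x in D) g x)%E.
    move=> mA mD; have -> : A `|` D = A `|` (D `\` A).
      apply/seteqP; split=> x [Ax|]; try by left.
        by move=> Dx; have [Ax|nAx] := pselect (A x); [left|right].
      by move=> [Dx _]; right.
    rewrite ge0_integral_setU//.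
    - rewrite leeD2l//; apply: ge0_subset_integral => //.
      + exact: measurableD.
      + exact: measurable_funTS.
    - exact: measurableD.
    - exact: measurable_funTS.
    - by apply/disj_setPS => x [Ax []].
  pose A : set R := `[(2 * pi *- n.+1)%R, (2 * pi *- n)%R]%classic.
  pose D : set R := `[(2 * pi *- n)%R, (2 * pi *+ n)%R]%classic.
  pose E : set R := `[(2 * pi *+ n)%R, (2 * pi + 2 * pi *+ n)%R]%classic.
  have mA : measurable A by exact: measurable_itv.
  have mD : measurable D by exact: measurable_itv.
  have mE : measurable E by exact: measurable_itv.
  apply: (@le_lt_trans _ _ (\int[mu]_(x in (A `|` D) `|` E) g x)%E).
    apply: ge0_subset_integral => //.
    - by apply: measurableU => //; exact: measurableU.
    - exact: measurable_funTS.
    - move=> x; rewrite /setU/A/D/E/= !in_itv/= -mulrS => /andP[-> ->]; rewrite andbT.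
      case: (leP x (2 * pi *+ n)) => [xn|/ltW]; last by right.
      by case: (leP x (2 * pi *- n)) => [|/ltW xn']; left; [left|right; rewrite xn'].
  apply: le_lt_trans (leU _ _ _ _) _ => //; first exact: measurableU.
  rewrite lte_add_pinfty//.
  apply: le_lt_trans (leU _ _ _ _) _ => //.
  by rewrite lte_add_pinfty.
apply: locintP => // n; apply/integrableP; split.
  by apply/measurable_EFinP; exact: measurable_funTS.
apply: le_lt_trans (step n); apply: ge0_subset_integral => //.
  exact: measurable_funTS.
move=> x; rewrite /= !in_itv/= => /andP[x1 x2].
have : n%:R <= 2 * pi *+ n :> R.
  by rewrite lerMn2r; apply/orP; right; have := @pi_ge2 R; lra.
by move=> H; rewrite (le_trans _ x1) ?lerN2// (le_trans x2).
Qed.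

Lemma finite_norm_power (q : R) f : 0 < q -> finite_norm mu q%:E f ->
  (\int[mu]_x (`|f x| `^ q)%:E < +oo)%E.
Proof.
rewrite /finite_norm unlock => q0 ff.
have := poweR_lty q ff.
rewrite -poweRrM mulVf ?gt_eqF// poweRe1//.
by apply: integral_ge0 => x _; exact: poweR_ge0.
Qed.

(** On a period, which has finite measure, [|g| <= 1 + |g|^q]. *)
Lemma Lp_locint p g : (1 <= p)%E -> Lp_circle p setT g -> locally_integrable setT g.
Proof.
move=> p1 [pg]; rewrite setTI => mg fg.
have mp : measurable (@period R) by exact: measurable_itv.
have fin : (mu (@period R) < +oo)%E.
  by rewrite /period lebesgue_measure_itv/= lte_fin twopi_gt0 ltry.
have mgT : measurable_fun setT (g \_ period) by apply/(measurable_restrictT g mp).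
apply: periodic_locint => //; apply/integrableP; split; first exact/measurable_EFinP.
have cstI (M : R) : 0 <= M -> (\int[mu]_(x in period) M%:E < +oo)%E.
  by move=> M0; rewrite integral_cst// lte_mul_pinfty.
case: p p1 fg => [q| |]// p1 fg; last first.
  have [M HM] := finite_norm_oo_bound fg.
  apply: le_lt_trans (cstI `|M| (normr_ge0 _)); apply: ae_ge0_le_integral => //.
  - by apply: measurableT_comp => //; exact/measurable_EFinP.
  - by apply: ae_imply HM => x; rewrite patchE => gM px; move: gM;
      rewrite ifT ?inE//= lee_fin => /le_trans; apply; exact: ler_norm.
have q0 : 0 < q by rewrite -lte_fin (lt_le_trans _ p1).
have q1 : 1 <= q by rewrite -lee_fin.
pose u : R -> R := fun x => `|(g \_ period) x| `^ q.
have mu_ : measurable_fun setT u.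
  apply: (measurableT_comp (measurable_powR q)).
  exact: measurableT_comp mgT.
have u0 x : (0 <= (u x)%:E)%E by rewrite lee_fin powR_ge0.
have I : (\int[mu]_x (u x)%:E < +oo)%E by exact: finite_norm_power fg.
apply: (@le_lt_trans _ _ (\int[mu]_(x in period) (1%:E + (u x)%:E))%E).
  apply: ge0_le_integral => //.
  - by apply: measurableT_comp => //; exact/measurable_EFinP.
  - by apply: emeasurable_funD => //; apply: measurable_funTS; exact/measurable_EFinP.
  - move=> x px; rewrite /= -EFinD lee_fin /u patchE ifT ?inE//.
    have [g1|/ltW g1] := leP `|g x| 1; first by rewrite (le_trans g1)// lerDl powR_ge0.
    by rewrite -[leLHS]powRr1// (le_trans (ler_powR g1 q1))// lerDr.
rewrite ge0_integralD//; last by apply: measurable_funTS; exact/measurable_EFinP.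
rewrite lte_add_pinfty//; first exact: cstI.
apply: le_lt_trans I; apply: ge0_subset_integral => //.
exact/measurable_EFinP.
Qed.

(** For finite exponents, [(|g| + 1)^q <= 2^q (|g|^q + 1)]. *)
Lemma Lp_circle_dominated p (f g : R -> R) (C : R) U : measurable U -> (1 <= p)%E -> 0 <= C ->
  circle_periodic f -> measurable_fun setT f -> Lp_circle p setT g ->
  (forall x, `|f x| <= C * (`|g x| + 1)) -> Lp_circle p U f.
Proof.
move=> mU p1 C0 pf mf [_]; rewrite setTI => mg fg fC.
have mp : measurable (@period R) by exact: measurable_itv.
have mUp : measurable (U `&` period) by exact: measurableI.
split => //; first exact: measurable_funTS.
have mgT : measurable_fun setT (g \_ period) by apply/(measurable_restrictT g mp).
have mfT : measurable_fun setT (f \_ (U `&` period)) by apply/(measurable_restrictT f mUp); exact: measurable_funTS.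
case: p p1 fg => [q| |]// p1 fg; last first.
  have [M HM] := finite_norm_oo_bound fg.
  rewrite /finite_norm (@le_lt_trans _ _ (C * (`|M| + 1))%:E) ?ltry//.
  apply: Lnorm_oo_le; first by rewrite mulr_ge0// addr_ge0.
  apply: ae_imply HM => x; rewrite !patchE => gM.
  case: ifPn => [/set_mem[_ px]|_]; last by rewrite normr0 mulr_ge0// addr_ge0.
  rewrite (le_trans (fC x))// ler_wpM2l// lerD2r.
  by move: gM; rewrite mem_set// => /le_trans; apply; exact: ler_norm.
have q0 : 0 < q by rewrite -lte_fin (lt_le_trans _ p1).
pose u : R -> R := fun x => `|(g \_ period) x| `^ q.
have mu_ : measurable_fun setT u.
  apply: (measurableT_comp (measurable_powR q)).
  exact: measurableT_comp mgT.
have u0 x : (0 <= (u x)%:E)%E by rewrite lee_fin powR_ge0.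
have I : (\int[mu]_x (u x)%:E < +oo)%E by exact: finite_norm_power fg.
rewrite /finite_norm unlock; apply: poweR_lty.
pose c := (2 * C) `^ q.
have c0 : 0 <= c by exact: powR_ge0.
have fin : (mu (@period R) < +oo)%E.
  by rewrite /period lebesgue_measure_itv/= lte_fin twopi_gt0 ltry.
pose k : R -> \bar R := fun x => (c * (u x + \1_period x))%:E.
have mk : measurable_fun setT k.
  apply/measurable_EFinP; apply: measurable_funM => //.
  by apply: measurable_funD => //; apply: measurable_indic.
apply: (@le_lt_trans _ _ (\int[mu]_x k x)%E).
  apply: ge0_le_integral => //.
  - by move=> x _; exact: poweR_ge0.
  - apply: (measurableT_comp (measurable_poweR q)).
    by apply: measurableT_comp => //; exact/measurable_EFinP.
  - move=> x _; rewrite -[leLHS]/((`|(f \_ (U `&` period)) x| `^ q)%:E) lee_fin /u !patchE indicE.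
    case: ifPn => [/set_mem[_ px]|_]; last first.
      by rewrite normr0 powR0 ?gt_eqF// mulr_ge0// addr_ge0// powR_ge0.
    rewrite (mem_set px).
    have a0 := normr_ge0 (g x); move: (`|g x|) a0 (fC x) => a a0 fa.
    have H : `|f x| <= 2 * C * Num.max a 1.
      have -> : 2 * C * Num.max a 1 = C * (2 * Num.max a 1) by ring.
      rewrite (le_trans fa)// ler_wpM2l//.
      have : a <= Num.max a 1 by rewrite le_max lexx.
      have : 1 <= Num.max a 1 by rewrite le_max lexx orbT.
      lra.
    have m0 : 0 <= Num.max a 1 by rewrite le_max a0.
    rewrite (le_trans (ge0_ler_powR (ltW q0) _ _ H))// ?nnegrE ?mulr_ge0//.
    rewrite powRM ?mulr_ge0// -/c ler_wpM2l//.
    have [a1|a1] := leP a 1; first by rewrite powR1 lerDr powR_ge0.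
    by rewrite lerDl.
under eq_integral do rewrite /k EFinM.
rewrite ge0_integralZl//.
- apply: lte_mul_pinfty => //.
  under eq_integral do rewrite EFinD.
  rewrite ge0_integralD//.
  + rewrite lte_add_pinfty//.
    by rewrite integral_indic// setIT.
  + exact/measurable_EFinP.
  + by apply/measurable_EFinP; apply: measurable_indic.
- by apply/measurable_EFinP; apply: measurable_funD => //; apply: measurable_indic.
- by move=> x _; rewrite lee_fin addr_ge0// powR_ge0.
Qed.

End CircleLp.

(** * Densities of increasing functions *)

Section IncrementDensity.
Context {R : realType}.
Local Notation mu := (@lebesgue_measure R).
Variables (F w : R -> R).
Hypotheses (F_nd : {homo F : x y / x <= y}) (F_rc : forall x, F y @[y --> x^'+] --> F x)
  (w_ge0 : forall x, 0 <= w x) (Iw : mu.-integrable setT (EFin \o w))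
  (Fw : forall c d, c <= d -> F d - F c <= \int[mu]_(x in `[c, d]) w x).

Let Lw : locally_integrable setT w.
Proof.
apply: locintP => [|n]; first by have /integrableP[/measurable_EFinP] := Iw.
exact: (integrableS measurableT).
Qed.

Let V (x : R) : R := if 0 <= x then \int[mu]_(t in `[0, x]) w t
                     else - \int[mu]_(t in `[x, 0]) w t.

Let V_primitive : is_primitive V w. Proof. exact: is_primitive_integral. Qed.

Let V_nd : {homo V : x y / x <= y}.
Proof.
move=> x y xy; rewrite -subr_ge0 V_primitive//.
exact: Rintegral_ge0.
Qed.

Let V_rc (x : R) : V y @[y --> x^'+] --> V x.
Proof. exact/cvg_at_right_filter/(is_primitive_continuous Lw V_primitive). Qed.

Let D x := V x - F x.

Let D_nd : {homo D : x y / x <= y}.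
Proof. by move=> x y xy; have := Fw xy; rewrite -V_primitive// /D; lra. Qed.

Let D_rc (x : R) : D y @[y --> x^'+] --> D x.
Proof. exact: cvgB. Qed.

HB.instance Definition _ := isCumulative.Build R _ R F F_nd F_rc.
HB.instance Definition _ := isCumulative.Build R _ R V V_nd V_rc.
HB.instance Definition _ := isCumulative.Build R _ R D D_nd D_rc.

Let T := measurableTypeR R.

Let dens (A : set T) : \bar R := (\int[mu]_(t in A) (w t)%:E)%E.

Let dens0 : dens set0 = 0%E. Proof. by rewrite /dens integral_set0. Qed.
Let dens_ge0 A : (0 <= dens A)%E.
Proof. by apply: integral_ge0 => t _; rewrite lee_fin. Qed.
Let dens_sigma : semi_sigma_additive dens.
Proof.
apply: (@semi_sigma_additive_nng_induced _ _ R mu (EFin \o w)).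
  by have /integrableP[] := Iw.
by move=> x; rewrite lee_fin.
Qed.
HB.instance Definition _ := isMeasure.Build _ T R dens dens0 dens_ge0 dens_sigma.

Local Notation LS f := (lebesgue_stieltjes_measure f).

Let LS_itv (f : cumulative R R) (a b : R) : a <= b ->
  LS f `]a, b]%classic = (f b - f a)%:E.
Proof.
move=> ab; rewrite /lebesgue_stieltjes_measure/= /measure_extension measurable_mu_extE//; last exact: is_ocitv.
exact: wlength_itv_bnd.
Qed.

Let LS_itv0 (f : cumulative R R) (a b : R) : b < a ->
  LS f `]a, b]%classic = 0%E.
Proof. by move=> ba; rewrite set_itv_ge ?measure0// bnd_simp -leNgt ltW. Qed.

(** By [Fw] the difference [D = V - F] is nondecreasing, so that its Stieltjes
    measure is nonnegative and the one of [F] is at most the one of [V]. *)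
Let LS_add (A : set T) : measurable A -> (LS V A = LS F A + LS D A)%E.
Proof.
move=> mA.
have -> : (LS F A + LS D A = measure_add (LS F) (LS D) A)%E by rewrite measure_addE.
apply: lebesgue_stieltjes_measure_unique => // _ [[a b] _ <-].
rewrite [RHS](_ : _ = (LS F `]a, b]%classic + LS D `]a, b]%classic)%E); last exact: measure_addE.
rewrite /=; have [ab|ba] := leP a b.
  rewrite !LS_itv//.
  transitivity ((F b - F a) + ((V b - F b) - (V a - F a)))%:E; last by [].
  have E : V b - V a = (F b - F a) + ((V b - F b) - (V a - F a)).
    by move: (V a) (V b) => va vb; ring.
  exact: (congr1 EFin E).
by rewrite !LS_itv0// adde0.
Qed.

Let LS_dens (A : set T) : measurable A -> LS V A = dens A.
Proof.
move=> mA; apply: lebesgue_stieltjes_measure_unique => // _ [[a b] _ <-] /=.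
have [ab|ba] := leP a b; last by rewrite LS_itv0// set_itv_ge ?measure0// bnd_simp -leNgt ltW.
rewrite LS_itv// V_primitive// /dens integral_itv_obnd_cbnd; last first.
  by apply: measurable_funTS; have /integrableP[] := Iw.
by rewrite fineK//; apply: integrable_fin_num => //; exact: locint_seg.
Qed.

Let LS_le (A : set T) : measurable A -> (LS F A <= dens A)%E.
Proof. by move=> mA; rewrite -LS_dens// LS_add// leeDl. Qed.

Let LS_fin : fin_num_fun (LS F).
Proof.
move=> A mA; rewrite ge0_fin_numE//; apply: le_lt_trans (LS_le mA) _.
have : dens A \is a fin_num.
  by apply: integrable_fin_num => //; exact: (integrableS measurableT).
by rewrite ge0_fin_numE.
Qed.

Let nu : set T -> \bar R := LS F.
HB.instance Definition _ := Measure.on nu.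
HB.instance Definition _ := Measure_isFinite.Build _ T R nu LS_fin.

(** The Stieltjes measure of [F] is at most the measure of density [w], hence
    absolutely continuous: the Radon-Nikodym theorem applies. *)
Lemma increment_density : exists rho, [/\ mu.-integrable setT (EFin \o rho),
  locally_integrable setT rho & is_primitive F rho].
Proof.
have dom : nu `<< mu.
  apply/null_content_dominatesP => A mA A0; apply/eqP; rewrite eq_le measure_ge0 andbT.
  rewrite (le_trans (LS_le mA))// /dens null_set_integral//.
  by have /integrableP[mw _] := Iw; exact: measurable_funTS.
have [f [f0 ffin If fE]] := radon_nikodym_sigma_finite dom.
have fK : f = EFin \o (fine \o f) by apply/funext => x /=; rewrite fineK.
have Irho : mu.-integrable setT (EFin \o (fine \o f)) by rewrite -fK.
have Lrho : locally_integrable setT (fine \o f).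
  apply: locintP => [|n]; first by have /integrableP[/measurable_EFinP] := Irho.
  exact: (integrableS measurableT).
exists (fine \o f); split => // a b ab.
apply: EFin_inj; rewrite -LS_itv// -/nu fE; last exact: measurable_itv.
rewrite integral_itv_obnd_cbnd; last first.
  by apply: measurable_funTS; have /integrableP[] := If.
rewrite /Rintegral fineK; first by apply: eq_integral => x _; rewrite /= fineK.
by apply: integrable_fin_num => //; exact: locint_seg.
Qed.

End IncrementDensity.

(** * From second differences to a weak second derivative *)

Section SecondDerivative.
Context {R : realType}.
Local Notation mu := (@lebesgue_measure R).
Variables (h w : R -> R) (B K s0 : R) (U : set R).
Hypotheses (hB : support_like B h) (Lw : locally_integrable setT w)
  (w_ge0 : forall x, 0 <= w x) (oU : open U) (K0 : 0 <= K) (s00 : 0 < s0)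
  (mid : forall c s, 0 < s <= s0 -> `[c - s, c + s] `<=` U ->
    h (c + s) + h (c - s) - 2 * h c <= K * s * \int[mu]_(t in `[c - s, c + s]) w t).

Local Notation f1 := (right_derivative h).
Local Notation int a b := (\int[mu]_(t in `[a, b]) w t).

Let B0 := slike_ge0 hB.

(** Telescoping: consecutive increments of step [s] differ by a second
    difference, and the arcs of these second differences cover each point at
    most twice. *)
Lemma second_difference_sum (n : nat) c s : 0 < s <= s0 -> `[c, c + n.+1%:R * s] `<=` U ->
  (h (c + n.+1%:R * s) - h (c + n%:R * s)) - (h (c + s) - h c) <=
  K * s * (int c (c + n%:R * s) + int (c + s) (c + n.+1%:R * s)).
Proof.
move=> /[dup] s0s /andP[s_gt0 _]; have sge0 := ltW s_gt0.
have seg0 x : int x x = 0 by rewrite set_itv1 Rintegral_set1.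
elim: n => [|n IH] cU.
  by rewrite !mul0r !addr0 !mul1r subrr !seg0 addr0 mulr0.
have E1 : n.+2%:R * s = n.+1%:R * s + s by rewrite -[in LHS]natr1 mulrDl mul1r.
have E2 : n.+1%:R * s = n%:R * s + s by rewrite -[in LHS]natr1 mulrDl mul1r.
have ns0 : 0 <= n%:R * s by rewrite mulr_ge0.
have {}IH := IH _.
have cU1 : `[c, c + n.+1%:R * s] `<=` U.
  move=> x; rewrite /= in_itv/= => /andP[cx xc]; apply: cU.
  by rewrite /= in_itv/= cx E1; lra.
have {}IH := IH cU1.
pose c' := c + n.+1%:R * s.
have c'U : `[c' - s, c' + s] `<=` U.
  move=> x; rewrite /= in_itv/= => /andP[cx xc]; apply: cU.
  by rewrite /= in_itv/= E1 E2; move: cx xc; rewrite /c' E2 => cx xc; apply/andP; split; lra.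
have := mid s0s c'U.
have -> : c' - s = c + n%:R * s by rewrite /c' E2; ring.
have -> : c' + s = c + n.+2%:R * s by rewrite /c' E1; ring.
rewrite -/c' (@Rintegral_chasles _ w (c + n%:R * s) c'); [|exact: Lw|rewrite /c' E2; lra|rewrite E1 /c'; lra].
rewrite (@Rintegral_chasles _ w c (c + n%:R * s) c'); [|exact: Lw|lra|rewrite /c' E2; lra].
rewrite (@Rintegral_chasles _ w (c + s) c' (c + n.+2%:R * s)); [|exact: Lw|rewrite /c' E2; lra|rewrite E1 /c'; lra].
move: IH; rewrite -/c' => IH M.
rewrite !mulrDr in IH M *; lra.
Qed.

(** Cut [[c, d]] into [n + 1] equal steps. As [n] grows, the difference
    quotients over the steps that start at [c] and at [d] tend to the right
    derivatives. *)
Lemma right_derivative_increment c d : c < d -> `[c, d] `<=` U ->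
  f1 d - f1 c <= 2 * K * int c d.
Proof.
move=> cd cdU.
have dc0 : 0 < d - c by rewrite subr_gt0.
have Ud : U d by apply: cdU; rewrite /= in_itv/= ltW//=.
have [e /= e0 He] : exists2 e : R, 0 < e & forall x, d <= x -> x <= d + e -> U x.
  have /nbhs_ballP[e /= e0 He] := open_nbhs_nbhs (conj oU Ud).
  exists (e / 2); first by rewrite divr_gt0.
  move=> x dx xe; apply: He; rewrite -ball_normE/= ler0_norm; lra.
pose s (n : nat) : R := (d - c) / n.+1%:R.
have s_gt0 n : 0 < s n by rewrite divr_gt0.
have s_cvg : s n @[n --> \oo] --> (0 : R).
  rewrite -[X in _ --> X](mulr0 (d - c)); apply: cvgM; first exact: cvg_cst.
  exact: cvg_harmonic.
have q_cvg t : quotient h t (s n) @[n --> \oo] --> f1 t.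
  have /cvg_at_rightP := @slike_cvg _ _ _ hB t; apply; split => //.
have L : quotient h d (s n) - quotient h c (s n) @[n --> \oo] --> f1 d - f1 c.
  by apply: cvgB; exact: q_cvg.
have [V pV] : exists V, is_primitive V w by eexists; exact: is_primitive_integral Lw.
have cV := is_primitive_continuous Lw pV.
have Rr : 2 * K * (V (d + s n) - V c) @[n --> \oo] --> 2 * K * (V d - V c).
  apply: cvgM; first exact: cvg_cst.
  apply: cvgB; last exact: cvg_cst.
  apply: (@cvg_comp _ _ _ (fun n => d + s n) V); last exact: cV.
  have : d + s n @[n --> \oo] --> d + 0 by apply: cvgD => //; exact: cvg_cst.
  by rewrite addr0.
rewrite -(pV _ _ (ltW cd)); apply: (ler_cvg_to L Rr).
have m0 : 0 < Num.min s0 e by rewrite lt_min s00.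
near=> n.
have sn0 := s_gt0 n.
have se : s n <= Num.min s0 e.
  have : `|s n| <= Num.min s0 e.
    by near: n; have /cvgr0Pnorm_le := s_cvg; apply.
  by rewrite gtr0_norm.
move: se; rewrite le_min => /andP[ss0 se].
have nsE : c + n.+1%:R * s n = d.
  by rewrite /s mulrCA mulfV// mulr1 subrKC.
have nsE' : c + n.+2%:R * s n = d + s n.
  by rewrite -nsE -[n.+2%:R]natr1 mulrDl mul1r addrA.
have := @second_difference_sum n.+1 c (s n).
rewrite sn0 ss0 nsE nsE' => /(_ isT) H.
have {}H := H _.
have cU : `[c, d + s n] `<=` U.
  move=> x; rewrite /= in_itv/= => /andP[cx xd].
  have [dx|xd'] := leP d x; first by apply: He => //; lra.
  by apply: cdU; rewrite /= in_itv/= cx ltW.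
have {}H := H cU.
have i1 : int c d <= int c (d + s n) by apply: Rintegral_seg_subset => //; lra.
have i2 : int (c + s n) (d + s n) <= int c (d + s n) by apply: Rintegral_seg_subset => //; lra.
have i3 : int c (d + s n) = V (d + s n) - V c by rewrite pV//; lra.
rewrite i3 in i1 i2.
have Ks : 0 <= K * s n by rewrite mulr_ge0// ltW.
have H2 : (h (d + s n) - h d) - (h (c + s n) - h c) <= s n * (2 * K * (V (d + s n) - V c)).
  apply: (le_trans H).
  apply: (le_trans (ler_wpM2l Ks (lerD i1 i2))).
  by rewrite le_eqVlt; apply/orP; left; apply/eqP; ring.
rewrite -(ler_pM2l sn0); apply: le_trans H2.
rewrite le_eqVlt; apply/orP; left; apply/eqP.
by rewrite /quotient; field; rewrite gt_eqF.
Unshelve. all: by end_near. Qed.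

(** Dominates the derivative of [f1] on both sides: the bound on second
    differences from above, semiconvexity from below. *)
Definition increment_bound (x : R) : R := 2 * K * w x + 4 * B.

Let W := increment_bound.

Lemma increment_bound_ge0 x : 0 <= W x.
Proof. by rewrite addr_ge0// ?mulr_ge0. Qed.

Lemma increment_bound_locint : locally_integrable setT W.
Proof. by apply: locintD; [exact: locintZ|exact: locint_cst]. Qed.

Let F x := f1 x + 4 * B * x.

Let F_nd c d : c <= d -> F c <= F d.
Proof.
apply: right_derivative_mono; [|exact: (slike_lip hB)|exact: (slike_semiconvex hB)].
by rewrite mulr_ge0.
Qed.

Let F_increment c d : c <= d -> `[c, d] `<=` U -> F d - F c <= \int[mu]_(t in `[c, d]) W t.
Proof.
rewrite le_eqVlt => /predU1P[->|cd] cdU.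
  by rewrite subrr set_itv1 Rintegral_set1.
rewrite RintegralD_seg; [|exact: locintZ|exact: locint_cst].
rewrite RintegralZ_seg// Rintegral_seg_cst; last exact: ltW.
have := right_derivative_increment cd cdU; rewrite /F; lra.
Qed.

(** Clamping the argument to [[al, be]] turns the bound on increments inside
    [U] into one on all increments, so that [increment_density] applies. *)
Lemma local_density al be : al < be -> `[al, be] `<=` U ->
  exists2 rho, locally_integrable setT rho &
  forall c d, al <= c -> c <= d -> d <= be -> f1 d - f1 c = \int[mu]_(t in `[c, d]) rho t.
Proof.
move=> ab abU.
pose cl (x : R) := Num.min (Num.max x al) be.
have cl_in x : al <= cl x <= be.
  by rewrite /cl le_min le_max lexx orbT ge_min lexx orbT (ltW ab).
have cl_nd : {homo cl : x y / x <= y}.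
  move=> x y xy; rewrite /cl le_min !ge_min !ge_max lexx !orbT andbT.
  by rewrite !le_max xy lexx !orbT.
have cl_id x : al <= x <= be -> cl x = x.
  by move=> /andP[ax xb]; rewrite /cl (max_idPl ax) (min_idPl xb).
have cl_lo x : x <= al -> cl x = al.
  by move=> xa; rewrite /cl (max_idPr xa) (min_idPl (ltW ab)).
have cl_hi x : be <= x -> cl x = be.
  by move=> bx; rewrite /cl (min_idPr _)// le_max bx.
have F_rc x : F y @[y --> x^'+] --> F x.
  apply: cvgD; first exact: (slike_rd_rcont hB).
  by apply: cvgM; [exact: cvg_cst|exact/cvg_at_right_filter/cvg_id].
have Fc_rc x : F (cl y) @[y --> x^'+] --> F (cl x).
  have [xa|ax] := ltP x al.
    rewrite (cl_lo x (ltW xa)); apply: cvg_near_cst; near=> y.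
    by rewrite cl_lo//; near: y; exact: nbhs_right_le.
  have [xb|bx] := ltP x be.
    rewrite (cl_id x) ?ax ?ltW//; apply: cvg_trans (F_rc x).
    apply: near_eq_cvg; near=> y; rewrite cl_id//; apply/andP; split.
      by apply: (le_trans ax); near: y; exact: nbhs_right_ge.
    by near: y; exact: nbhs_right_le.
  rewrite (cl_hi x bx); apply: cvg_near_cst; near=> y.
  by rewrite cl_hi//; apply: (le_trans bx); near: y; exact: nbhs_right_ge.
pose w' := W \_ `[al, be].
have Iw' : mu.-integrable setT (EFin \o w').
  exact: integrable_seg_restrict increment_bound_locint.
have w'0 x : 0 <= w' x.
  by rewrite /w' patchE; case: ifP => // _; exact: increment_bound_ge0.
have Lw' : locally_integrable setT w'.
  apply: locintP => [|n]; first by have /integrableP[/measurable_EFinP] := Iw'.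
  exact: (integrableS measurableT).
have Fw' c d : c <= d -> F (cl d) - F (cl c) <= \int[mu]_(x in `[c, d]) w' x.
  move=> cd; have ccd := cl_nd _ _ cd.
  have /andP[c1 c2] := cl_in c; have /andP[d1 d2] := cl_in d.
  have [dal|ald] := leP d al.
    rewrite (cl_lo d dal) (cl_lo c (le_trans cd dal)) subrr.
    exact: Rintegral_ge0.
  have [bec|cbe] := leP be c.
    rewrite (cl_hi c bec) (cl_hi d (le_trans bec cd)) subrr.
    exact: Rintegral_ge0.
  have ccl : c <= cl c by rewrite /cl le_min le_max lexx/= ltW.
  have cld : cl d <= d by rewrite /cl ge_min ge_max lexx (ltW ald).
  apply: le_trans (Rintegral_seg_subset Lw' w'0 ccl cld).
  apply: le_trans (F_increment ccd _) _.
    move=> x; rewrite /= in_itv/= => /andP[x1 x2]; apply: abU.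
    by rewrite /= in_itv/= (le_trans c1)//= (le_trans x2).
  rewrite le_eqVlt; apply/orP; left; apply/eqP.
  apply: eq_Rintegral => x; rewrite inE/= in_itv/= => /andP[x1 x2].
  by rewrite /w' patchE ifT// inE/= in_itv/= (le_trans c1)//= (le_trans x2).
have Fc_nd : {homo (F \o cl) : x y / x <= y} by move=> x y xy; exact/F_nd/cl_nd.
have [rho [_ Lrho prho]] := increment_density Fc_nd Fc_rc w'0 Iw' Fw'.
exists (fun x => rho x - 4 * B); first by apply: locintB => //; exact: locint_cst.
move=> c d ac cd db.
rewrite RintegralB_seg//; last exact: locint_cst.
rewrite -(prho _ _ cd) Rintegral_seg_cst//= !cl_id; last 2 first.
- by rewrite ac (le_trans cd).
- by rewrite (le_trans ac).
by rewrite /F; ring.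
Unshelve. all: by end_near. Qed.

(** The limit of the difference quotients, cut off outside [U] and where it is
    not controlled by [W]; inside [U] this only concerns a null set. *)
Definition second_derivative (x : R) : R :=
  let l := fine (limn_esup (fun n => (quotient f1 x n.+2%:R^-1)%:E)) in
  if (`|l| <= W x) && (x \in U) then l else 0.

Local Notation f2 := second_derivative.

Lemma second_derivative_bound x : `|f2 x| <= W x.
Proof.
rewrite /second_derivative; case: ifP => [/andP[]//|_].
by rewrite normr0 increment_bound_ge0.
Qed.

Lemma second_derivative_measurable : measurable_fun setT f2.
Proof.
pose l x := fine (limn_esup (fun n => (quotient f1 x n.+2%:R^-1)%:E)).
have mf1 := slike_rd_measurable hB.
have ml : measurable_fun setT l.
  apply: (measurableT_comp (fine_measurable measurableT)).
  apply: measurable_fun_limn_esup => n; apply/measurable_EFinP.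
  apply: measurable_funM => //; apply: measurable_funB => //.
  by apply: (measurableT_comp mf1); exact: measurable_funD.
have mW := locint_measurable increment_bound_locint.
have mA : measurable ([set x | `|l x| <= W x] `&` U).
  apply: measurableI; last exact: open_measurable.
  rewrite -[X in measurable X]setTI.
  have -> : [set x | `|l x| <= W x] = [set x | (`|l x|%:E <= (W x)%:E)%E].
    by apply/seteqP; split=> x /=; rewrite lee_fin.
  apply: measurable_lee => //; first exact/measurable_EFinP/measurableT_comp.
  exact/measurable_EFinP.
have -> : f2 = fun x => l x * \1_([set x | `|l x| <= W x] `&` U) x.
  apply/funext => x; rewrite /second_derivative -/(l x) indicE.
  case: ifPn => [/andP[lW /set_mem Ux]|].
    by rewrite mem_set ?mulr1.
  by move=> H; rewrite memNset ?mulr0// => -[/= lW Ux]; move: H; rewrite lW mem_set.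
by apply: measurable_funM => //; apply: measurable_indic.
Qed.

Lemma second_derivative_locint : locally_integrable setT f2.
Proof.
apply: locintP => [|n]; first exact: second_derivative_measurable.
apply: (le_integrable _ _ _ (locint_seg _ _ increment_bound_locint)) => //.
  by apply/measurable_EFinP/measurable_funTS; exact: second_derivative_measurable.
move=> x _; rewrite /= lee_fin (ger0_norm (increment_bound_ge0 x)).
exact: second_derivative_bound.
Qed.

(** The density given by [local_density] depends on the segment, but almost
    everywhere it is the limit of the difference quotients and lies within the
    bounds, hence equals [second_derivative]. *)
Lemma second_derivative_primitive c d : c <= d -> `[c, d] `<=` U ->
  f1 d - f1 c = \int[mu]_(t in `[c, d]) f2 t.
Proof.
rewrite le_eqVlt => /predU1P[->|cd] cdU.
  by rewrite subrr set_itv1 Rintegral_set1.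
have [rho Lrho rhoE] := local_density cd cdU.
rewrite (rhoE _ _ (lexx _) (ltW cd) (lexx _)).
have [V pV] : exists V, is_primitive V rho by eexists; exact: is_primitive_integral Lrho.
have [Z pZ] : exists Z, is_primitive Z W by eexists; exact: is_primitive_integral increment_bound_locint.
apply: ae_eq_Rintegral => //.
- by apply: measurable_funTS; exact: locint_measurable.
- by apply: measurable_funTS; exact: second_derivative_measurable.
have ae1 := is_primitive_ae_derive Lrho pV.
have ae2 := is_primitive_ae_derive increment_bound_locint pZ.
have ae3 : {ae mu, forall x : R, x != d}.
  exists [set d]; split => //; first exact: lebesgue_measure_set1.
  by move=> x /= /negP; rewrite negbK => /eqP.
apply: ae_imply (ae_and (ae_and ae1 ae2) ae3) => x [[dV dZ] xd].
rewrite /= in_itv/= => /andP[cx]; rewrite le_eqVlt (negPf xd)/= => xd'.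
have qV : {near (0 : R)^'+, quotient V x =1 quotient f1 x}.
  near=> s; have s_gt0 : 0 < s by near: s; exact: nbhs_right_gt.
  have sd : s <= d - x by near: s; apply: nbhs_right_le; rewrite subr_gt0.
  rewrite /quotient pV ?lerDl ?(ltW s_gt0)// -rhoE//; lra.
have cf1 : quotient f1 x s @[s --> 0^'+] --> rho x.
  by apply: cvg_trans (is_derive_quotient dV); apply: near_eq_cvg; exact: qV.
have lE : fine (limn_esup (fun n => (quotient f1 x n.+2%:R^-1)%:E)) = rho x.
  have H : (quotient f1 x n.+2%:R^-1)%:E @[n --> \oo] --> (rho x)%:E.
    by apply: cvg_EFin; [exact: nearW|exact: cvg_quotient_harmonic].
  by have [_ ->] := cvg_limn_einf_sup H.
rewrite /second_derivative lE ifT//.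
have Ux : U x by apply: cdU; rewrite /= in_itv/= cx ltW.
rewrite mem_set// andbT ler_norml; apply/andP; split.
- have lo : - (4 * B) <= rho x.
    apply: (ler_cvg_to (cvg_cst (- (4 * B))) cf1); near=> s.
    have s_gt0 : 0 < s by near: s; exact: nbhs_right_gt.
    have := @F_nd x (x + s); rewrite lerDl ltW// => /(_ isT); rewrite /F => Fs.
    by rewrite /quotient ler_pdivlMl//; lra.
  apply: le_trans lo; rewrite lerN2 /W /increment_bound lerDr.
  by rewrite !mulr_ge0.
- apply: (ler_cvg_to cf1 (is_derive_quotient dZ)); near=> s.
  have s_gt0 : 0 < s by near: s; exact: nbhs_right_gt.
  have sd : s <= d - x by near: s; apply: nbhs_right_le; rewrite subr_gt0.
  rewrite /quotient ler_pM2l ?invr_gt0// pZ ?lerDl ?(ltW s_gt0)//.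
  have xs : x <= x + s by rewrite lerDl ltW.
  have := F_increment xs _.
  have sub : `[x, x + s] `<=` U.
    move=> y; rewrite /= in_itv/= => /andP[xy ys]; apply: cdU.
    by rewrite /= in_itv/= (le_trans cx)//=; lra.
  move=> /(_ sub); apply: le_trans; rewrite /F.
  have : 0 <= 4 * B * s by rewrite !mulr_ge0// ltW.
  lra.
Unshelve. all: by end_near. Qed.

End SecondDerivative.

Lemma second_derivative_periodic (R : realType) (h w : R -> R) (B K : R) (U : set R) :
  circle_periodic h -> circle_periodic w -> (forall t, U (t + 2 * pi) <-> U t) ->
  circle_periodic (second_derivative h w B K U).
Proof.
move=> ph pw pU t; rewrite /second_derivative /increment_bound pw.
have -> : ((t + 2 * pi)%R \in U) = (t \in U).
  by apply/idP/idP => /set_mem/pU/mem_set.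
have -> // : (fun n => (quotient (right_derivative h) (t + 2 * pi) n.+2%:R^-1)%:E) =
  (fun n => (quotient (right_derivative h) t n.+2%:R^-1)%:E).
apply/funext => n; rewrite /quotient addrAC.
by rewrite !(right_derivative_periodic ph).
Qed.

(** * Weak derivatives on an open set *)

Section LocalWeakDerivative.
Context {R : realType}.
Local Notation mu := (@lebesgue_measure R).
Implicit Types (f g : R -> R) (U D : set R).

Lemma locint_open f U : open U -> locally_integrable setT f -> locally_integrable U f.
Proof.
move=> oU [mf _ If]; split => //; last by move=> K _; exact: If.
exact: measurable_funTS.
Qed.

Lemma test_function_out U phi x : test_function U phi -> ~ U x -> phi x = 0.
Proof.
move=> [_ _ SU] nU; apply: contrapT => /eqP px; apply: nU; apply: SU.
exact: subset_closure.
Qed.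

Lemma test_function_near U phi x : test_function U phi -> ~ U x ->
  \forall y \near x, phi y = 0 /\ derive1 phi y = 0.
Proof.
move=> [_ _ SU] nU; pose S := closure [set x | phi x != 0].
have oS : open (~` S) by apply: closed_openC; exact: closed_closure.
have Sx : (~` S) x by move=> /SU.
have S0 y : (~` S) y -> phi y = 0.
  by move=> nS; apply: contrapT => /eqP py; apply: nS; exact: subset_closure.
have := open_nbhs_nbhs (conj oS Sx); apply: filterS => y Sy; split; first exact: S0.
rewrite derive1E -(@near_eq_derive _ _ _ (cst 0) phi y 1) ?derive_cst//.
by have := open_nbhs_nbhs (conj oS Sy); apply: filterS => z /S0 ->.
Qed.

Lemma derive1_test_out U phi x : test_function U phi -> ~ U x -> derive1 phi x = 0.
Proof. by move=> tphi nU; have /nbhs_singleton[] := test_function_near tphi nU. Qed.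

Lemma locally_constant (D : R -> R) : (forall x, \forall y \near x, D y = D x) ->
  forall x y, D x = D y.
Proof.
move=> lc x y; have dD z : is_derive z (1 : R) D 0.
  apply: (@near_eq_is_derive _ _ _ (cst (D z))).
  by have := lc z; apply: filterS => t ->.
have := @mvt_lip _ D (fun=> 0) 0 dD (fun x => _) y x; rewrite mul0r => H.
apply/eqP; rewrite -subr_eq0 -normr_le0; apply: H.
by move=> z; rewrite normr0.
Qed.

(** Testing is local: near every point of [U] integration by parts applies, off
    the support of the test function everything vanishes, so that the two sides
    differ by the increment of a locally constant function. *)
Lemma weak_derivative_local U f g : open U -> locally_integrable setT f ->
  locally_integrable setT g ->
  (forall c d, c <= d -> `[c, d] `<=` U -> f d - f c = \int[mu]_(t in `[c, d]) g t) ->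
  weak_derivative U f g.
Proof.
move=> oU If Ig fg; split; [exact: locint_open|exact: locint_open|].
move=> phi tphi; have sphi := test_function_smooth tphi.
have cphi := smooth_continuous sphi.
have cd := smooth_continuous (smooth_derive1 sphi).
have pphi : is_primitive phi (derive1 phi).
  exact: derive_is_primitive (smooth_is_derive sphi) cd.
have Ifd : locally_integrable setT (fun x => f x * derive1 phi x) by exact: locint_cM.
have Igp : locally_integrable setT (fun x => g x * phi x) by exact: locint_cM.
pose k x := f x * derive1 phi x + g x * phi x.
have Ik : locally_integrable setT k by exact: locintD.
have [V pV] : exists V, is_primitive V k by eexists; exact: is_primitive_integral Ik.
have [Z pZ] : exists Z, is_primitive Z g by eexists; exact: is_primitive_integral Ig.
pose D x := f x * phi x - V x.
have loc x : exists2 e : R, 0 < e & forall c d, x - e < c -> c <= d -> d < x + e ->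
    f d * phi d - f c * phi c = \int[mu]_(t in `[c, d]) k t.
  have [Ux|nU] := pselect (U x).
    have /nbhs_ballP[e /= e0 He] := open_nbhs_nbhs (conj oU Ux).
    exists e => // c d xc cd' dx.
    have sub : `[c, d] `<=` U.
      move=> t; rewrite /= in_itv/= => /andP[ct td]; apply: He.
      rewrite -ball_normE/= ltr_norml; apply/andP; split; lra.
    have sub' t : c <= t <= d -> f t = Z t + (f c - Z c).
      move=> /andP[ct td].
      have := fg c t ct; rewrite -(pZ _ _ ct) => H.
      suff E : f t - f c = Z t - Z c by lra.
      apply: H => y; rewrite /= in_itv/= => /andP[cy yt]; apply: sub.
      by rewrite /= in_itv/= cy (le_trans yt).
    have pZ' : is_primitive (fun t => Z t + (f c - Z c)) g.
      by move=> y z yz; rewrite -(pZ _ _ yz); ring.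
    have := is_primitive_ibp cd' Ig (continuous_locint cd) pZ' pphi.
    rewrite -!sub' ?lexx ?cd'// => ibp.
    rewrite /k RintegralD_seg//.
    rewrite (_ : \int[mu]_(t in `[c, d]) (f t * derive1 phi t) =
      \int[mu]_(t in `[c, d]) (derive1 phi t * (Z t + (f c - Z c)))); last first.
      by apply: eq_Rintegral => t; rewrite inE/= in_itv/= => tcd; rewrite -sub'// mulrC.
    by rewrite ibp; ring.
  have /nbhs_ballP[e /= e0 He] := test_function_near tphi nU.
  exists e => // c d xc cd' dx.
  have p0 t : c <= t <= d -> phi t = 0 /\ derive1 phi t = 0.
    move=> /andP[ct td]; apply: He; rewrite -ball_normE/= ltr_norml.
    by apply/andP; split; lra.
  have [|-> _] := p0 c; first by rewrite lexx.
  have [|-> _] := p0 d; first by rewrite lexx cd'.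
  rewrite !mulr0 subrr; apply/esym.
  rewrite -[RHS](_ : \int[mu]_(t in `[c, d]) 0 = 0); last by rewrite Rintegral_seg_cst// mul0r.
  apply: eq_Rintegral => t; rewrite inE/= in_itv/= => tcd.
  by rewrite /k; have [-> ->] := p0 t tcd; rewrite !mulr0 addr0.
have Dcst : forall x y, D x = D y.
  apply: locally_constant => x; have [e e0 He] := loc x.
  apply/nbhs_ballP; exists e => //= y; rewrite -ball_normE/= ltr_norml => /andP[y1 y2].
  have [xy|/ltW yx] := leP x y.
    have := He x y; rewrite -(pV _ _ xy) /D => H.
    suff : f y * phi y - f x * phi x = V y - V x by lra.
    by apply: H => //; lra.
  have := He y x; rewrite -(pV _ _ yx) /D => H.
  suff : f x * phi x - f y * phi y = V x - V y by lra.
  by apply: H => //; lra.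
have [n p0] := test_function_seg tphi.
have nn : - (n.+1)%:R <= (n.+1)%:R :> R by rewrite -subr_ge0 opprK addr_ge0.
have pn : phi n.+1%:R = 0.
  by apply: p0; rewrite negb_and -!ltNge ltr_nat ltnSn orbT.
have pm : phi (- n.+1%:R) = 0.
  by apply: p0; rewrite negb_and -!ltNge ltrN2 ltr_nat ltnSn.
have := Dcst n.+1%:R (- n.+1%:R); rewrite /D pn pm !mulr0 !sub0r => /oppr_inj VV.
have := pV _ _ nn; rewrite VV subrr RintegralD_seg// => E.
have toU (u p : R -> R) : (forall x, ~ U x -> p x = 0) ->
    (forall x, ~~ (- n%:R <= x <= n%:R) -> p x = 0) ->
    \int[mu]_(x in U) (u x * p x) = \int[mu]_(x in `[- n.+1%:R, n.+1%:R]) (u x * p x).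
  move=> pU pn'; apply: Rintegral_eq_support => x.
    move=> _ xn; rewrite pn' ?mulr0//; apply/negP => /andP[x1 x2]; apply: xn.
    rewrite /= in_itv/= (le_trans _ x1) ?lerN2 ?ler_nat//=.
    by rewrite (le_trans x2) ?ler_nat.
  by move=> _ /pU ->; rewrite mulr0.
rewrite (toU f _ (fun x => derive1_test_out tphi) (derive1_out p0)).
rewrite (toU g _ (fun x => test_function_out tphi) p0).
by apply/eqP; rewrite -subr_eq0 opprK -E.
Qed.

End LocalWeakDerivative.

(** * Strict convexity *)

Section StrictConvexity.
Context {R : realType}.
Local Notation mu := (@lebesgue_measure R).

Lemma open_strictly_between (k1 k2 : R -> \bar R) h : upper_semicontinuous k1 ->
  lower_semicontinuous k2 -> continuous h -> open (strictly_between k1 k2 h).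
Proof.
move=> u1 l2 ch; rewrite openE => t /andP[kh hk].
have [a ka ah] : exists2 a : R, (k1 t < a%:E)%E & a < h t.
  move: kh; case: (k1 t) => [u| |]//.
    rewrite lte_fin => uh; exists ((u + h t) / 2); rewrite ?lte_fin; lra.
  by move=> _; exists (h t - 1); [rewrite ltNyr|lra].
have [b bk hb] : exists2 b : R, (b%:E < k2 t)%E & h t < b.
  move: hk; case: (k2 t) => [u| |]//.
    rewrite lte_fin => uh; exists ((u + h t) / 2); rewrite ?lte_fin; lra.
  by move=> _; exists (h t + 1); [rewrite ltry|lra].
have [V Vt HV] : exists2 V, nbhs t V & forall y, V y -> ((- a)%:E < - k1 y)%E.
  by apply: u1; rewrite EFinN lteN2.
have [V' Vt' HV'] := l2 _ _ bk.
near=> y; apply/andP; split.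
  have : (k1 y < a%:E)%E by rewrite -lteN2 -EFinN; apply: HV; near: y.
  move=> /lt_trans; apply; rewrite lte_fin.
  by near: y; apply: (cvgr_gt (h t) (ch t) _ ah).
have : (b%:E < k2 y)%E by apply: HV'; near: y.
apply: lt_trans; rewrite lte_fin.
by near: y; apply: (cvgr_lt (h t) (ch t) _ hb).
Unshelve. all: by end_near. Qed.

Variables (h w : R -> R) (Om : set (R * R)) (K s0 : R) (U : set R).
Hypotheses (hOm : is_Omega h Om) (Lw : locally_integrable setT w) (oU : open U)
  (s00 : 0 < s0)
  (mid : forall c s, 0 < s <= s0 -> `[c - s, c + s] `<=` U ->
    h (c + s) + h (c - s) - 2 * h c <= K * s * \int[mu]_(t in `[c - s, c + s]) w t).

Lemma dot_le_support x t : closure Om x -> dot x (eitheta t) <= h t.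
Proof.
move=> clx; have [oOm Om0 bOm _ <-] := hOm.
have [B B0 OmB] := bounded_in_box bOm.
exact: (support_ub (closure_in_box OmB)).
Qed.

(** A segment in a supporting line orthogonal to [eitheta t] makes a corner of
    [h] at [t], which second differences of order [o(s)] exclude. *)
Lemma no_corner x y t : U t -> closure Om x -> closure Om y ->
  dot x (eitheta t) = h t -> dot y (eitheta t) = h t -> dot' x t <= dot' y t.
Proof.
move=> Ut clx cly xt yt; rewrite leNgt; apply/negP => xy.
set d := dot' x t - dot' y t.
have d0 : 0 < d by rewrite subr_gt0.
have [V pV] : exists V, is_primitive V w by eexists; exact: is_primitive_integral Lw.
have cV := is_primitive_continuous Lw pV.
have lim : s * `|h t| + K * (V (t + s) - V (t - s)) @[s --> (0 : R)^'+] --> 0.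
  have cs : s @[s --> (0 : R)^'+] --> (0 : R) by exact/cvg_at_right_filter/cvg_id.
  rewrite [X in _ --> X](_ : 0 = 0 * `|h t| + K * (V (t + 0) - V (t - 0))); last first.
    by rewrite subr0 addr0 subrr mulr0 mul0r addr0.
  apply: cvgD; first by apply: cvgM => //; exact: cvg_cst.
  apply: cvgM; first exact: cvg_cst.
  apply: cvgB.
    apply: (@cvg_comp _ _ _ (fun s => t + s) V); last exact: cV.
    by apply: cvgD => //; exact: cvg_cst.
  apply: (@cvg_comp _ _ _ (fun s => t - s) V); last exact: cV.
  by apply: cvgB => //; exact: cvg_cst.
have d2 : 0 < d / 2 by rewrite divr_gt0.
have /nbhs_ballP[e /= e0 He] := open_nbhs_nbhs (conj oU Ut).
have : \forall s \near (0 : R)^'+, False.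
  near=> s.
  have s_gt0 : 0 < s by near: s; exact: nbhs_right_gt.
  have ss0 : s <= s0 by near: s; exact: nbhs_right_le.
  have s1 : s <= 1 by near: s; exact: nbhs_right_le.
  have se : s < e by near: s; exact: nbhs_right_lt.
  have small : s * `|h t| + K * (V (t + s) - V (t - s)) < d / 2.
    by near: s; apply: (cvgr_lt _ lim).
  have sub : `[t - s, t + s] `<=` U.
    move=> z; rewrite /= in_itv/= => /andP[z1 z2]; apply: He.
    by rewrite -ball_normE/= ltr_norml; apply/andP; split; lra.
  have := mid _ sub; rewrite s_gt0 ss0 => /(_ isT).
  rewrite -pV; last by lra.
  have h1 := dot_le_support (t + s) clx.
  have h2 := dot_le_support (t - s) cly.
  rewrite dotD xt in h1; rewrite dotD cosN sinN yt in h2.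
  have sn : s / 2 <= sin s by apply: sin_ge_half; rewrite ltW.
  have cs : 2 * (1 - cos s) <= s ^+ 2 by have := cos_ge_quadratic s; lra.
  have cs0 : 0 <= 2 * (1 - cos s) by rewrite mulr_ge0// subr_ge0 cos_le1.
  have dsn : d * (s / 2) <= d * sin s by rewrite ler_pM2l.
  have hc : 2 * (1 - cos s) * h t <= s ^+ 2 * `|h t|.
    apply: (@le_trans _ _ (2 * (1 - cos s) * `|h t|)).
      by rewrite ler_wpM2l// ler_norm.
    by rewrite ler_wpM2r.
  have sm : s * (s * `|h t| + K * (V (t + s) - V (t - s))) < s * (d / 2) by rewrite ltr_pM2l.
  move: dsn; rewrite /d; move: h1 h2 hc sm; rewrite /d.
  move: (V (t + s) - V (t - s)) (sin s) (cos s) (`|h t|) => v sn' cs' ah h1 h2 hc sm dsn M.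
  have E1 : s * (s * ah + K * v) = s ^+ 2 * ah + K * s * v by ring.
  rewrite E1 in sm.
  lra.
by move=> /filter_ex[].
Unshelve. all: by end_near. Qed.

(** A supporting line through the midpoint of a segment contains both ends,
    and [no_corner] in both directions gives them the same coordinate on that
    line. *)
Lemma no_boundary_segment : contains_no_segment (boundary_part Om h U).
Proof.
move=> x y xy seg.
have [|[clx _] _] := seg 0; first by rewrite lexx ler01.
have [|[cly _] _] := seg 1; first by rewrite lexx ler01.
rewrite subr0 scale1r scale0r addr0 in clx.
rewrite subrr scale1r scale0r add0r in cly.
have h01 : 0 <= (2^-1 : R) <= 1 by rewrite invr_ge0 ler0n/= invf_le1// ler1n.
have [_ [t Ut]] := seg 2^-1 h01.
rewrite dot_combination => E.
have hx := dot_le_support t clx; have hy := dot_le_support t cly.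
have xt : dot x (eitheta t) = h t by lra.
have yt : dot y (eitheta t) = h t by lra.
have D : dot' x t = dot' y t.
  apply/eqP; rewrite eq_le (no_corner Ut clx cly xt yt)/=.
  exact: (no_corner Ut cly clx yt xt).
move: xy => /eqP; apply; move: D xt; rewrite -yt !dot_eitheta /dot'.
move: (cos2Dsin2 t); move: x y {seg clx cly E hx hy yt} => [x1 x2] [y1 y2] /=.
move: (cos t) (sin t) => c s cs D1 D2.
have e1 : x1 = y1.
  have -> : x1 = (x1 * c + x2 * s) * c - (x2 * c - x1 * s) * s.
    by rewrite -[LHS]mulr1 -cs; ring.
  by rewrite D1 D2 -[RHS]mulr1 -cs; ring.
have e2 : x2 = y2.
  have -> : x2 = (x1 * c + x2 * s) * s + (x2 * c - x1 * s) * c.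
    by rewrite -[LHS]mulr1 -cs; ring.
  by rewrite D1 D2 -[RHS]mulr1 -cs; ring.
by rewrite e1 e2.
Qed.

End StrictConvexity.

(** * Regularity of optimal shapes *)

Theorem corollary3p16 (R : realType)
  (S_ad : set (set (R * R))) (k1 k2 : R -> \bar R)
  (J Rfun Cfun : set (R * R) -> R)
  (p : \bar R) (r : (R -> R) -> R) (G : R * R * R -> R)
  (h0 : R -> R) (Om0 : set (R * R))
  (S_ad_open : forall Om, S_ad Om -> open Om)
  (k1_periodic : circle_periodic k1) (k2_periodic : circle_periodic k2)
  (k1_ge0 : forall t, (0 <= k1 t)%E) (k2_ge0 : forall t, (0 <= k2 t)%E)
  (k1_usc : upper_semicontinuous k1) (k2_lsc : lower_semicontinuous k2)
  (F_ad : forall h Om, W1inf h -> convex_support h -> is_Omega h Om ->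
     (S_ad Om <-> between k1 k2 h))
  (h0_W1inf : W1inf h0) (h0_convex : convex_support h0)
  (h0_Om0 : is_Omega h0 Om0) (h0_gt0 : forall t, 0 < h0 t)
  (Om0_adm : S_ad Om0)
  (Om0_opt : forall Om, S_ad Om -> convex_domain Om -> J Om0 <= J Om)
  (J_sum : forall Om, J Om = Rfun Om + Cfun Om)
  (Rfun_r : forall h Om, W1inf h -> convex_support h -> is_Omega h Om ->
     between k1 k2 h -> Rfun Om = r h)
  (Cfun_G : forall h Om, W1inf h -> convex_support h -> is_Omega h Om ->
     between k1 k2 h ->
     (Cfun Om)%:E =
       (\int[lebesgue_measure]_(t in period) (G (t, h t, wderiv h t))%:E)%E)
  (p_ge1 : (1 <= p)%E)
  (r_C1 : C1_around r h0)
  (G_periodic : forall u q, circle_periodic (fun t => G (t, u, q)))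
  (G_C2 : C2_around (jet_hull h0) G)
  (r_Lp : derivative_in_Lp p r h0)
  (G_qq : forall x, jet_hull h0 x ->
     0 < 'D_((0, 0, 1) : R * R * R) ('D_((0, 0, 1) : R * R * R) G) x) :
  W2p p (strictly_between k1 k2 h0) h0 /\
  contains_no_segment (boundary_part Om0 h0 (strictly_between k1 k2 h0)).

Proof.
have [B hB] := is_Omega_support_like h0_Om0.
have [L [rL [g gLp Lg]]] := r_Lp.
have [U0 [oU0 hullU0 C2G]] := G_C2.
have Ig := Lp_locint p_ge1 gLp.
have g_periodic : circle_periodic g by case: gLp.
have [K [s0 [K0 s00 mid]]] := midpoint_estimate k2_periodic k2_lsc F_ad h0_Om0
  h0_gt0 Om0_adm Om0_opt J_sum Rfun_r Cfun_G hB oU0 hullU0 C2G G_qq k1_periodic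
  G_periodic rL Ig g_periodic Lg.
have hper := slike_periodic hB.
have hcont := slike_continuous hB.
pose U := strictly_between k1 k2 h0.
have oU : open U by exact: open_strictly_between.
have pU t : U (t + 2 * pi) <-> U t.
  by rewrite /U /strictly_between/= k1_periodic k2_periodic hper.
pose w t := `|g t| + 1.
have w_ge0 t : 0 <= w t by rewrite addr_ge0.
have w_periodic : circle_periodic w by move=> t; rewrite /w g_periodic.
have Lw : locally_integrable setT w.
  by apply: locintD; [exact: locint_norm|exact: locint_cst].
have B0 := slike_ge0 hB.
split; last exact: (no_boundary_segment h0_Om0 Lw oU s00 mid).
pose f1 := right_derivative h0.
pose f2 := second_derivative h0 w B K U.
have mU : measurable U by exact: open_measurable.
have le2B (x c : R) : `|x| <= 2 * B -> `|x| <= 2 * B * (`|c| + 1).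
  by move=> /le_trans; apply; rewrite ler_peMr ?mulr_ge0// lerDr.
exists f1, f2; split.
- apply: (@Lp_circle_dominated _ _ _ g (2 * B)) => //; first by rewrite mulr_ge0.
    exact: locint_measurable (continuous_locint hcont).
  by move=> t; apply: le2B; case: hB.
- apply: (@Lp_circle_dominated _ _ _ g (2 * B)) => //; first by rewrite mulr_ge0.
  + exact: slike_rd_periodic hB.
  + exact: slike_rd_measurable hB.
  + by move=> t; apply: le2B; exact: (slike_rd_bound hB).
- apply: (@Lp_circle_dominated _ _ _ g (2 * K + 4 * B)) => //.
  + by rewrite addr_ge0 ?mulr_ge0.
  + exact: second_derivative_periodic.
  + exact: second_derivative_measurable.
  + move=> t; rewrite (le_trans (second_derivative_bound U hB w_ge0 K0 t))//.
    rewrite /increment_bound /w [leRHS]mulrDl lerD2l ler_peMr ?mulr_ge0//.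
    by rewrite lerDr.
- apply: weak_derivative_local => //.
  + exact: continuous_locint.
  + exact: slike_rd_locint hB.
  + by move=> c d cd _; exact: (slike_primitive hB cd).
- apply: weak_derivative_local => //.
  + exact: slike_rd_locint hB.
  + exact: second_derivative_locint.
  + move=> c d; exact: (second_derivative_primitive hB Lw w_ge0 oU K0 s00 mid).
Qed.
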